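(* Let $f$ be a pseudo-polynomial. There exist an exponent $\eta>0$ and a constant $C>0$, both depending only on $f$, such that for every real number $\xi$ and every sufficiently large $N\in\mathbb{N}$, \[\min_{\substack{1\le p\le N\\ p\text{ prime}}}\lVert\xi\lfloor f(p)\rfloor\rVert\le C N^{-\eta}.\]
   Context: A pseudo-polynomial is a function $f(x)=\alpha_1x^{\theta_1}+\cdots+\alpha_dx^{\theta_d}$ where $\alpha_1,\dots,\alpha_d,\theta_1,\dots,\theta_d$ are positive reals with $1\le\theta_1<\cdots<\theta_d$ and at least one $\theta_j\notin\mathbb{Z}$. $\lVert x\rVert$ denotes the distance from $x$ to the nearest integer, and $\lfloor\cdot\rfloor$ the floor function. *)

(* Defs.v *)
From Stdlib Require Import Reals Lra Lia ZArith Znumtheory List.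
Open Scope R_scope.

Definition floorZ (x : R) : Z := (up x - 1)%Z.

Definition dist_int (x : R) : R :=
  Rmin (x - IZR (floorZ x)) (IZR (floorZ x) + 1 - x).

(* A pseudo-polynomial given by coefficients alpha_1..alpha_d and exponents
   theta_1..theta_d (indices 0..d-1): f(x) = sum_j alpha_j x^theta_j. *)
Definition is_pseudo_poly (d : nat) (alpha theta : nat -> R) : Prop :=
  (1 <= d)%nat /\
  (forall j, (j < d)%nat -> 0 < alpha j) /\
  1 <= theta 0%nat /\
  (forall j, (S j < d)%nat -> theta j < theta (S j)) /\
  (exists j, (j < d)%nat /\ forall z : Z, theta j <> IZR z).

Definition pseudo_poly (d : nat) (alpha theta : nat -> R) (x : R) : R :=
  fold_right Rplus 0 (map (fun j => alpha j * Rpower x (theta j)) (seq 0 d)).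

(* Main.v *)
Require Import Defs.
From Stdlib Require Import Reals Lra Lia ZArith Znumtheory List.
From Stdlib Require Import Classical.
From Coquelicot Require Complex Hierarchy.
From HB Require structures.
From mathcomp Require all_boot zify.
Open Scope R_scope.

(** Write f for the pseudo-polynomial and e(t) = exp(2 pi i t).

    The core is a power saving for the sum of Lambda(n) e(beta f(n)) over
    M <= n < 2M, uniformly for M^(-1/16) <= |beta| <= M^(1/16). Vaughan's
    identity reduces it to sums of e(g(n)) over intervals, with g(n) = beta f(Dn)
    or g(n) = beta (f(c n) - f(c' n)). The derivatives of g of order k > deg f
    are governed by the largest non-integral exponent of f, so k Weyl
    differencings on blocks of suitable length followed by the Kusmin-Landau
    estimate give the saving.

    Given xi and N, two cases arise. If |k xi - a| < N^(-1/64) with k bounded by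
    a small power of N, take a prime p, again at most a small power of N, for
    which k divides floor(f(p)), i.e. f(p)/k lies in [0, 1/k) modulo 1. Otherwise
    every frequency h + k xi with small h, k lies in the admissible range of
    beta, so (f(p), xi f(p)) is well distributed modulo 1 and for some p <= N
    the number f(p) is slightly above, and xi f(p) close to, an integer. In both
    cases the prime is detected by mean squares of Dirichlet kernels. *)

Module PrimeValues.
Import Coquelicot.Rcomplements Coquelicot.Rbar Coquelicot.Hierarchy Coquelicot.Complex.
Import HB.structures.
Import mathcomp.boot.all_boot mathcomp.zify.zify.
Set Implicit Arguments. Unset Strict Implicit. Unset Printing Implicit Defensive.
(* [all_boot] rebinds the key [R] to [ring_scope]. *)
Delimit Scope R_scope with R.
Open Scope R_scope.
Arguments INR : simpl never.

(** * Finite sums *)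

HB.instance Definition _ := Monoid.isComLaw.Build R 0 Rplus
  (fun x y z => esym (Rplus_assoc x y z)) Rplus_comm Rplus_0_l.
HB.instance Definition _ := Monoid.isMulLaw.Build R 0 Rmult Rmult_0_l Rmult_0_r.
HB.instance Definition _ := Monoid.isAddLaw.Build R Rmult Rplus
  Rmult_plus_distr_r Rmult_plus_distr_l.
HB.instance Definition _ := Monoid.isComLaw.Build C (RtoC 0) Cplus
  Cplus_assoc Cplus_comm Cplus_0_l.
HB.instance Definition _ := Monoid.isMulLaw.Build C (RtoC 0) Cmult Cmult_0_l Cmult_0_r.
HB.instance Definition _ := Monoid.isAddLaw.Build C Cmult Cplus
  Cmult_plus_distr_r Cmult_plus_distr_l.

Reserved Notation "\rsum_ ( m <= i < n | P ) F"
  (at level 41, F at level 41, i, m, n at level 50).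
Reserved Notation "\rsum_ ( m <= i < n ) F"
  (at level 41, F at level 41, i, m, n at level 50).
Reserved Notation "\csum_ ( m <= i < n | P ) F"
  (at level 41, F at level 41, i, m, n at level 50).
Reserved Notation "\csum_ ( m <= i < n ) F"
  (at level 41, F at level 41, i, m, n at level 50).
Notation "\rsum_ ( m <= i < n | P ) F" :=
  (\big[Rplus/0]_(m%N <= i < n%N | P%B) F%R).
Notation "\rsum_ ( m <= i < n ) F" := (\big[Rplus/0]_(m%N <= i < n%N) F%R).
Notation "\csum_ ( m <= i < n | P ) F" :=
  (\big[Cplus/(RtoC 0)]_(m%N <= i < n%N | P%B) F%C).
Notation "\csum_ ( m <= i < n ) F" := (\big[Cplus/(RtoC 0)]_(m%N <= i < n%N) F%C).

Section NatBigops.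
Variables (T : Type) (idx : T).

Lemma big_nat_idx (op : Monoid.law idx) (F : nat -> T) (P : pred nat) a b :
  (forall i, (a <= i < b)%N -> P i -> F i = idx) ->
  \big[op/idx]_(a <= i < b | P i) F i = idx.
Proof. by move=> F0; rewrite big_nat_cond big1 // => i /andP[]; apply: F0. Qed.

Lemma big_nat_convex (op : Monoid.law idx) (F : nat -> T) (P : pred nat) n :
  (forall i j k, (i <= j <= k)%N -> P i -> P k -> P j) ->
  exists a b, (forall i, (a <= i < b)%N -> P i /\ (i < n)%N) /\
    \big[op/idx]_(0 <= i < n | P i) F i = \big[op/idx]_(a <= i < b) F i.
Proof.
move=> convex.
suff [a [b [ab_range P_eq]]] : exists a b, (a <= b <= n)%N /\
    (forall i, (i < n)%N -> P i = (a <= i < b)%N).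
  exists a, b; split=> [i i_range|]; first by rewrite P_eq; lia.
  rewrite (@big_cat_nat _ _ _ a 0 n) ?(@big_cat_nat _ _ _ b a n) //=; try lia.
  rewrite [X in op X _]big_nat_idx => [|i i_range]; last by rewrite P_eq; lia.
  rewrite [X in op _ (op _ X)]big_nat_idx => [|i i_range]; last by rewrite P_eq; lia.
  rewrite Monoid.mul1m Monoid.mulm1 big_mkcond; apply: eq_big_nat => i i_range.
  by rewrite P_eq ?i_range //; lia.
elim: n => [|n [a [b [ab_range P_eq]]]]; first by exists 0%N, 0%N; split.
have eqP_lt c d : (c <= n < d)%N = P n ->
    (forall i, (i < n)%N -> (a <= i < b)%N = (c <= i < d)%N) ->
    forall i, (i < n.+1)%N -> P i = (c <= i < d)%N.
  by move=> Pn eq_ab i; rewrite ltnS leq_eqVlt => /orP[/eqP-> //|lt_in]; rewrite P_eq ?eq_ab.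
case Pn: (P n) eqP_lt => eqP_lt; last first.
  by exists a, b; split; [lia|apply: eqP_lt => //; lia].
case: (ltnP a b) => [lt_ab|le_ba]; last first.
  by exists n, n.+1; split; [lia|apply: eqP_lt => // [|i lt_in]; lia].
have eq_bn : b = n.
  apply/eqP; apply: contraT => ne_bn.
  have Pa : P a by rewrite P_eq; lia.
  have : P b by apply: convex Pa Pn; lia.
  by rewrite P_eq; lia.
by exists a, n.+1; split; [lia|apply: eqP_lt => [|i lt_in]; lia].
Qed.

Lemma big_dyadic (op : Monoid.law idx) (F : nat -> T) h k : (h <= k)%N ->
  \big[op/idx]_(2 ^ h <= c < 2 ^ k) F c =
  \big[op/idx]_(h <= i < k) \big[op/idx]_(2 ^ i <= c < 2 ^ i.+1) F c.
Proof.
move/subnK <-; elim: (k - h)%N => [|m IH]; first by rewrite !big_geq.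
rewrite addSn [RHS]big_nat_recr ?leq_addl //= -IH (@big_cat_nat _ _ _ (2 ^ (m + h))%N) //=.
  by rewrite leq_exp2l // leq_addl.
by rewrite leq_exp2l.
Qed.

Lemma big_modn_divn (op : Monoid.law idx) (F : nat -> nat -> T) K m : (0 < K)%N ->
  \big[op/idx]_(0 <= j < K * m) F (j %% K)%N (j %/ K)%N =
  \big[op/idx]_(0 <= l < m) \big[op/idx]_(0 <= k < K) F k l.
Proof.
move=> K_gt0; elim: m => [|m IH]; first by rewrite muln0 !big_geq.
rewrite [RHS]big_nat_recr //= -IH (@big_cat_nat _ _ _ (K * m)%N) ?leq_mul //=.
congr (op _ _); rewrite -{1}[(K * m)%N]add0n big_addn -mulnBr subSnn muln1.
apply: eq_big_nat => k lt_kK.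
by rewrite addnC mulnC modnMDl modn_small ?divnMDl ?divn_small ?addn0.
Qed.

End NatBigops.

Section Sums.
Implicit Types (a b m n : nat) (P : pred nat) (F G : nat -> R) (z w : nat -> C).

Lemma Cconj_RtoC (x : R) : Cconj (RtoC x) = RtoC x.
Proof. by rewrite /Cconj /= Ropp_0. Qed.

Lemma Cconj_csum a b P z :
  Cconj (\csum_(a <= i < b | P i) z i) = \csum_(a <= i < b | P i) Cconj (z i).
Proof. exact: (big_morph _ Cplus_conj (Cconj_RtoC 0)). Qed.

Lemma Re_csum a b P z :
  Re (\csum_(a <= i < b | P i) z i) = \rsum_(a <= i < b | P i) Re (z i).
Proof. by apply: (big_morph Re). Qed.

Lemma RtoC_rsum a b P F :
  RtoC (\rsum_(a <= i < b | P i) F i) = \csum_(a <= i < b | P i) RtoC (F i).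
Proof. exact: (big_morph _ RtoC_plus). Qed.

Lemma csum_sub a b z w :
  (\csum_(a <= i < b) z i - \csum_(a <= i < b) w i = \csum_(a <= i < b) (z i - w i))%C.
Proof. by rewrite /Cminus big_split /= (big_morph Copp Copp_plus_distr (Copp_0)). Qed.

Lemma rsum_le a b P F G :
  (forall i, (a <= i < b)%N -> P i -> F i <= G i) ->
  \rsum_(a <= i < b | P i) F i <= \rsum_(a <= i < b | P i) G i.
Proof.
move=> le_FG; rewrite big_nat_cond [X in _ <= X]big_nat_cond.
apply: (big_ind2 Rle); [exact: Rle_refl|by move=> *; apply: Rplus_le_compat|].
by move=> i /andP[i_range Pi]; apply: le_FG.
Qed.

Lemma rsum_ge0 a b P F :
  (forall i, (a <= i < b)%N -> P i -> 0 <= F i) ->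
  0 <= \rsum_(a <= i < b | P i) F i.
Proof.
move=> F_ge0; rewrite big_nat_cond; apply: (big_ind (Rle 0)); [exact: Rle_refl| |].
  exact: Rplus_le_le_0_compat.
by move=> i /andP[i_range Pi]; apply: F_ge0.
Qed.

Lemma rsum_le_cond a b P F :
  (forall i, (a <= i < b)%N -> 0 <= F i) ->
  \rsum_(a <= i < b | P i) F i <= \rsum_(a <= i < b) F i.
Proof.
move=> F_ge0; rewrite big_mkcond; apply: rsum_le => i i_range _.
by case: (P i); [apply: Rle_refl|apply: F_ge0].
Qed.

Lemma rsum_const a b c : \rsum_(a <= i < b) c = INR (b - a) * c.
Proof.
rewrite big_const_nat; elim: (b - a)%N => [|n IH]; first by rewrite INR_0 /=; lra.
by rewrite iterS IH S_INR; lra.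
Qed.

Lemma rsum_le_const a b P F c : 0 <= c ->
  (forall i, (a <= i < b)%N -> P i -> F i <= c) ->
  \rsum_(a <= i < b | P i) F i <= INR (b - a) * c.
Proof.
move=> c_ge0 le_Fc; rewrite -rsum_const.
by apply: Rle_trans (rsum_le_cond _ _); [apply: rsum_le|].
Qed.

Lemma Rabs_rsum a b P F :
  Rabs (\rsum_(a <= i < b | P i) F i) <= \rsum_(a <= i < b | P i) Rabs (F i).
Proof.
apply: (big_ind2 (fun x y => Rabs x <= y)); first by rewrite Rabs_R0; lra.
  by move=> x1 x2 y1 y2 ? ?; have := Rabs_triang x1 y1; lra.
by move=> j _; lra.
Qed.

Lemma Cmod_csum a b P z :
  Cmod (\csum_(a <= i < b | P i) z i) <= \rsum_(a <= i < b | P i) Cmod (z i).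
Proof.
apply: (big_ind2 (fun x y => Cmod x <= y)); first by rewrite Cmod_0; lra.
  by move=> x1 x2 y1 y2 ? ?; have := Cmod_triangle x1 y1; lra.
by move=> i _; lra.
Qed.

Lemma csum_le_const a b P z c : 0 <= c ->
  (forall i, (a <= i < b)%N -> P i -> Cmod (z i) <= c) ->
  Cmod (\csum_(a <= i < b | P i) z i) <= INR (b - a) * c.
Proof. by move=> *; apply: Rle_trans (Cmod_csum _ _ _ _) _; apply: rsum_le_const. Qed.

Lemma discriminant_le x y t : 0 <= y ->
  (forall s, 0 <= s ^ 2 * y - 2 * s * x + t) -> x ^ 2 <= y * t.
Proof.
move=> y_ge0 q_ge0; case: (Req_dec y 0) => [y0|y_neq0].
  suff -> : x = 0 by rewrite y0; lra.
  apply: NNPP => x_neq0; have := q_ge0 ((t + 1) / (2 * x)).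
  have -> : 2 * ((t + 1) / (2 * x)) * x = t + 1 by field.
  by rewrite y0; lra.
have := q_ge0 (x / y).
have -> : (x / y) ^ 2 * y - 2 * (x / y) * x + t = t - x ^ 2 / y by field.
by move=> le_t; rewrite Rmult_comm; apply/Rle_div_l; lra.
Qed.

Lemma rsum_cauchy_schwarz a b P F G :
  (\rsum_(a <= i < b | P i) (F i * G i)) ^ 2 <=
  (\rsum_(a <= i < b | P i) F i ^ 2) * (\rsum_(a <= i < b | P i) G i ^ 2).
Proof.
apply: discriminant_le => [|s]; first by apply: rsum_ge0 => i _ _; apply: pow2_ge_0.
suff -> : s ^ 2 * (\rsum_(a <= i < b | P i) F i ^ 2) -
    2 * s * (\rsum_(a <= i < b | P i) (F i * G i)) + \rsum_(a <= i < b | P i) G i ^ 2 =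
    \rsum_(a <= i < b | P i) (s * F i - G i) ^ 2.
  by apply: rsum_ge0 => i _ _; apply: pow2_ge_0.
rewrite /Rminus Ropp_mult_distr_l !big_distrr -!big_split /=.
by apply: eq_bigr => i _; ring.
Qed.

Lemma rsum_chebyshev a b F m : (forall i, 0 <= F i) ->
  (\rsum_(a <= i < b) F i) * (\rsum_(a <= i < b) F i ^ m) <=
  INR (b - a) * \rsum_(a <= i < b) F i ^ m.+1.
Proof.
move=> F_ge0; set s1 := \rsum_(a <= i < b) F i.
set sm := \rsum_(a <= i < b) F i ^ m; set sm1 := \rsum_(a <= i < b) F i ^ m.+1.
have : 0 <= \rsum_(a <= i < b) \rsum_(a <= k < b) ((F i - F k) * (F i ^ m - F k ^ m)).
  apply: rsum_ge0 => i _ _; apply: rsum_ge0 => k _ _.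
  case: (Rle_or_lt (F i) (F k)) => [le_ik|/Rlt_le le_ki].
    by have := pow_incr (F i) (F k) m (conj (F_ge0 i) le_ik); nra.
  by have := pow_incr (F k) (F i) m (conj (F_ge0 k) le_ki); nra.
have -> : \rsum_(a <= i < b) \rsum_(a <= k < b) ((F i - F k) * (F i ^ m - F k ^ m)) =
    \rsum_(a <= i < b) (INR (b - a) * F i ^ m.+1 + sm1 + (- sm * F i + - s1 * F i ^ m)).
  apply: eq_bigr => i _; rewrite -rsum_const ![_ * F i]Rmult_comm [_ * F i ^ m]Rmult_comm.
  rewrite (big_morph Ropp Ropp_plus_distr Ropp_0) [- s1](big_morph Ropp Ropp_plus_distr Ropp_0).
  by rewrite !big_distrr -!big_split /=; apply: eq_bigr => k _; ring.
rewrite !big_split /= -!big_distrr /= rsum_const -/s1 -/sm -/sm1; lra.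
Qed.

Lemma rsum_power_mean a b F m : (forall i, 0 <= F i) ->
  (\rsum_(a <= i < b) F i) ^ m.+1 <= INR (b - a) ^ m * \rsum_(a <= i < b) F i ^ m.+1.
Proof.
move=> F_ge0; have n_ge0 := pos_INR (b - a).
have sum_ge0 : 0 <= \rsum_(a <= i < b) F i by apply: rsum_ge0.
elim: m => [|m IH].
  rewrite /= Rmult_1_l Rmult_1_r; apply: Req_le; apply: eq_bigr => i _; ring.
rewrite -[_ ^ m.+2]/(_ * _ ^ m.+1); apply: Rle_trans (Rmult_le_compat_l _ _ _ sum_ge0 IH) _.
have := Rmult_le_compat_l _ _ _ (pow_le _ m n_ge0) (rsum_chebyshev a b m.+1 F_ge0).
by rewrite -[INR (b - a) ^ m.+1]/(INR (b - a) * INR (b - a) ^ m); lra.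
Qed.

(* Summation by parts. *)
Lemma csum_monotone_weight_le a b (w : nat -> R) z E W : 0 <= E -> 0 <= W ->
  (forall c, (a <= c)%N -> Cmod (\csum_(c <= n < b) z n) <= E) ->
  (forall n, (a <= n)%N -> (n.+1 < b)%N -> w n <= w n.+1) ->
  (forall n, (a <= n < b)%N -> 0 <= w n <= W) ->
  Cmod (\csum_(a <= n < b) (w n * z n)) <= W * E.
Proof.
move=> E_ge0 W_ge0 tail_le w_mono w_bound.
case: (leqP b a) => [le_ba|lt_ab]; first by rewrite big_geq // Cmod_0; nra.
suff shifted m x : (b - a <= m)%N -> x <= w a ->
    Cmod (\csum_(a <= n < b) (RtoC (w n - x) * z n)) <= (w b.-1 - x) * E.
  have := shifted _ 0 (leqnn _) (proj1 (w_bound a ltac:(lia))).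
  have last_bound := w_bound b.-1 ltac:(lia).
  rewrite (eq_bigr (fun n => (w n * z n)%C)) => [|n _]; last by rewrite Rminus_0_r.
  by move/Rle_trans; apply; nra.
elim: m a lt_ab x tail_le w_mono w_bound => [|m IH] a lt_ab x tail_le w_mono w_bound le_m le_x.
  by lia.
rewrite (eq_bigr (fun n => (RtoC (w a - x) * z n + RtoC (w n - w a) * z n)%C)) => [|n _];
  last first.
  by rewrite !RtoC_minus; ring.
rewrite big_split /= -big_distrr /=.
apply: Rle_trans (Cmod_triangle _ _) _.
have head_le : Cmod (RtoC (w a - x) * \csum_(a <= n < b) z n) <= (w a - x) * E.
  rewrite Cmod_mult Cmod_R Rabs_pos_eq; last lra.
  by apply: Rmult_le_compat_l; [lra|apply: tail_le].
set head := Cmod (RtoC (w a - x) * _) in head_le *.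
rewrite big_ltn // Rminus_diag Cmult_0_l Cplus_0_l.
case: (ltnP a.+1 b) => [lt_Sab|le_bSa]; last first.
  rewrite (_ : b.-1 = a); last by lia.
  by rewrite big_geq // Cmod_0; lra.
have := IH a.+1 lt_Sab (w a) (fun c le_c => tail_le c ltac:(lia))
  (fun n le_n => w_mono n ltac:(lia)) (fun n le_n => w_bound n ltac:(lia))
    ltac:(lia) (w_mono a (leqnn _) lt_Sab).
lra.
Qed.

Lemma csum_blocks_le z (H : nat) E a b : (0 < H)%N -> 0 <= E ->
  (forall c d, (a <= c)%N -> (d <= b)%N -> (d - c <= H)%N -> Cmod (\csum_(c <= n < d) z n) <= E) ->
  Cmod (\csum_(a <= n < b) z n) <= (INR (b - a) / INR H + 1) * E.
Proof.
move=> H_gt0 E_ge0; have INR_H_gt0 : 0 < INR H by apply: lt_0_INR; lia.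
have ratio_ge0 m : 0 <= INR m / INR H by apply: Rdiv_le_0_compat => //; apply: pos_INR.
have [m le_m] : exists m, (b - a <= m)%N by exists (b - a)%N.
elim: m a le_m => [|m IH] a le_m block_le.
  rewrite big_geq; last by lia.
  by rewrite Cmod_0; apply: Rmult_le_pos => //; have := ratio_ge0 (b - a)%N; lra.
case: (leqP (b - a) H) => [le_H|lt_H].
  by apply: Rle_trans (block_le _ _ _ _ le_H) _ => //; have := ratio_ge0 (b - a)%N; nra.
rewrite (@big_cat_nat _ _ _ (a + H)) //=; try lia.
apply: Rle_trans (Cmod_triangle _ _) _.
have first_le : Cmod (\csum_(a <= n < a + H) z n) <= E by apply: block_le; lia.
have rest_le := IH (a + H)%N ltac:(lia) (fun c d le_c => block_le c d ltac:(lia)).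
have -> : INR (b - a) / INR H = INR (b - (a + H)) / INR H + 1.
  have -> : INR (b - a) = INR (b - (a + H)) + INR H by rewrite -plus_INR; congr INR; lia.
  by field; lra.
lra.
Qed.

End Sums.

(** * Growth comparisons *)

Lemma ln_ge0 x : 1 <= x -> 0 <= ln x.
Proof. by move=> x_ge1; rewrite -ln_1; apply: ln_le; lra. Qed.

Lemma ln_le_sub1 x : 0 < x -> ln x <= x - 1.
Proof. by move=> x_gt0; have := exp_ineq1_le (ln x); rewrite exp_ln //; lra. Qed.

Lemma ln_double_le x : 0 < x -> ln (2 * x) <= 1 + ln x.
Proof. by move=> x_gt0; rewrite ln_mult; [have := @ln_le_sub1 2 ltac:(lra)| |]; lra. Qed.

Lemma INR_expn (a i : nat) : INR (a ^ i)%N = INR a ^ i.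
Proof. by elim: i => [|k IH]; [rewrite expn0|rewrite expnS mult_INR IH]. Qed.

Lemma INR_2 : INR 2 = 2.
Proof. by rewrite /INR; lra. Qed.

Lemma INR_exp2_gt0 k : 0 < INR (2 ^ k).
Proof. by rewrite INR_expn; apply: pow_lt; rewrite INR_2; lra. Qed.

Lemma INR_exp2S k : INR (2 ^ k.+1) = 2 * INR (2 ^ k).
Proof. by rewrite expnS mult_INR INR_2. Qed.

Lemma INR_exp2_le i j : (i <= j)%N -> INR (2 ^ i) <= INR (2 ^ j).
Proof. by move=> le_ij; apply: le_INR; apply/leP; rewrite leq_exp2l. Qed.

Lemma INR_le_ln_exp2 k x : 2 ^ k <= x -> INR k <= 2 * ln x.
Proof.
move=> le_x; have pow_gt0 : 0 < 2 ^ k by apply: pow_lt; lra.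
have := ln_le _ _ pow_gt0 le_x; rewrite ln_pow; last lra.
by have := ln_lt_2; have := pos_INR k; nra.
Qed.

Lemma harmonic_le H : (0 < H)%N -> \rsum_(1 <= h < H.+1) / INR h <= 1 + ln (INR H).
Proof.
elim: H => // -[|H] IH _; first by rewrite big_nat1 INR_1 ln_1; lra.
rewrite big_nat_recr //=; have := IH isT.
set n := H.+1; have n_gt0 : 0 < INR n by apply: lt_0_INR; lia.
suff : / INR n.+1 <= ln (INR n.+1) - ln (INR n) by move=> ? ?; lra.
rewrite S_INR.
have : ln (INR n / (INR n + 1)) <= INR n / (INR n + 1) - 1.
  by apply: ln_le_sub1; apply: Rdiv_lt_0_compat; lra.
rewrite ln_div; try lra.
have -> : INR n / (INR n + 1) - 1 = - / (INR n + 1) by field; lra.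
lra.
Qed.

Lemma Rpower_gt0 x y : 0 < Rpower x y.
Proof. exact: exp_pos. Qed.

Lemma Rpower_ge0 x y : 0 <= Rpower x y.
Proof. exact/Rlt_le/Rpower_gt0. Qed.
#[local] Hint Resolve Rpower_gt0 Rpower_ge0 : core.

Lemma Rpower_ge1 x a : 1 <= x -> 0 <= a -> 1 <= Rpower x a.
Proof. by move=> x_ge1 a_ge0; rewrite -(Rpower_O x); [apply: Rle_Rpower|lra]. Qed.

Lemma Rle_Rpower_l_npos x y a : 0 < x <= y -> a <= 0 -> Rpower y a <= Rpower x a.
Proof.
move=> [x_gt0 le_xy] a_le0; rewrite -(Ropp_involutive a) !(Rpower_Ropp _ (- a)).
by apply: Rinv_le_contravar => //; apply: Rle_Rpower_l; lra.
Qed.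

Lemma Rpower_mul_le x y b c : 0 <= c -> Rpower x b <= y -> Rpower x (b * c) <= Rpower y c.
Proof. by move=> c_ge0 le_y; rewrite -Rpower_mult; apply: Rle_Rpower_l. Qed.

Lemma Rpower_mulN_le x y b c : 0 <= c -> Rpower x b <= y -> Rpower y (- c) <= Rpower x (- (b * c)).
Proof.
by move=> c_ge0 le_y; rewrite !Rpower_Ropp; apply: Rinv_le_contravar => //; apply: Rpower_mul_le.
Qed.

Lemma Rpower_mulN x a : Rpower x a * Rpower x (- a) = 1.
Proof. by rewrite -Rpower_plus Rplus_opp_r /Rpower Rmult_0_l exp_0. Qed.

Lemma Rpower_sqr x a : Rpower x a ^ 2 = Rpower x (2 * a).
Proof. by rewrite -Rsqr_pow2 /Rsqr -Rpower_plus; congr Rpower; ring. Qed.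

Lemma sqr_le_mul_Rpower x y c a :
  0 <= y <= c * Rpower x a -> y ^ 2 <= c ^ 2 * Rpower x (2 * a).
Proof. by rewrite -Rpower_sqr -Rpow_mult_distr; apply: pow_incr. Qed.

Lemma pow_le_mul_Rpower_inv x y z m : (0 < m)%N -> 0 <= x -> 0 < y -> 0 < z ->
  x ^ m <= z * y ^ m -> x <= y * Rpower z (/ INR m).
Proof.
move=> m_gt0 [x_gt0|<-] y_gt0 z_gt0 le_x; last by apply: Rmult_le_pos => //; lra.
have INR_m_gt0 : 0 < INR m by apply: lt_0_INR; lia.
have eq_root u : 0 < u -> u = Rpower (u ^ m) (/ INR m).
  by move=> u_gt0; rewrite -Rpower_pow // Rpower_mult Rinv_r ?Rpower_1; lra.
rewrite {1}(eq_root y) // Rpower_mult_distr //; last exact: pow_lt.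
rewrite {1}(eq_root x) //; apply: Rle_Rpower_l; first exact/Rlt_le/Rinv_0_lt_compat.
by split; [apply: pow_lt|rewrite Rmult_comm].
Qed.

Notation for_large := (Rbar_locally p_infty).

Lemma for_large_and (P Q : R -> Prop) :
  for_large P -> for_large Q -> for_large (fun M => P M /\ Q M).
Proof. exact: filter_and. Qed.

Lemma for_large_imp (P Q : R -> Prop) :
  (forall M, P M -> Q M) -> for_large P -> for_large Q.
Proof. exact: filter_imp. Qed.

Lemma for_large_ge c : for_large (fun M => c <= M).
Proof. by exists c => M; apply: Rlt_le. Qed.

Lemma for_large_forall_ord d (P : nat -> R -> Prop) :
  (forall j, (j < d)%N -> for_large (P j)) -> for_large (fun M => forall j, (j < d)%N -> P j M).
Proof.
elim: d => [|d IH] P_large; first exact: filter_forall.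
have := for_large_and (P_large d (leqnn _)) (IH (fun j lt_jd => P_large j (ltnW lt_jd))).
by apply: for_large_imp => M [Pd Pj] j; rewrite ltnS leq_eqVlt => /orP[/eqP-> //|]; apply: Pj.
Qed.

Lemma for_large_mul_Rpower_le C a b : a < b -> for_large (fun M => C * Rpower M a <= Rpower M b).
Proof.
move=> lt_ab; have [C' [C'_ge1 le_C']] : exists C', 1 <= C' /\ C <= C'.
  by exists (Rmax C 1); split; [apply: Rmax_r|apply: Rmax_l].
have := for_large_ge (Rpower C' (/ (b - a))); apply: for_large_imp => M M_large.
have -> : Rpower M b = Rpower M (b - a) * Rpower M a by rewrite -Rpower_plus; congr Rpower; ring.
apply: Rmult_le_compat_r => //; apply: Rle_trans le_C' _.
have := @Rpower_mul_le _ _ _ (b - a) ltac:(lra) M_large.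
by rewrite Rinv_l ?Rpower_1; lra.
Qed.

Lemma for_large_le_Rpower C b : 0 < b -> for_large (fun M => C <= Rpower M b).
Proof.
move=> b_gt0; have := for_large_and (for_large_ge 1) (for_large_mul_Rpower_le C b_gt0).
by apply: for_large_imp => M [M_ge1]; rewrite Rpower_O; lra.
Qed.

Lemma for_large_comp_Rpower (P : R -> Prop) a : 0 < a -> for_large P ->
  for_large (fun M => forall M', Rpower M a <= M' -> P M').
Proof.
move=> a_gt0 [M0 P_large]; have := for_large_le_Rpower (M0 + 1) a_gt0.
by apply: for_large_imp => M M_large M' le_M'; apply: P_large; lra.
Qed.

Lemma for_large_INR (P : R -> Prop) :
  for_large P -> exists N0 : nat, forall N, le N0 N -> P (INR N).
Proof.
move=> [X0 P_large]; have [N0 N0_range] := nfloor_ex (Rmax X0 0) (Rmax_r _ _).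
exists N0.+1 => N le_N; apply: P_large.
by have := le_INR _ _ le_N; rewrite S_INR; have := Rmax_l X0 0; lra.
Qed.

Lemma one_plus_ln_le_Rpower x a : 1 <= x -> 0 < a -> 1 + ln x <= (1 + / a) * Rpower x a.
Proof.
move=> x_ge1 a_gt0; have p_ge1 := Rpower_ge1 x_ge1 (Rlt_le _ _ a_gt0).
have : ln (Rpower x a) <= Rpower x a - 1 by apply: ln_le_sub1.
rewrite ln_Rpower => /(Rmult_le_compat_l (/ a)) ln_le.
have := ln_le (Rlt_le _ _ (Rinv_0_lt_compat _ a_gt0)); rewrite -Rmult_assoc Rinv_l; last lra.
by have := Rinv_0_lt_compat _ a_gt0; lra.
Qed.

Lemma for_large_ln_pow_le C k b : 0 < b -> for_large (fun M => C * (1 + ln M) ^ k <= Rpower M b).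
Proof.
move=> b_gt0; have k_ge0 := pos_INR k; pose a := b / 2 / (INR k + 1).
have a_gt0 : 0 < a by apply: Rdiv_lt_0_compat; lra.
have absorb := for_large_mul_Rpower_le (Rabs C * (1 + / a) ^ k) (_ : b / 2 < b).
have := for_large_and (for_large_ge 1) (absorb ltac:(lra)).
apply: for_large_imp => M [M_ge1 {}absorb].
have ln_M_ge0 := ln_ge0 M_ge1; have inv_gt0 := Rinv_0_lt_compat _ a_gt0.
have pow_ge0 : 0 <= (1 + ln M) ^ k by apply: pow_le; lra.
apply: Rle_trans (Rmult_le_compat_r _ _ _ pow_ge0 (Rle_abs C)) _.
apply: Rle_trans absorb; rewrite Rmult_assoc; apply: Rmult_le_compat_l; first exact: Rabs_pos.
apply: Rle_trans (pow_incr _ _ k (conj _ (one_plus_ln_le_Rpower M_ge1 a_gt0))) _; first lra.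
rewrite Rpow_mult_distr; apply: Rmult_le_compat_l; first by apply: pow_le; lra.
rewrite -Rpower_pow // Rpower_mult; apply: Rle_Rpower => //.
have -> : a * INR k = b / 2 * (INR k / (INR k + 1)) by rewrite /a; field; lra.
have : INR k / (INR k + 1) <= 1 by apply/Rle_div_l; lra.
by nra.
Qed.

(** * Exponential sums: Kusmin-Landau and Weyl differencing *)

Definition expi (t : R) : C := (cos (2 * PI * t), sin (2 * PI * t)).

Lemma expiD s t : expi (s + t) = (expi s * expi t)%C.
Proof.
rewrite /expi /Cmult /= Rmult_plus_distr_l cos_plus sin_plus.
by congr (_, _); ring.
Qed.

Lemma expi_conj t : Cconj (expi t) = expi (- t).
Proof. by rewrite /expi /Cconj /= Ropp_mult_distr_r_reverse cos_neg sin_neg. Qed.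

Lemma expi_sub s t : expi (s - t) = (expi s * Cconj (expi t))%C.
Proof. by rewrite expi_conj -expiD. Qed.

Lemma expi0 : expi 0 = RtoC 1.
Proof. by rewrite /expi Rmult_0_r cos_0 sin_0. Qed.

Lemma Cmod_expi t : Cmod (expi t) = 1.
Proof.
rewrite /Cmod /expi /= !Rmult_1_r.
by rewrite Rplus_comm -[_ + _]/(Rsqr _ + Rsqr _) sin2_cos2 sqrt_1.
Qed.

Lemma expi_INR (n : nat) : expi (INR n) = RtoC 1.
Proof.
rewrite /expi; have -> : 2 * PI * INR n = 0 + 2 * INR n * PI by ring.
by rewrite cos_period sin_period cos_0 sin_0.
Qed.

Lemma expi_IZR (k : Z) : expi (IZR k) = RtoC 1.
Proof.
case: (Z_le_gt_dec 0 k) => k_sign.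
  by rewrite -(Z2Nat.id k) // -INR_IZR_INZ expi_INR.
have -> : IZR k = - INR (Z.to_nat (- k)).
  by rewrite INR_IZR_INZ Z2Nat.id ?opp_IZR; [ring|lia].
by rewrite -expi_conj expi_INR Cconj_RtoC.
Qed.

Lemma Cmod_csum_expi_opp a b u :
  Cmod (\csum_(a <= n < b) expi (- u n)) = Cmod (\csum_(a <= n < b) expi (u n)).
Proof.
by rewrite -Cmod_conj Cconj_csum; congr Cmod; apply: eq_bigr => n _;
  rewrite expi_conj Ropp_involutive.
Qed.

Lemma Cmod_1_expi t : Cmod (1 - expi t) = 2 * Rabs (sin (PI * t)).
Proof.
rewrite -[RHS]Rabs_pos_eq; last by have := Rabs_pos (sin (PI * t)); lra.
rewrite -sqrt_Rsqr_abs /Cmod Rsqr_mult -Rsqr_abs; congr sqrt.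
rewrite /expi /Cminus /Cplus /Copp /= Rmult_assoc cos_2a_sin sin_2a.
have := sin2_cos2 (PI * t); rewrite /Rsqr.
set s := sin _; set c := cos _ => sqr_add.
transitivity (4 * (s * s) * (s * s) + 4 * (s * s) * (c * c)); first by ring.
by rewrite -Rmult_plus_distr_l sqr_add; ring.
Qed.

Lemma Rabs_sin_Rabs x : Rabs (sin x) = Rabs (sin (Rabs x)).
Proof.
case: (Rcase_abs x) => x_sign; last by rewrite (Rabs_right x).
by rewrite (Rabs_left x) // sin_neg Rabs_Ropp.
Qed.

Lemma Rabs_sin_le x : Rabs (sin x) <= Rabs x.
Proof.
rewrite Rabs_sin_Rabs; case: (Rle_or_lt (Rabs x) 1) => x_le1; last first.
  by have := SIN_bound (Rabs x) => ?; apply: Rabs_le; lra.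
have [->|x_neq0] := Req_dec (Rabs x) 0; first by rewrite sin_0 Rabs_R0; lra.
have x_ge0 := Rabs_pos x.
rewrite Rabs_pos_eq; last by apply: sin_ge_0; have := PI2_1; lra.
by apply: Rlt_le; apply: sin_lt_x; lra.
Qed.

Lemma sin_ge_third x : 0 <= x <= PI / 2 -> x / 3 <= sin x.
Proof.
move=> [x_ge0 x_le]; have pi_le4 := PI_4.
have [sin_lower _] := sin_bound x 0 x_ge0 ltac:(lra); apply: Rle_trans sin_lower.
rewrite /sin_approx /sin_term /= !INR_IZR_INZ /=; nra.
Qed.

Lemma Cmod_1_expi_ge t : Rabs t <= / 2 -> Rabs t <= Cmod (1 - expi t).
Proof.
move=> t_le; rewrite Cmod_1_expi Rabs_sin_Rabs Rabs_mult.
have pi_gt3 := PI2_3_2; have t_ge0 := Rabs_pos t.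
rewrite (Rabs_pos_eq PI); last lra.
have := @sin_ge_third (PI * Rabs t) ltac:(nra).
by have := Rle_abs (sin (PI * Rabs t)); nra.
Qed.

Lemma Cmod_1_expi_le t : Cmod (1 - expi t) <= 8 * Rabs t.
Proof.
rewrite Cmod_1_expi; have := Rabs_sin_le (PI * t); rewrite Rabs_mult.
have pi_gt0 := PI_RGT_0; rewrite (Rabs_pos_eq PI); last lra.
by have := PI_4; have := Rabs_pos t; nra.
Qed.

Lemma Cmod_expi_sub s t : Cmod (expi s - expi t) <= 8 * Rabs (s - t).
Proof.
have -> : (expi s - expi t = expi s * (1 - expi (t - s)))%C.
  have {1}-> : t = s + (t - s) by ring.
  by rewrite expiD; ring.
by rewrite Cmod_mult Cmod_expi Rmult_1_l Rabs_minus_sym; apply: Cmod_1_expi_le.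
Qed.

Section KusminLandau.
Variables (u : nat -> R) (L : nat) (lam K : R).
Hypotheses (lam_gt0 : 0 < lam) (lam_le : lam <= / 2) (K_ge0 : 0 <= K).
Hypothesis step_bound : forall n, (n.+1 < L)%N -> lam <= Rabs (u n.+1 - u n) <= / 2.
Hypothesis curvature_bound : forall n, (n.+2 < L)%N ->
  Rabs (u n.+2 - 2 * u n.+1 + u n) * INR L <= K * lam.

(* [expi (u n)] is [c n] times a difference of consecutive terms, and [c] varies
   slowly because [u] is almost linear. *)
Let c n : C := (/ (1 - expi (u n.+1 - u n)))%C.

Let den_ge n : (n.+1 < L)%N -> lam <= Cmod (1 - expi (u n.+1 - u n)).
Proof. by move/step_bound => [ge_lam /Cmod_1_expi_ge]; lra. Qed.

Let den_neq0 n : (n.+1 < L)%N -> (1 - expi (u n.+1 - u n))%C <> RtoC 0.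
Proof. by move=> /den_ge + den0; rewrite den0 Cmod_0; lra. Qed.

Let Cmod_c_le n : (n.+1 < L)%N -> Cmod (c n) <= / lam.
Proof.
by move=> ?; rewrite Cmod_inv; [apply: Rinv_le_contravar => //; apply: den_ge|apply: den_neq0].
Qed.

Let expi_telescope n : (n.+1 < L)%N -> expi (u n) = (c n * (expi (u n) - expi (u n.+1)))%C.
Proof.
move=> /den_neq0 neq0; rewrite /c.
have -> : expi (u n.+1) = (expi (u n) * expi (u n.+1 - u n))%C by rewrite -expiD; congr expi; ring.
by field.
Qed.

Let Cmod_c_sub_le n : (n.+2 < L)%N -> Cmod (c n.+1 - c n) * INR L <= 8 * K / lam.
Proof.
move=> lt_n2; have lt_n1 : (n.+1 < L)%N by lia.
have -> : (c n.+1 - c n = (expi (u n.+2 - u n.+1) - expi (u n.+1 - u n)) * (c n.+1 * c n))%C.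
  by have := den_neq0 lt_n1; have := den_neq0 lt_n2; rewrite /c => ? ?; field.
have num_le : Cmod (expi (u n.+2 - u n.+1) - expi (u n.+1 - u n)) * INR L <= 8 * (K * lam).
  apply: Rle_trans (Rmult_le_compat_r _ _ _ (pos_INR L) (Cmod_expi_sub _ _)) _.
  have -> : u n.+2 - u n.+1 - (u n.+1 - u n) = u n.+2 - 2 * u n.+1 + u n by ring.
  by have := curvature_bound lt_n2; lra.
have cc_le : Cmod (c n.+1 * c n) <= / lam * / lam.
  by rewrite Cmod_mult; apply: Rmult_le_compat (Cmod_c_le lt_n2) (Cmod_c_le lt_n1);
    apply: Cmod_ge_0.
rewrite Cmod_mult Rmult_assoc (Rmult_comm (Cmod (c _ * _))) -Rmult_assoc.
have -> : 8 * K / lam = 8 * (K * lam) * (/ lam * / lam) by field; lra.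
apply: Rmult_le_compat num_le cc_le; last exact: Cmod_ge_0.
by apply: Rmult_le_pos; [apply: Cmod_ge_0|apply: pos_INR].
Qed.

Let telescoped_sum_le m : (m.+1 < L)%N ->
  Cmod (\csum_(0 <= n < m.+1) expi (u n) + c m * expi (u m.+1)) * INR L <=
  / lam * INR L + INR m * (8 * K / lam).
Proof.
elim: m => [|m IH] lt_m.
  rewrite big_nat1 {1}(expi_telescope lt_m).
  have -> : (c 0%N * (expi (u 0%N) - expi (u 1%N)) + c 0%N * expi (u 1%N) =
    c 0%N * expi (u 0%N))%C by ring.
  rewrite Cmod_mult Cmod_expi Rmult_1_r INR_0 Rmult_0_l Rplus_0_r.
  by apply: Rmult_le_compat_r (Cmod_c_le lt_m); apply: pos_INR.
rewrite big_nat_recr // {1}(expi_telescope lt_m) S_INR.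
set s := \csum_(0 <= n < m.+1) _ in IH *.
have -> : (s + c m.+1 * (expi (u m.+1) - expi (u m.+2)) + c m.+1 * expi (u m.+2)
  = (s + c m * expi (u m.+1)) + (c m.+1 - c m) * expi (u m.+1))%C by ring.
have := Cmod_triangle (s + c m * expi (u m.+1)) ((c m.+1 - c m) * expi (u m.+1)).
rewrite Cmod_mult Cmod_expi Rmult_1_r => /(Rmult_le_compat_r _ _ _ (pos_INR L)).
by have := IH ltac:(lia); have := Cmod_c_sub_le lt_m; lra.
Qed.

Lemma kusmin_landau : Cmod (\csum_(0 <= n < L) expi (u n)) <= (3 + 8 * K) / lam.
Proof.
have inv_lam_ge : 2 <= / lam by rewrite -(Rinv_inv 2); apply: Rinv_le_contravar; lra.
have Kinv_ge0 : 0 <= 8 * K / lam by apply: Rdiv_le_0_compat; lra.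
have -> : (3 + 8 * K) / lam = 3 * / lam + 8 * K / lam by field; lra.
case: (leqP L 1) => [L_le1|L_gt1].
  have := @csum_le_const 0 L xpredT (fun n => expi (u n)) 1 ltac:(lra).
  have : INR (L - 0) <= 1 by apply: (le_INR _ 1); lia.
  by move=> ? /(_ (fun n _ _ => Req_le _ _ (Cmod_expi _))); lra.
have [m eq_L] : exists m, L = m.+2 by exists L.-2; lia.
have lt_m : (m.+1 < L)%N by lia.
have L_gt0 : 0 < INR L by apply: lt_0_INR; lia.
have le_mL : INR m <= INR L by apply: le_INR; lia.
have telescoped : Cmod (\csum_(0 <= n < m.+1) expi (u n) + c m * expi (u m.+1)) <=
    / lam + 8 * K / lam.
  by apply: (Rmult_le_reg_r (INR L)) => //; have := telescoped_sum_le lt_m; nra.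
rewrite eq_L big_nat_recr //=; set s := \csum_(0 <= n < m.+1) _ in telescoped *.
have -> : (s + expi (u m.+1) = (s + c m * expi (u m.+1)) + (1 - c m) * expi (u m.+1))%C by ring.
apply: Rle_trans (Cmod_triangle _ _) _; rewrite Cmod_mult Cmod_expi Rmult_1_r.
have := Cmod_triangle 1 (- c m); rewrite Cmod_opp Cmod_1 -/(Cminus _ _).
by have := Cmod_c_le lt_m; lra.
Qed.

End KusminLandau.

Definition autocorrelation (z : nat -> C) (L h : nat) : C :=
  \csum_(0 <= n < L - h) (z (n + h)%N * Cconj (z n)).

Lemma csum_autocorrelation_recr z L :
  \csum_(1 <= h < L.+1) autocorrelation z L.+1 h =
  (\csum_(1 <= h < L) autocorrelation z L h + z L * Cconj (\csum_(0 <= n < L) z n))%C.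
Proof.
rewrite Cconj_csum big_distrr /=.
have -> : \csum_(0 <= n < L) (z L * Cconj (z n)) =
  \csum_(1 <= h < L.+1) (z L * Cconj (z (L - h)%N)).
  rewrite big_add1 /= big_nat_rev /= add0n; apply: eq_big_nat => i lt_i.
  by rewrite subnS.
have -> : \csum_(1 <= h < L) autocorrelation z L h = \csum_(1 <= h < L.+1) autocorrelation z L h.
  case: L => [|L]; first by rewrite !big_geq.
  by rewrite [RHS]big_nat_recr //= {3}/autocorrelation subnn [X in (_ + X)%C]big_geq // Cplus_0_r.
rewrite -big_split /=; apply: eq_big_nat => h lt_h.
rewrite /autocorrelation subSn; last lia.
by rewrite big_nat_recr //=; congr (_ + _ * _)%C; congr z; lia.
Qed.

Lemma Cmod2_csum z L :
  Cmod (\csum_(0 <= n < L) z n) ^ 2 =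
  \rsum_(0 <= n < L) Cmod (z n) ^ 2 + 2 * Re (\csum_(1 <= h < L) autocorrelation z L h).
Proof.
elim: L => [|L IH]; first by rewrite !big_geq // Cmod_0 /=; ring.
rewrite csum_autocorrelation_recr !big_nat_recr //.
set s := \csum_(0 <= n < L) z n in IH *; set t := \csum_(1 <= h < L) _ in IH *.
have -> : Cmod (s + z L) ^ 2 = Cmod s ^ 2 + Cmod (z L) ^ 2 + 2 * Re (z L * Cconj s).
  by rewrite !Cmod2_alt; case: (s) => a b; case: (z L) => a' b' /=; ring.
by rewrite IH re_plus /=; ring.
Qed.

Lemma weyl_differencing z L : (forall n, Cmod (z n) <= 1) ->
  Cmod (\csum_(0 <= n < L) z n) ^ 2 <=
  INR L + 2 * \rsum_(1 <= h < L) Cmod (autocorrelation z L h).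
Proof.
move=> z_le1; rewrite Cmod2_csum; apply: Rplus_le_compat.
  rewrite -[X in _ <= X]Rmult_1_r -{2}(subn0 L); apply: rsum_le_const; first lra.
  by move=> i _ _; have := z_le1 i; have := Cmod_ge_0 (z i); nra.
apply: Rmult_le_compat_l; first lra.
rewrite Re_csum; apply: rsum_le => h _ _.
by apply: Rle_trans (re_le_Cmod _); apply: Rle_abs.
Qed.

Lemma pow_add_le m a b : 0 <= a -> 0 <= b -> (a + b) ^ m <= 2 ^ m * (a ^ m + b ^ m).
Proof.
move=> a_ge0 b_ge0; have pow_a := pow_le a m a_ge0; have pow_b := pow_le b m b_ge0.
have pow2_gt0 : 0 < 2 ^ m by apply: pow_lt; lra.
have [le_max [le_a le_b]] : a + b <= 2 * Rmax a b /\ a <= Rmax a b /\ b <= Rmax a b.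
  by have := Rmax_l a b; have := Rmax_r a b; lra.
apply: Rle_trans (pow_incr _ (2 * Rmax a b) m _) _; first lra.
rewrite Rpow_mult_distr; apply: Rmult_le_compat_l; first lra.
by rewrite /Rmax; case: Rle_dec => _; lra.
Qed.

Lemma weyl_differencing_pow z L H m : (forall n, Cmod (z n) <= 1) -> (L <= H)%N ->
  Cmod (\csum_(0 <= n < L) z n) ^ (2 * m.+1) <=
  2 ^ m.+1 * INR H ^ m.+1 +
  4 ^ m.+1 * INR H ^ m * \rsum_(1 <= h < L) Cmod (autocorrelation z L h) ^ m.+1.
Proof.
move=> z_le1 le_LH; rewrite -multE pow_mult.
set T := \rsum_(1 <= h < L) Cmod (autocorrelation z L h).
have T_ge0 : 0 <= T by apply: rsum_ge0 => h _ _; apply: Cmod_ge_0.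
have sq_le : Cmod (\csum_(0 <= n < L) z n) ^ 2 <= INR H + 2 * T.
  apply: Rle_trans (weyl_differencing _ z_le1) _; apply: Rplus_le_compat_r.
  by apply: le_INR; lia.
apply: Rle_trans (pow_incr _ _ m.+1 (conj (pow2_ge_0 _) sq_le)) _.
apply: Rle_trans (pow_add_le _ (pos_INR H) _) _; first lra.
have -> : 4 ^ m.+1 = 2 ^ m.+1 * 2 ^ m.+1 by rewrite -Rpow_mult_distr; congr pow; lra.
rewrite Rpow_mult_distr Rmult_plus_distr_l; apply: Rplus_le_compat_l.
rewrite -Rmult_assoc [X in _ <= X]Rmult_assoc; apply: Rmult_le_compat_l.
  by apply: Rmult_le_pos; apply: pow_le; lra.
apply: Rle_trans (rsum_power_mean _ _ _ _) _; first by move=> h; apply: Cmod_ge_0.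
apply: Rmult_le_compat_r; first by apply: rsum_ge0 => h _ _; apply: pow_le; apply: Cmod_ge_0.
by apply: pow_incr; split; [apply: pos_INR|apply: le_INR; lia].
Qed.

(* All [j]-fold differences of the phase [u] with steps [h_1, ..., h_j] satisfy
   the hypotheses of [kusmin_landau] with parameter [lam * h_1 * ... * h_j]. *)
Fixpoint vdc_phase (K : R) (j : nat) (u : nat -> R) (lam : R) (L : nat) : Prop :=
  if j is i.+1 then
    forall h, (0 < h < L)%N ->
      vdc_phase K i (fun n => u (n + h)%N - u n) (lam * INR h) (L - h)
  else
    (forall n, (n.+1 < L)%N -> lam <= Rabs (u n.+1 - u n) <= / 2) /\
    (forall n, (n.+2 < L)%N -> Rabs (u n.+2 - 2 * u n.+1 + u n) * INR L <= K * lam).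

Lemma autocorrelation_expi u L h :
  autocorrelation (fun n => expi (u n)) L h =
  \csum_(0 <= n < L - h) expi (u (n + h)%N - u n).
Proof. by apply: eq_bigr => n _; rewrite expi_sub. Qed.

Lemma rsum_inv_affine_le L H x y : (L <= H)%N -> (0 < H)%N -> 0 <= x -> 0 <= y ->
  \rsum_(1 <= h < L) (x * / INR H + y * / INR h) <= x + y * (1 + ln (INR H)).
Proof.
move=> le_LH H_gt0 x_ge0 y_ge0; have INR_H_gt0 : 0 < INR H by apply: lt_0_INR; lia.
have inv_ge0 h : (0 < h)%N -> 0 <= / INR h.
  by move=> h_gt0; apply/Rlt_le/Rinv_0_lt_compat/lt_0_INR; lia.
rewrite big_split /= -!big_distrr /= rsum_const; apply: Rplus_le_compat; last first.
  apply: Rmult_le_compat_l => //; apply: Rle_trans (harmonic_le H_gt0).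
  case: (posnP L) => [->|L_gt0].
    by rewrite big_geq //; apply: rsum_ge0 => h h_range _; apply: inv_ge0; lia.
  rewrite [X in _ <= X](@big_cat_nat _ _ _ L) //=; last lia.
  rewrite -[X in X <= _]Rplus_0_r; apply: Rplus_le_compat_l.
  by apply: rsum_ge0 => h h_range _; apply: inv_ge0; lia.
rewrite -[X in _ <= X]Rmult_1_r; apply: Rmult_le_compat_l => //.
by apply/Rle_div_l => //; rewrite Rmult_1_l; apply: le_INR; lia.
Qed.

Definition vdc_saving (j H : nat) (lam : R) : R :=
  / INR H + (1 + ln (INR H)) ^ j / (lam * INR H ^ j.+1).

Section VdcSaving.
Variables (j H : nat) (lam : R).
Hypotheses (H_gt0 : (0 < H)%N) (lam_gt0 : 0 < lam).

Let INR_H_ge1 : 1 <= INR H. Proof. by apply: (le_INR 1); lia. Qed.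

Let log_ge0 : 0 <= 1 + ln (INR H).
Proof. by have := ln_ge0 INR_H_ge1; lra. Qed.

Lemma vdc_saving_ge i : / INR H <= vdc_saving i H lam.
Proof.
suff : 0 <= (1 + ln (INR H)) ^ i / (lam * INR H ^ i.+1) by rewrite /vdc_saving; lra.
apply: Rdiv_le_0_compat; first exact: pow_le.
by apply: Rmult_lt_0_compat => //; apply: pow_lt; lra.
Qed.

Lemma rsum_vdc_saving_le L : (L <= H)%N ->
  \rsum_(1 <= h < L) vdc_saving j H (lam * INR h) <= INR H * vdc_saving j.+1 H lam.
Proof.
move=> le_LH; move: log_ge0; set l := 1 + ln (INR H) => l_ge0.
have pow_gt0 i : 0 < INR H ^ i by apply: pow_lt; lra.
pose y := l ^ j / (lam * INR H ^ j.+1).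
have y_ge0 : 0 <= y by apply: Rdiv_le_0_compat; [apply: pow_le|apply: Rmult_lt_0_compat].
have -> : INR H * vdc_saving j.+1 H lam = 1 + y * l.
  by rewrite /vdc_saving -/l /y /=; field; have := pow_gt0 j; lra.
apply: Rle_trans (rsum_inv_affine_le le_LH H_gt0 Rle_0_1 y_ge0).
apply: rsum_le => h h_range _; apply: Req_le; rewrite /vdc_saving -/l /y; field.
have : 0 < INR h by [apply: lt_0_INR; lia]; have := pow_gt0 j.+1; lra.
Qed.

Lemma weyl_differencing_saving z L m C : (forall n, Cmod (z n) <= 1) -> (L <= H)%N -> 0 <= C ->
  (forall h, (0 < h < L)%N ->
     Cmod (autocorrelation z L h) ^ m.+1 <= C * INR H ^ m.+1 * vdc_saving j H (lam * INR h)) ->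
  Cmod (\csum_(0 <= n < L) z n) ^ (2 * m.+1) <=
  (2 ^ m.+1 + 4 ^ m.+1 * C) * INR H ^ (2 * m.+1) * vdc_saving j.+1 H lam.
Proof.
move=> z_le1 le_LH C_ge0 autocorrelation_le.
set sigma := vdc_saving j.+1 H lam.
have pow_H_gt0 i : 0 < INR H ^ i by apply: pow_lt; lra.
have pow2_gt0 : 0 < 2 ^ m.+1 by apply: pow_lt; lra.
have pow4_gt0 : 0 < 4 ^ m.+1 by apply: pow_lt; lra.
have sum_le : \rsum_(1 <= h < L) Cmod (autocorrelation z L h) ^ m.+1 <=
    C * INR H ^ m.+1 * (INR H * sigma).
  apply: Rle_trans (Rmult_le_compat_l _ _ _ _ (rsum_vdc_saving_le le_LH)).
    by rewrite big_distrr /=; apply: rsum_le => h h_range _; apply: autocorrelation_le.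
  by apply: Rmult_le_pos => //; apply: Rlt_le.
have sigma_ge : 1 <= INR H * sigma.
  have := Rmult_le_compat_l (INR H) _ _ (pos_INR H) (vdc_saving_ge j.+1).
  by rewrite Rinv_r //; have := pow_H_gt0 1%N; lra.
apply: Rle_trans (weyl_differencing_pow m z_le1 le_LH) _.
have -> : INR H ^ (2 * m.+1) = INR H * (INR H ^ m * INR H ^ m.+1).
  by rewrite mul2n -addnn -plusE pow_add /=; ring.
have -> : (2 ^ m.+1 + 4 ^ m.+1 * C) * (INR H * (INR H ^ m * INR H ^ m.+1)) * sigma =
    2 ^ m.+1 * INR H ^ m.+1 * (INR H ^ m * (INR H * sigma)) +
    4 ^ m.+1 * INR H ^ m * (C * INR H ^ m.+1 * (INR H * sigma)) by ring.
apply: Rplus_le_compat; last first.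
  by apply: Rmult_le_compat_l => //; apply/Rlt_le/Rmult_lt_0_compat.
rewrite -[X in X <= _]Rmult_1_r; apply: Rmult_le_compat_l; first exact/Rlt_le/Rmult_lt_0_compat.
by have := pow_R1_Rle (INR H) m INR_H_ge1; nra.
Qed.

End VdcSaving.

Lemma vdc_inequality K j : 0 <= K -> exists C, 0 < C /\
  forall u lam L H, 0 < lam -> lam * INR H ^ j <= / 2 -> (L <= H)%N -> (0 < H)%N ->
    vdc_phase K j u lam L ->
  Cmod (\csum_(0 <= n < L) expi (u n)) ^ (2 ^ j) <= C * INR H ^ (2 ^ j) * vdc_saving j H lam.
Proof.
move=> K_ge0; elim: j => [|j [C [C_gt0 IH]]].
  exists (3 + 8 * K); split; first lra.
  move=> u lam L H lam_gt0 lam_le le_LH H_gt0 [step curvature].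
  have INR_H_gt0 : 0 < INR H by apply: lt_0_INR; lia.
  rewrite /vdc_saving expn0 pow_1 /= !Rmult_1_r in lam_le *.
  apply: Rle_trans (kusmin_landau lam_gt0 lam_le K_ge0 step curvature) _.
  have -> : (3 + 8 * K) * INR H * (/ INR H + 1 / (lam * INR H)) = (3 + 8 * K) + (3 + 8 * K) / lam.
    by field; lra.
  lra.
have [m eq_m] : exists m, (2 ^ j = m.+1)%N by exists (2 ^ j).-1; rewrite prednK // expn_gt0.
rewrite eq_m in IH; rewrite expnS eq_m; exists (2 ^ m.+1 + 4 ^ m.+1 * C); split.
  have : 0 < 2 ^ m.+1 by apply: pow_lt; lra.
  by have : 0 < 4 ^ m.+1 by [apply: pow_lt; lra]; nra.
move=> u lam L H lam_gt0 lam_le le_LH H_gt0 phase.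
apply: weyl_differencing_saving => //; [by move=> n; rewrite Cmod_expi; lra|lra|move=> h h_range].
have INR_h_ge1 : 1 <= INR h by apply: (le_INR 1); lia.
have le_hH : INR h <= INR H by apply: le_INR; lia.
rewrite autocorrelation_expi; apply: IH (phase h h_range) => //; [nra| |lia].
apply: Rle_trans lam_le; rewrite -[INR H ^ j.+1]/(INR H * INR H ^ j) -Rmult_assoc.
by apply: Rmult_le_compat_r; [apply: pow_le; lra|nra].
Qed.

(** * Phases with prescribed derivatives *)

Definition deriv_tower (g : nat -> R -> R) (a b : R) : Prop :=
  forall i x, a <= x <= b -> derivable_pt_lim (g i) x (g i.+1 x).

Lemma deriv_tower_mvt g a b i x y : deriv_tower g a b -> a <= x -> x < y -> y <= b ->
  exists c, g i y - g i x = g i.+1 c * (y - x) /\ x <= c <= y.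
Proof.
move=> tower le_ax lt_xy le_yb.
have [c [eq_c c_range]] := MVT_cor2 (g i) (g i.+1) x y lt_xy
  (fun z z_range => tower i z ltac:(lra)).
by exists c; split=> //; lra.
Qed.

Lemma deriv_tower_shift_sub g a b h : 0 <= h -> deriv_tower g a b ->
  deriv_tower (fun i x => g i (x + h) - g i x) a (b - h).
Proof.
move=> h_ge0 tower i x x_range; apply: derivable_pt_lim_minus; last by apply: tower; lra.
have -> : g i.+1 (x + h) = g i.+1 (x + h) * (1 + 0) by ring.
apply: (derivable_pt_lim_comp (fun x => x + h) (g i)); last by apply: tower; lra.
by apply: derivable_pt_lim_plus; [apply: derivable_pt_lim_id|apply: derivable_pt_lim_const].
Qed.

Lemma eq_vdc_phase K j u v lam L : (forall n, u n = v n) ->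
  vdc_phase K j u lam L -> vdc_phase K j v lam L.
Proof.
elim: j u v lam L => [|j IH] u v lam L uv /=.
  by move=> [step curvature]; split=> n lt_n; rewrite -!uv; [apply: step|apply: curvature].
by move=> phase h h_range; apply: IH (phase h h_range) => n; rewrite !uv.
Qed.

Lemma vdc_phase0_deriv K (g : nat -> R -> R) x0 Y L lam mu kap :
  deriv_tower g x0 (x0 + Y) ->
  (forall x, x0 <= x <= x0 + Y -> lam <= g 1%N x <= mu) ->
  (forall x, x0 <= x <= x0 + Y -> Rabs (g 2%N x) <= kap) ->
  0 < lam -> mu <= / 2 -> kap * INR L <= K * lam -> INR L <= Y + 1 ->
  vdc_phase K 0 (fun n => g 0%N (x0 + INR n)) lam L.
Proof.
move=> tower g1_bound g2_bound lam_gt0 mu_le kap_le L_le; split=> n lt_n; have n_ge0 := pos_INR n.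
  have lt_INR : INR n + 2 <= INR L by have := le_INR n.+2 L ltac:(lia); rewrite !S_INR; lra.
  have [c [-> c_range]] := @deriv_tower_mvt g _ _ 0 (x0 + INR n) (x0 + INR n.+1) tower
    ltac:(lra) ltac:(rewrite S_INR; lra) ltac:(rewrite S_INR; lra).
  rewrite S_INR in c_range *; have -> : x0 + (INR n + 1) - (x0 + INR n) = 1 by ring.
  by have := g1_bound c ltac:(lra); rewrite Rmult_1_r => ?; rewrite Rabs_pos_eq; lra.
have lt_INR : INR n + 3 <= INR L by have := le_INR n.+3 L ltac:(lia); rewrite !S_INR; lra.
have [c [eq_c c_range]] := @deriv_tower_mvt _ _ _ 0 (x0 + INR n) (x0 + INR n + 1)
  (deriv_tower_shift_sub Rle_0_1 tower) ltac:(lra) ltac:(lra) ltac:(lra).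
have [e [eq_e e_range]] := @deriv_tower_mvt g _ _ 1 c (c + 1) tower ltac:(lra) ltac:(lra)
  ltac:(lra).
rewrite eq_e in eq_c; rewrite !S_INR.
have -> : x0 + (INR n + 1 + 1) = x0 + INR n + 1 + 1 by ring.
have -> : x0 + (INR n + 1) = x0 + INR n + 1 by ring.
have -> : g 0%N (x0 + INR n + 1 + 1) - 2 * g 0%N (x0 + INR n + 1) + g 0%N (x0 + INR n) = g 2%N e
  by lra.
apply: Rle_trans kap_le; apply: Rmult_le_compat_r; first exact: pos_INR.
by apply: g2_bound; lra.
Qed.

Lemma vdc_phase_deriv K j (g : nat -> R -> R) x0 Y L lam mu kap :
  deriv_tower g x0 (x0 + Y) ->
  (forall x, x0 <= x <= x0 + Y -> lam <= g j.+1 x <= mu) ->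
  (forall x, x0 <= x <= x0 + Y -> Rabs (g j.+2 x) <= kap) ->
  0 < lam -> mu * INR L ^ j <= / 2 -> kap * INR L <= K * lam -> INR L <= Y + 1 ->
  vdc_phase K j (fun n => g 0%N (x0 + INR n)) lam L.
Proof.
elim: j g Y L lam mu kap => [|j IH] g Y L lam mu kap tower g1_bound g2_bound lam_gt0.
  by rewrite Rmult_1_r; apply: vdc_phase0_deriv.
move=> mu_le kap_le L_le h h_range; have h_ge1 : 1 <= INR h by apply: (le_INR 1); lia.
have le_hL : INR h + 1 <= INR L by rewrite -S_INR; apply: le_INR; lia.
have eq_Lh : INR (L - h) = INR L - INR h by rewrite minus_INR //; lia.
have mvt i x : x0 <= x <= x0 + Y - INR h ->
    exists c, g i (x + INR h) - g i x = g i.+1 c * INR h /\ x0 <= c <= x0 + Y.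
  move=> x_range; have [c [eq_c c_range]] := @deriv_tower_mvt g _ _ i x (x + INR h) tower
    ltac:(lra) ltac:(lra) ltac:(lra).
  by exists c; split; [rewrite eq_c; ring|lra].
apply: (@eq_vdc_phase _ _ (fun n => g 0%N (x0 + INR n + INR h) - g 0%N (x0 + INR n))).
  by move=> n; rewrite plus_INR; congr (g 0%N _ - _); ring.
have lam_le_mu := g1_bound x0 ltac:(lra).
have kap_ge0 : 0 <= kap by apply: Rle_trans (Rabs_pos _) (g2_bound x0 _); lra.
apply: (IH (fun i x => g i (x + INR h) - g i x) (Y - INR h) _ _ (mu * INR h) (kap * INR h)).
- have -> : x0 + (Y - INR h) = x0 + Y - INR h by ring.
  by apply: deriv_tower_shift_sub => //; lra.
- by move=> x x_range; have [c [-> c_range]] := mvt j.+1 x ltac:(lra);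
  have := g1_bound c c_range; nra.
- move=> x x_range; have [c [-> c_range]] := mvt j.+2 x ltac:(lra);
  rewrite Rabs_mult (Rabs_pos_eq (INR h)); last lra.
  by apply: Rmult_le_compat_r; [lra|apply: g2_bound].
- by nra.
- apply: Rle_trans mu_le; rewrite Rmult_assoc; apply: Rmult_le_compat_l; first lra.
  rewrite -[INR L ^ j.+1]/(INR L * INR L ^ j); apply: Rmult_le_compat; try lra.
    by apply: pow_le; apply: pos_INR.
  by apply: pow_incr; rewrite eq_Lh; lra.
- rewrite eq_Lh; nra.
by rewrite eq_Lh; lra.
Qed.

Lemma vdc_derivative_test K k : 0 <= K -> exists C, 0 < C /\
  forall (g : nat -> R -> R) x0 Y L H lam mu kap,
  0 <= Y -> deriv_tower g x0 (x0 + Y) ->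
  (forall x, x0 <= x <= x0 + Y -> lam <= g k.+1 x <= mu) ->
  (forall x, x0 <= x <= x0 + Y -> Rabs (g k.+2 x) <= kap) ->
  0 < lam -> mu * INR H ^ k <= / 2 -> kap * INR H <= K * lam -> INR L <= Y + 1 ->
  (L <= H)%N -> (0 < H)%N ->
  Cmod (\csum_(0 <= n < L) expi (g 0%N (x0 + INR n)%R)) ^ (2 ^ k) <=
  C * INR H ^ (2 ^ k) * vdc_saving k H lam.
Proof.
move=> K_ge0; have [C [C_gt0 bound]] := vdc_inequality k K_ge0; exists C; split=> //.
move=> g x0 Y L H lam mu kap Y_ge0 tower g1_bound g2_bound lam_gt0 mu_le kap_le L_le le_LH H_gt0.
have lam_le_mu := g1_bound x0 ltac:(lra).
have kap_ge0 : 0 <= kap by apply: Rle_trans (Rabs_pos _) (g2_bound x0 _); lra.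
have le_INR_LH : 0 <= INR L <= INR H by split; [apply: pos_INR|apply: le_INR; lia].
apply: (bound (fun n => g 0%N (x0 + INR n))) => //.
  apply: Rle_trans mu_le; apply: Rmult_le_compat_r; last lra.
  by apply: pow_le; apply: pos_INR.
apply: (vdc_phase_deriv tower g1_bound g2_bound) => //.
  by apply: Rle_trans mu_le; apply: Rmult_le_compat_l; [lra|apply: pow_incr].
by apply: Rle_trans kap_le; apply: Rmult_le_compat_l; lra.
Qed.

(* On [[A, 2A]] the derivatives of order [k + 1] and [k + 2] behave like those of
   a power function of size [T]. *)
Definition vdc_size (k : nat) (c1 c2 c3 A T : R) (g : nat -> R -> R) : Prop :=
  deriv_tower g A (2 * A) /\
  (forall x, A <= x <= 2 * A -> c1 * T / A ^ k.+1 <= g k.+1 x <= c2 * T / A ^ k.+1) /\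
  (forall x, A <= x <= 2 * A -> Rabs (g k.+2 x) <= c3 * T / A ^ k.+2).

(* The block length [H ~ Y] that makes the first derivative after [k] differencings
   as large as [kusmin_landau] allows. *)
Definition vdc_block_length (k : nat) (c2 A T Y : R) : Prop :=
  Rpower Y (INR k + / 2) * (2 * c2 * T) = A ^ k.+1.

Lemma Rpower_half_mul x : 0 < x -> Rpower x (/ 2) * Rpower x (/ 2) = x.
Proof. by move=> x_gt0; rewrite -Rpower_plus (_ : / 2 + / 2 = 1) ?Rpower_1; lra. Qed.

Section VdcBlockLength.
Variables (k : nat) (c1 c2 A T Y H : R).
Hypotheses (c1_gt0 : 0 < c1) (c2_gt0 : 0 < c2) (A_gt0 : 0 < A) (T_gt0 : 0 < T).
Hypotheses (Y_ge1 : 1 <= Y) (H_range : Y / 2 <= H <= Y).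
Hypothesis block_length : vdc_block_length k c2 A T Y.

Let mu_Y : c2 * T / A ^ k.+1 * (Y ^ k * Rpower Y (/ 2)) = / 2.
Proof.
rewrite -block_length -Rpower_pow; last lra.
rewrite -Rpower_plus; field; have := Rpower_gt0 Y (INR k + / 2); lra.
Qed.

Lemma vdc_block_length_le : c2 * T / A ^ k.+1 * H ^ k <= / 2.
Proof.
have pow_gt0 : 0 < A ^ k.+1 by apply: pow_lt.
rewrite -mu_Y; apply: Rmult_le_compat_l; first by apply: Rdiv_le_0_compat; nra.
rewrite -[X in X <= _]Rmult_1_r; apply: Rmult_le_compat; [by apply: pow_le; lra|lra| |].
  by apply: pow_incr; lra.
by apply: Rpower_ge1; lra.
Qed.

Lemma vdc_block_length_ge :
  c1 / (2 * c2 * 2 ^ k.+1) * Rpower Y (/ 2) <= c1 * T / A ^ k.+1 * H ^ k.+1.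
Proof.
have pow_gt0 : 0 < A ^ k.+1 by apply: pow_lt.
have lam_gt0 : 0 < c1 * T / A ^ k.+1 by apply: Rdiv_lt_0_compat; nra.
have half_le : (Y / 2) ^ k.+1 <= H ^ k.+1 by apply: pow_incr; lra.
apply: Rle_trans (Rmult_le_compat_l _ _ _ (Rlt_le _ _ lam_gt0) half_le).
have -> : (Y / 2) ^ k.+1 = Y ^ k.+1 * / 2 ^ k.+1 by rewrite Rpow_mult_distr pow_inv.
have -> : Y ^ k.+1 = Y ^ k * Rpower Y (/ 2) * Rpower Y (/ 2).
  by rewrite Rmult_assoc Rpower_half_mul /=; lra.
have -> : c1 * T / A ^ k.+1 = c1 / c2 * (c2 * T / A ^ k.+1) by field; lra.
have pow2_gt0 : 0 < 2 ^ k.+1 by apply: pow_lt; lra.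
apply: Req_le; transitivity
  (c1 / c2 * (c2 * T / A ^ k.+1 * (Y ^ k * Rpower Y (/ 2))) * Rpower Y (/ 2) * / 2 ^ k.+1);
    last by ring.
by rewrite mu_Y; field; lra.
Qed.

End VdcBlockLength.

Lemma vdc_saving_le k (H : nat) lam Y l c : 1 <= Y -> Y / 2 <= INR H ->
  0 <= 1 + ln (INR H) <= l -> 1 <= l -> 0 < c -> c * Rpower Y (/ 2) <= lam * INR H ^ k.+1 ->
  vdc_saving k H lam <= (2 + / c) * l ^ k / Rpower Y (/ 2).
Proof.
move=> Y_ge1 le_H lH_range l_ge1 c_gt0 lamH_ge; have Yh_gt0 := Rpower_gt0 Y (/ 2).
have l_pow_ge1 := pow_R1_Rle l k l_ge1; have lH_pow_le := pow_incr _ _ k lH_range.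
have -> : (2 + / c) * l ^ k / Rpower Y (/ 2) =
    / (Rpower Y (/ 2) / 2) * l ^ k + l ^ k * / (c * Rpower Y (/ 2)) by field; lra.
apply: Rplus_le_compat.
  have YhYh := @Rpower_half_mul Y ltac:(lra).
  rewrite -[/ INR H]Rmult_1_r; apply: Rmult_le_compat => //; try lra.
    by apply/Rlt_le/Rinv_0_lt_compat; lra.
  by apply: Rinv_le_contravar; [lra|nra].
apply: Rmult_le_compat => //; first by apply: pow_le; lra.
  by apply/Rlt_le/Rinv_0_lt_compat; nra.
by apply: Rinv_le_contravar => //; apply: Rmult_lt_0_compat.
Qed.

Lemma vdc_block_bound k c1 c2 c3 : 0 < c1 -> 0 < c2 -> 0 <= c3 -> exists C, 0 < C /\
  forall A T Y (g : nat -> R -> R) (H : nat) x0 L,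
  1 <= A -> 0 < T -> 1 <= Y <= A -> vdc_block_length k c2 A T Y -> vdc_size k c1 c2 c3 A T g ->
  1 <= INR H -> Y / 2 <= INR H <= Y -> (0 < L <= H)%N -> A <= x0 -> x0 + INR L - 1 <= 2 * A ->
  Cmod (\csum_(0 <= n < L) expi (g 0%N (x0 + INR n)%R)) <=
  INR H * Rpower (C * (1 + ln A) ^ k / Rpower Y (/ 2)) (/ INR (2 ^ k)).
Proof.
move=> c1_gt0 c2_gt0 c3_ge0.
have [C [C_gt0 test]] := vdc_derivative_test k (Rdiv_le_0_compat _ _ c3_ge0 c1_gt0).
pose c := c1 / (2 * c2 * 2 ^ k.+1).
have c_gt0 : 0 < c.
  by apply: Rdiv_lt_0_compat => //; apply: Rmult_lt_0_compat; [lra|apply: pow_lt; lra].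
exists (C * (2 + / c)); have c_inv_gt0 := Rinv_0_lt_compat _ c_gt0; split; first by nra.
move=> A T Y g H x0 L A_ge1 T_gt0 [Y_ge1 le_YA] block [tower [g1_bound g2_bound]].
move=> H_ge1 H_range L_range x0_ge x_last.
have pow_A_gt0 : 0 < A ^ k.+1 by apply: pow_lt; lra.
have L_ge1 : 1 <= INR L by apply: (le_INR 1); lia.
have lamH_ge := @vdc_block_length_ge k c1 c2 A T Y (INR H) c1_gt0 c2_gt0
  ltac:(lra) T_gt0 Y_ge1 H_range block.
set lam := c1 * T / A ^ k.+1 in g1_bound lamH_ge; rewrite -/c in lamH_ge.
have lam_gt0 : 0 < lam by apply: Rdiv_lt_0_compat; nra.
have ln_H_le := ln_le (INR H) A ltac:(lra) ltac:(lra); have ln_H_ge0 := ln_ge0 H_ge1.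
have saving_le := @vdc_saving_le k H lam Y (1 + ln A) c Y_ge1 ltac:(lra) ltac:(lra)
  ltac:(lra) c_gt0 lamH_ge.
have saving_gt0 : 0 < vdc_saving k H lam.
  by apply: Rlt_le_trans (vdc_saving_ge _ lam_gt0 k); [apply: Rinv_0_lt_compat; lra|lia].
have Hm_gt0 : 0 < INR H ^ (2 ^ k) by apply: pow_lt; lra.
have -> : C * (2 + / c) * (1 + ln A) ^ k / Rpower Y (/ 2) =
    C * ((2 + / c) * (1 + ln A) ^ k / Rpower Y (/ 2)) by rewrite /Rdiv; ring.
apply: pow_le_mul_Rpower_inv; rewrite ?expn_gt0 //; [exact: Cmod_ge_0|lra|nra|].
have CH_gt0 : 0 < C * INR H ^ (2 ^ k) by apply: Rmult_lt_0_compat.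
apply: (Rle_trans _ (C * INR H ^ (2 ^ k) * vdc_saving k H lam)); last first.
  by have := Rmult_le_compat_l _ _ _ (Rlt_le _ _ CH_gt0) saving_le; lra.
apply: (test g x0 (INR L - 1) L H lam (c2 * T / A ^ k.+1) (c3 * T / A ^ k.+2)) => //;
  try lra; try lia.
- by move=> i x x_range; apply: tower; lra.
- by move=> x x_range; apply: g1_bound; lra.
- by move=> x x_range; apply: g2_bound; lra.
- by apply: vdc_block_length_le block => //; lra.
have -> : c3 / c1 * lam = c3 * T / A ^ k.+2 * A.
  by rewrite /lam -[A ^ k.+2]/(A * A ^ k.+1); field; lra.
apply: Rmult_le_compat_l; last lra.
by apply: Rdiv_le_0_compat; [nra|apply: pow_lt; lra].
Qed.

Lemma vdc_interval_bound k c1 c2 c3 : 0 < c1 -> 0 < c2 -> 0 <= c3 -> exists C, 0 < C /\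
  forall A T Y (g : nat -> R -> R) a b,
  1 <= A -> 0 < T -> 2 <= Y <= A -> vdc_block_length k c2 A T Y -> vdc_size k c1 c2 c3 A T g ->
  (forall n, (a <= n < b)%N -> A <= INR n <= 2 * A) ->
  Cmod (\csum_(a <= n < b) expi (g 0%N (INR n))) <=
    3 * A * Rpower (C * (1 + ln A) ^ k / Rpower Y (/ 2)) (/ INR (2 ^ k)).
Proof.
move=> c1_gt0 c2_gt0 c3_ge0; have [C [C_gt0 bound]] := vdc_block_bound k c1_gt0 c2_gt0 c3_ge0.
exists C; split=> // A T Y g a b A_ge1 T_gt0 [Y_ge2 le_YA] block size ab_range.
set Z := _ / _; have Zr_gt0 := Rpower_gt0 Z (/ INR (2 ^ k)).
have [H H_range] := @nfloor_ex Y ltac:(lra).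
have H_gt0 : (0 < H)%N by apply/ltP/INR_lt; rewrite INR_0; lra.
case: (leqP b a) => [le_ba|lt_ab]; first by rewrite big_geq // Cmod_0; nra.
have range_a := ab_range a ltac:(lia); have range_b := ab_range b.-1 ltac:(lia).
have INR_sub c d : (c < d)%N -> INR (d - c) = INR d.-1 - INR c + 1.
  by move=> lt_cd; rewrite -minus_INR -?S_INR; [congr INR; lia|lia].
apply: Rle_trans (csum_blocks_le (E := INR H * Rpower Z (/ INR (2 ^ k))) H_gt0 _ _) _.
- by apply: Rmult_le_pos; lra.
- move=> c d le_ac le_db le_H; case: (leqP d c) => [le_dc|lt_cd].
    by rewrite big_geq // Cmod_0; apply: Rmult_le_pos; lra.
  have range_c := ab_range c ltac:(lia); have range_d := ab_range d.-1 ltac:(lia).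
  rewrite -{1}[c]add0n big_addn (eq_bigr (fun n => expi (g 0%N (INR c + INR n)%R))) => [|n _].
    by apply: (bound A T Y) => //; rewrite ?INR_sub //; try lra; lia.
  by rewrite plus_INR Rplus_comm.
have -> : (INR (b - a) / INR H + 1) * (INR H * Rpower Z (/ INR (2 ^ k))) =
   (INR (b - a) + INR H) * Rpower Z (/ INR (2 ^ k)) by field; lra.
by apply: Rmult_le_compat_r; rewrite ?INR_sub //; lra.
Qed.

Lemma vdc_block_length_exists k c2 A T M : 0 < A -> 0 < M -> 0 < 2 * c2 * T ->
  Rpower A (/ 2) <= 2 * c2 * T -> M * (2 * c2 * T) <= A ^ k.+1 ->
  exists Y, vdc_block_length k c2 A T Y /\ Rpower M (/ (INR k + / 2)) <= Y <= A.
Proof.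
move=> A_gt0 M_gt0 cT_gt0 cT_ge cT_le; have k_ge0 := pos_INR k.
have pow_gt0 : 0 < A ^ k.+1 by apply: pow_lt.
set sigma := / (INR k + / 2); have sigma_gt0 : 0 < sigma by apply: Rinv_0_lt_compat; lra.
have sigma_mul : sigma * (INR k + / 2) = 1 by rewrite Rinv_l; lra.
pose Q := A ^ k.+1 / (2 * c2 * T); have Q_gt0 : 0 < Q by apply: Rdiv_lt_0_compat.
exists (Rpower Q sigma); split; [|split].
- by rewrite /vdc_block_length Rpower_mult sigma_mul Rpower_1 // /Q /Rdiv Rmult_assoc Rinv_l; lra.
- by apply: Rle_Rpower_l; [lra|split=> //; apply/Rle_div_r].
have -> : A = Rpower (Rpower A (INR k + / 2)) sigma.
  by rewrite Rpower_mult Rmult_comm sigma_mul Rpower_1.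
apply: Rle_Rpower_l; first lra.
split=> //; apply/Rle_div_l => //.
have -> : A ^ k.+1 = Rpower A (INR k + / 2) * Rpower A (/ 2).
  by rewrite -Rpower_plus -Rpower_pow // S_INR; congr Rpower; field.
exact: Rmult_le_compat_l.
Qed.

Lemma for_large_log_root C k sigma m : 0 < C -> 0 < sigma -> 0 < m ->
  for_large (fun M => forall A Y, 1 <= A <= M -> Rpower M sigma <= Y ->
    3 * Rpower (C * (1 + ln A) ^ k / Rpower Y (/ 2)) (/ m) <= Rpower M (- (sigma / (8 * m)))).
Proof.
move=> C_gt0 sigma_gt0 m_gt0; pose rho := sigma / (8 * m).
have rho_gt0 : 0 < rho by apply: Rdiv_lt_0_compat; lra.
have m_inv_gt0 := Rinv_0_lt_compat _ m_gt0.
have := for_large_and (@for_large_ln_pow_le C k (sigma / 4) ltac:(lra))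
  (@for_large_mul_Rpower_le 3 (- (2 * rho)) (- rho) ltac:(lra)).
apply: for_large_imp => M [log_le power_le] A Y [A_ge1 le_AM] le_Y.
have ln_A_ge0 := ln_ge0 A_ge1; have ln_A_le := ln_le A M ltac:(lra) le_AM.
apply: Rle_trans power_le; apply: Rmult_le_compat_l; first lra.
have -> : Rpower M (- (2 * rho)) = Rpower (Rpower M (- (sigma / 4))) (/ m).
  by rewrite Rpower_mult; congr Rpower; rewrite /rho; field; lra.
apply: Rle_Rpower_l; first lra.
split; first by apply: Rdiv_lt_0_compat => //; apply: Rmult_lt_0_compat => //; apply: pow_lt; lra.
apply/Rle_div_l => //; apply: Rle_trans (_ : C * (1 + ln M) ^ k <= _).
  by apply: Rmult_le_compat_l; [lra|apply: pow_incr; lra].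
apply: Rle_trans log_le _.
have -> : Rpower M (sigma / 4) = Rpower M (- (sigma / 4)) * Rpower M (sigma * / 2).
  by rewrite -Rpower_plus; congr Rpower; field.
by apply: Rmult_le_compat_l => //; apply: Rpower_mul_le => //; lra.
Qed.

Lemma vdc_power_saving k c1 c2 c3 : 0 < c1 -> 0 < c2 -> 0 <= c3 -> exists rho, 0 < rho /\
  for_large (fun M => forall A T (g : nat -> R -> R) a b,
    1 <= A <= M -> 0 < T -> Rpower A (/ 2) <= 2 * c2 * T -> M * (2 * c2 * T) <= A ^ k.+1 ->
    vdc_size k c1 c2 c3 A T g -> (forall n, (a <= n < b)%N -> A <= INR n <= 2 * A) ->
    Cmod (\csum_(a <= n < b) expi (g 0%N (INR n))) <= A * Rpower M (- rho)).
Proof.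
move=> c1_gt0 c2_gt0 c3_ge0; have [C [C_gt0 bound]] := vdc_interval_bound k c1_gt0 c2_gt0 c3_ge0.
have k_ge0 := pos_INR k; pose sigma := / (INR k + / 2).
have sigma_gt0 : 0 < sigma by apply: Rinv_0_lt_compat; lra.
have m_gt0 := INR_exp2_gt0 k.
exists (sigma / (8 * INR (2 ^ k))); split; first by apply: Rdiv_lt_0_compat; lra.
have := for_large_and (for_large_log_root k C_gt0 sigma_gt0 m_gt0)
  (for_large_le_Rpower 2 sigma_gt0).
apply: for_large_imp => M [root_le M_sigma_ge2] A T g a b [A_ge1 le_AM].
move=> T_gt0 cT_ge cT_le size ab_range.
have cT_gt0 : 0 < 2 * c2 * T by apply: Rmult_lt_0_compat; lra.
have [Y [block [le_Y le_YA]]] :=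
  @vdc_block_length_exists k c2 A T M ltac:(lra) ltac:(lra) cT_gt0 cT_ge cT_le.
rewrite -/sigma in le_Y; have Y_range : 2 <= Y <= A by lra.
apply: Rle_trans (bound A T Y g a b A_ge1 T_gt0 Y_range block size ab_range) _.
rewrite (Rmult_comm 3) Rmult_assoc; apply: Rmult_le_compat_l; first lra.
by apply: root_le => //; lra.
Qed.

(** * Moebius and von Mangoldt functions *)

Section DivisorSums.
Variables (T : Type) (idx : T) (op : Monoid.com_law idx).

Lemma big_multiples (G : nat -> T) b N : (0 < b)%N ->
  (forall m, (N <= m)%N -> G m = idx) ->
  \big[op/idx]_(1 <= m < N | (b %| m)%N) G m = \big[op/idx]_(1 <= d < N) G (b * d)%N.
Proof.
move=> b_gt0 G_idx.
rewrite [RHS](eq_big_nat _ _ (F2 := fun d => \big[op/idx]_(1 <= m < N | m == (b * d)%N) G m));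
  last first.
  move=> d d_range; rewrite big_nat1_eq; case: ifP => // not_lt.
  by rewrite G_idx //; nia.
under [RHS]eq_bigr do rewrite big_mkcond.
rewrite [RHS]exchange_big /= big_mkcond; apply: eq_big_nat => m m_range.
rewrite -big_mkcond; case: ifP => [b_dvd_m|b_ndvd_m].
  rewrite (eq_bigl (fun d => d == (m %/ b)%N)) => [|d]; last first.
    by rewrite -{1}(divnK b_dvd_m) mulnC eqn_pmul2l // eq_sym.
  by rewrite big_nat1_eq ifT //; have := leq_div m b; have := divnK b_dvd_m; nia.
by rewrite big1 // => d /eqP eq_m; rewrite eq_m dvdn_mulr in b_ndvd_m.
Qed.

Lemma big_divisors (f : nat -> nat -> T) N :
  (forall b m, (N <= m)%N -> f b m = idx) ->
  \big[op/idx]_(1 <= b < N) \big[op/idx]_(1 <= d < N) f b (b * d)%N =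
  \big[op/idx]_(1 <= m < N) \big[op/idx]_(1 <= b < N | (b %| m)%N) f b m.
Proof.
move=> f_idx; under [RHS]eq_bigr do rewrite big_mkcond.
rewrite [RHS]exchange_big /=; apply: eq_big_nat => b b_range.
by rewrite -big_mkcond /= big_multiples //; [lia|move=> m; apply: f_idx].
Qed.

End DivisorSums.

Definition squarefree n := all (fun p => logn p n == 1%N) (primes n).
Definition moebius (n : nat) : R :=
  if squarefree n then (-1) ^ size (primes n) else 0.
Definition mangoldt (n : nat) : R := if primes n is [:: p] then ln (INR p) else 0.

Lemma Rabs_moebius_le1 n : Rabs (moebius n) <= 1.
Proof.
rewrite /moebius; case: ifP => _; last by rewrite Rabs_R0; lra.
by rewrite pow_1_abs; lra.
Qed.

Lemma moebius_mul_prime p e : prime p -> (0 < e)%N ->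
  moebius (p * e) = if (p %| e)%N then 0 else - moebius e.
Proof.
move=> p_pr e_gt0; have p_gt0 := prime_gt0 p_pr.
have logn_pe : logn p (p * e) = (logn p e).+1 by rewrite lognM // logn_prime // eqxx.
have p_primes : p \in primes (p * e) by rewrite mem_primes p_pr muln_gt0 p_gt0 e_gt0 dvdn_mulr.
case: ifP => [p_dvd_e|p_ndvd_e].
  rewrite /moebius; suff -> : squarefree (p * e) = false by [].
  apply/allP => /(_ p p_primes); rewrite logn_pe eqSS.
  by rewrite eqn0Ngt logn_gt0 mem_primes p_pr e_gt0 p_dvd_e.
have perm_pe : perm_eq (primes (p * e)) (p :: primes e).
  apply: uniq_perm; rewrite ?primes_uniq //= ?primes_uniq ?mem_primes ?p_ndvd_e ?andbF //.
  by move=> q; rewrite primesM // primes_prime // !inE.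
rewrite /moebius (perm_size perm_pe) /squarefree (perm_all _ perm_pe) /=.
rewrite logn_pe (_ : logn p e = 0%N) ?eqxx /=;
  last by rewrite logn_coprime // prime_coprime // p_ndvd_e.
have -> : all (fun q => logn q (p * e) == 1)%N (primes e) =
  all (fun q => logn q e == 1)%N (primes e).
  apply: eq_in_all => q; rewrite mem_primes => /and3P[q_pr _ q_dvd_e];
    rewrite lognM // logn_prime //.
  by case: (eqVneq q p) => [eq_qp|//]; rewrite eq_qp p_ndvd_e in q_dvd_e.
by case: all; ring.
Qed.

Lemma sum_moebius n N : (0 < n < N)%N ->
  \rsum_(1 <= b < N | (b %| n)%N) moebius b = if n == 1%N then 1 else 0.
Proof.
move=> /andP[n_gt0 lt_nN]; case: eqP => [->|/eqP n_neq1].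
  rewrite (eq_bigl (fun b => b == 1%N)) => [|b]; last by rewrite dvdn1.
  by rewrite big_nat1_eq ifT /moebius //=; lia.
set p := pdiv n; have p_pr : prime p by apply: pdiv_prime; lia.
have p_dvd_n : (p %| n)%N by apply: pdiv_dvd.
rewrite (bigID (fun b => p %| b)%N) /=.
have -> : \rsum_(1 <= b < N | (b %| n)%N && (p %| b)%N) moebius b =
    \rsum_(1 <= e < N | (e %| n)%N && ~~ (p %| e)%N) (- moebius e).
  rewrite [LHS](eq_bigl (fun b => (p %| b) && (b %| n))%N) => [|b]; last by rewrite andbC.
  rewrite big_mkcondr.
  have := @big_multiples _ _ Rplus (fun m => if (m %| n)%N then moebius m else 0) p N
    (prime_gt0 p_pr).
  move=> /= -> => [|m le_Nm]; last by case: ifP => // /dvdn_leq; lia.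
  rewrite [RHS]big_mkcond; apply: eq_big_nat => e e_range.
  rewrite moebius_mul_prime //; last lia.
  case: (boolP (p %| e)%N) => p_e; first by rewrite andbF; case: ifP.
  rewrite andbT -[in LHS](divnK p_dvd_n) mulnC dvdn_pmul2r ?prime_gt0 //.
  by rewrite -{2}(divnK p_dvd_n) Gauss_dvdl // coprime_sym prime_coprime.
by rewrite -big_split /= big1 // => i _; ring.
Qed.

Lemma mangoldt_ge0 n : 0 <= mangoldt n.
Proof.
rewrite /mangoldt; case eq_n : (primes n) => [|p [|q s]]; try lra.
have : p \in primes n by rewrite eq_n inE.
by rewrite mem_primes => /and3P[/prime_gt0 p_gt0 _ _]; apply/ln_ge0/(le_INR 1); lia.
Qed.

Lemma mangoldt_le_ln n N : (0 < n <= N)%N -> mangoldt n <= ln (INR N).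
Proof.
move=> n_range; have N_ge1 : 1 <= INR N by apply: (le_INR 1); lia.
rewrite /mangoldt; case eq_n : (primes n) => [|p [|q s]]; try by apply: ln_ge0.
have : p \in primes n by rewrite eq_n inE.
rewrite mem_primes => /and3P[/prime_gt0 p_gt0 n_gt0 /(dvdn_leq n_gt0) le_pn].
by apply: ln_le; [apply: lt_0_INR|apply: le_INR]; lia.
Qed.

Lemma primes1P n p : primes n = [:: p] -> prime p /\ n = (p ^ logn p n)%N.
Proof.
move=> eq_n; have : p \in primes n by rewrite eq_n inE.
rewrite mem_primes => /and3P[p_pr n_gt0 p_dvd_n]; split=> //.
by rewrite -p_part part_pnat_id // /pnat n_gt0 eq_n /= andbT; apply/eqP.
Qed.

Lemma mangoldt_new_divisor p m c : prime p -> (0 < m)%N ->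
  (c %| p * m)%N && ~~ (c %| m)%N ->
  mangoldt c = if c == (p ^ (logn p m).+1)%N then ln (INR p) else 0.
Proof.
move=> p_pr m_gt0 /andP[c_dvd_pm c_ndvd_m].
case: eqP => [->|c_neq]; first by rewrite /mangoldt primesX // primes_prime.
rewrite /mangoldt; case eq_c : (primes c) => [|q [|r s]] //; case: c_neq.
have [q_pr eq_cq] := primes1P eq_c; have p_gt0 := prime_gt0 p_pr.
have le_pm : (logn q c <= (q == p) + logn q m)%N.
  by rewrite -(logn_prime q p_pr) -lognM // -pfactor_dvdn ?muln_gt0 ?p_gt0 // -eq_cq.
have lt_m : (logn q m < logn q c)%N by rewrite ltnNge -pfactor_dvdn // -eq_cq.
have [eq_q eq_log] : q = p /\ logn q c = (logn p m).+1.
  by case: (eqVneq q p) le_pm lt_m => [->|_] /= le_pm lt_m; [split=> //|]; lia.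
by rewrite eq_cq eq_log eq_q.
Qed.

Lemma sum_mangoldt n N : (0 < n < N)%N ->
  \rsum_(1 <= c < N | (c %| n)%N) mangoldt c = ln (INR n).
Proof.
elim/ltn_ind: n => n IH /andP[n_gt0 lt_nN]; have dvd1E b : (b %| 1)%N = (b == 1%N) by rewrite dvdn1.
case: (ltnP 1 n) => [n_gt1|n_le1]; last first.
  have -> : n = 1%N by lia.
  by rewrite (eq_bigl _ _ dvd1E) big_nat1_eq ifT; [rewrite /mangoldt /= INR_1 ln_1|lia].
set p := pdiv n; have p_pr : prime p by apply: pdiv_prime.
set m := (n %/ p)%N; have eq_n : n = (p * m)%N by rewrite mulnC divnK // pdiv_dvd.
have m_gt0 : (0 < m)%N by move: n_gt0; rewrite eq_n muln_gt0 => /andP[].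
have lt_mn : (m < n)%N by have := prime_gt1 p_pr; rewrite eq_n; nia.
rewrite (bigID (fun c => c %| m)%N) /=.
rewrite (eq_bigl (fun c => c %| m)%N) => [|c]; last first.
  by apply/andP/idP => [[]|c_dvd_m] //; split=> //; rewrite eq_n dvdn_mull.
rewrite IH //; last lia.
rewrite {2}eq_n mult_INR ln_mult; try by apply: lt_0_INR; have := prime_gt0 p_pr; lia.
rewrite Rplus_comm; congr (_ + _); set P := (p ^ (logn p m).+1)%N.
have P_new : (P %| p * m)%N && ~~ (P %| m)%N.
  rewrite -eq_n !pfactor_dvdn // eq_n lognM ?(prime_gt0 p_pr) //.
  by rewrite (logn_prime p p_pr) eqxx add1n leqnn ltnn.
have lt_PN : (1 <= P < N)%N.
  case/andP: P_new => /dvdn_leq; rewrite -eq_n => /(_ n_gt0) le_Pn _.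
  by rewrite (leq_ltn_trans le_Pn) // expn_gt0 prime_gt0.
have -> : ln (INR p) = \rsum_(1 <= c < N | c == P) ln (INR p) by rewrite big_nat1_eq lt_PN.
rewrite big_mkcond [RHS]big_mkcond; apply: eq_bigr => c _.
case: ifP => [c_new|c_old]; first by rewrite (mangoldt_new_divisor p_pr m_gt0) -?eq_n.
by case: eqP => // eq_cP; rewrite eq_cP eq_n P_new in c_old.
Qed.

Lemma mangoldt_nonprime_bounds n s L : mangoldt n <> 0 -> ~~ prime n ->
  (n < s ^ 2)%N -> (n < 2 ^ L)%N -> exists p i, n = (p ^ i)%N /\ (p < s)%N /\ (i < L)%N.
Proof.
rewrite /mangoldt; case eq_n : (primes n) => [|p [|q r]] // _ n_npr lt_s lt_L.
have [p_pr eq_np] := primes1P eq_n; exists p, (logn p n); split=> //.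
have p_gt1 := prime_gt1 p_pr.
have log_gt1 : (1 < logn p n)%N.
  case: (logn p n) eq_np => [|[|//]] eq_np; first by rewrite eq_np in eq_n.
  by rewrite eq_np expn1 p_pr in n_npr.
split.
  rewrite -(ltn_exp2r _ _ (_ : 0 < 2)%N) //; apply: leq_ltn_trans lt_s.
  by rewrite {1}eq_np leq_exp2l.
rewrite -(ltn_exp2l _ _ (_ : 1 < 2)%N) //; apply: leq_ltn_trans lt_L.
by rewrite {2}eq_np leq_exp2r //; lia.
Qed.

Lemma rsum_ge_term a b (F : nat -> R) i : (forall j, 0 <= F j) -> (a <= i < b)%N ->
  F i <= \rsum_(a <= j < b) F j.
Proof.
move=> F_ge0 i_range; rewrite (bigD1_seq i) ?mem_index_iota ?iota_uniq //=.
by have := @rsum_ge0 a b (fun j => j != i) F (fun j _ _ => F_ge0 j); lra.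
Qed.

Lemma sum_mangoldt_nonprime_le_mul N s L : (0 < N)%N -> (N <= s ^ 2)%N -> (N <= 2 ^ L)%N ->
  \rsum_(1 <= n < N | ~~ prime n) mangoldt n <= INR s * INR L * ln (INR N).
Proof.
move=> N_gt0 le_s le_L; pose power_of n p i := if n == (p ^ i)%N then ln (INR N) else 0.
have ln_N_ge0 : 0 <= ln (INR N) by apply/ln_ge0/(le_INR 1); lia.
have power_ge0 n p i : 0 <= power_of n p i by rewrite /power_of; case: ifP; lra.
have sum_ge0 n p : 0 <= \rsum_(0 <= i < L) power_of n p i by apply: rsum_ge0.
apply: Rle_trans (_ : \rsum_(1 <= n < N) \rsum_(0 <= p < s) \rsum_(0 <= i < L) power_of n p i <= _).
  rewrite big_mkcond; apply: rsum_le => n n_range _.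
  case: ifP => [n_npr|_]; last by apply: rsum_ge0.
  case: (Req_dec (mangoldt n) 0) => [->|n_neq0]; first by apply: rsum_ge0.
  have lt_nN : (n < N)%N by lia.
  have [p [i [eq_n [lt_ps lt_iL]]]] :=
    mangoldt_nonprime_bounds n_neq0 n_npr (leq_trans lt_nN le_s) (leq_trans lt_nN le_L).
  apply: Rle_trans (rsum_ge_term (i := p) (sum_ge0 n) _); last lia.
  apply: Rle_trans (rsum_ge_term (i := i) (power_ge0 n p) _); last lia.
  by rewrite /power_of -eq_n eqxx; apply: mangoldt_le_ln; lia.
have -> : INR s * INR L * ln (INR N) = \rsum_(0 <= p < s) \rsum_(0 <= i < L) ln (INR N).
  by rewrite !rsum_const !subn0; ring.
rewrite exchange_big /=.
apply: rsum_le => p _ _; rewrite exchange_big /=; apply: rsum_le => i _ _.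
by rewrite -big_mkcond big_nat1_eq; case: ifP; lra.
Qed.

Lemma sum_ln_mangoldt m N : (m < N)%N ->
  \rsum_(1 <= k < m.+1) ln (INR k) = \rsum_(1 <= c < N) (INR (m %/ c) * mangoldt c).
Proof.
move=> lt_mN.
rewrite (@eq_big_nat _ _ _ 1 m.+1 _ (fun k => \rsum_(1 <= c < N | (c %| k)%N) mangoldt c)) =>
  [|k k_range]; last first.
  by rewrite sum_mangoldt //; lia.
under eq_bigr do rewrite big_mkcond.
rewrite exchange_big /=; apply: eq_big_nat => c c_range.
rewrite divn_count_dvd (big_morph INR plus_INR INR_0) big_distrl /=.
by apply: eq_bigr => k _; case: (c %| k)%N; rewrite /= ?INR_1 ?INR_0; ring.
Qed.

(* The ratio of [(2n)!] to the square of [n!] is at least [2 ^ n], and a prime power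
   [c] contributes at most [mangoldt c] to its logarithm. *)
Lemma chebyshev_lower n : (0 < n)%N ->
  INR n / 2 <= \rsum_(1 <= c < (2 * n).+1) mangoldt c.
Proof.
move=> n_gt0; set N := (2 * n).+1.
have log_fact2n := @sum_ln_mangoldt (2 * n) N (leqnn _).
have log_factn := @sum_ln_mangoldt n N ltac:(lia).
have ratio_ge : INR n * ln 2 <= \rsum_(1 <= k < N) ln (INR k) -
  2 * \rsum_(1 <= k < n.+1) ln (INR k).
  rewrite (@big_cat_nat _ _ _ n.+1 1 N) //=; last by lia.
  have -> : \rsum_(n.+1 <= k < N) ln (INR k) = \rsum_(1 <= k < n.+1) ln (INR (k + n)%N).
    by rewrite -{1}[n.+1]add1n big_addn (_ : (N - n = n.+1)%N) //; lia.
  suff : INR n * ln 2 + \rsum_(1 <= k < n.+1) ln (INR k) <=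
    \rsum_(1 <= k < n.+1) ln (INR (k + n)%N) by lra.
  have -> : INR n * ln 2 = \rsum_(1 <= k < n.+1) ln 2 by rewrite rsum_const subSS subn0.
  rewrite -big_split /=; apply: rsum_le => k k_range _.
  have k_gt0 : 0 < INR k by apply: lt_0_INR; lia.
  rewrite -ln_mult; try lra; apply: ln_le; first lra.
  by rewrite plus_INR; have : INR k <= INR n by [apply: le_INR; lia]; lra.
apply: Rle_trans (_ : INR n * ln 2 <= _); first by have := ln_lt_2; have := pos_INR n; nra.
apply: Rle_trans ratio_ge _; rewrite log_factn log_fact2n big_distrr /=.
suff : \rsum_(1 <= c < N) (INR (2 * n %/ c) * mangoldt c) <=
  \rsum_(1 <= c < N) mangoldt c + \rsum_(1 <= c < N) (2 * (INR (n %/ c) * mangoldt c)) by lra.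
rewrite -big_split /=; apply: rsum_le => c c_range _.
have div_le : INR (2 * n %/ c) <= 2 * INR (n %/ c) + 1.
  rewrite -INR_2 -mult_INR -S_INR; apply: le_INR.
  suff : (2 * n %/ c < (2 * (n %/ c)).+2)%N by lia.
  by rewrite ltn_divLR; [have := ltn_ceil n (_ : 0 < c)%N; nia|lia].
by have := mangoldt_ge0 c; nra.
Qed.

(** * Primes in dyadic intervals *)

Definition prime_weight (n : nat) : R := if prime n then mangoldt n else 0.

Lemma prime_weight_gt0 n : 0 < prime_weight n -> prime n.
Proof. by rewrite /prime_weight; case: prime => //; lra. Qed.

Lemma prime_weight_ge0 n : 0 <= prime_weight n.
Proof. by rewrite /prime_weight; case: prime; [apply: mangoldt_ge0|lra]. Qed.

Lemma prime_weight_le_ln n N : (0 < n <= N)%N -> prime_weight n <= ln (INR N).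
Proof.
move=> n_range; rewrite /prime_weight; case: prime; first exact: mangoldt_le_ln.
by apply/ln_ge0/(le_INR 1); lia.
Qed.

Lemma rsum_mangoldt_split a b :
  \rsum_(a <= n < b) mangoldt n =
  \rsum_(a <= n < b) prime_weight n + \rsum_(a <= n < b | ~~ prime n) mangoldt n.
Proof. by rewrite (bigID prime) /= [X in X + _]big_mkcond. Qed.

Definition dyadic_prime_weight (i : nat) : R := \rsum_(2 ^ i <= n < 2 ^ i.+1) prime_weight n.

Lemma rsum_dyadic_prime_weight_ge K h : (0 < K)%N -> (h <= K <= (2 * h).+1)%N ->
  INR (2 ^ K) / 4 <= (1 + INR (2 ^ h) + INR (2 ^ h.+1) * INR K) * ln (INR (2 ^ K)) +
    \rsum_(h <= i < K) dyadic_prime_weight i.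
Proof.
move=> K_gt0 hK_range; set N := (2 ^ K)%N; have N_gt0 : (0 < N)%N by rewrite expn_gt0.
have le_hN : (2 ^ h <= N)%N by rewrite leq_exp2l //; lia.
have := @chebyshev_lower (2 ^ K.-1) (ltac:(by rewrite expn_gt0)).
rewrite -expnS prednK // -/N; have -> : INR (2 ^ K.-1) / 2 = INR N / 4.
  by rewrite /N -{2}(prednK K_gt0) INR_exp2S; field.
rewrite big_nat_recr // /= rsum_mangoldt_split (@big_cat_nat _ _ _ (2 ^ h)%N) ?expn_gt0 //=.
rewrite big_dyadic /=; last lia.
have last_le : mangoldt N <= ln (INR N) by apply: mangoldt_le_ln; rewrite N_gt0 /=.
have nonprime_le : \rsum_(1 <= n < N | ~~ prime n) mangoldt n <=
  INR (2 ^ h.+1) * INR K * ln (INR N).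
  by apply: sum_mangoldt_nonprime_le_mul => //; rewrite -expnM /N leq_exp2l //; lia.
have ln_N_ge0 : 0 <= ln (INR N) by apply/ln_ge0/(le_INR 1); lia.
have small_le : \rsum_(1 <= n < 2 ^ h) prime_weight n <= INR (2 ^ h) * ln (INR N).
  apply: Rle_trans (rsum_le_const ln_N_ge0 _) _.
    by move=> n n_range _; apply: prime_weight_le_ln; lia.
  by apply: Rmult_le_compat_r => //; apply: le_INR; lia.
by rewrite /dyadic_prime_weight; lra.
Qed.

Lemma for_large_exp2 (P : R -> Prop) : for_large P ->
  exists h0, forall h, (h0 <= h)%N -> P (INR (2 ^ h)).
Proof.
move=> /for_large_INR [N0 P_large]; exists N0 => h le_h; apply: P_large.
by have := ltn_expl h (isT : 1 < 2)%N; lia.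
Qed.

Lemma half_sqr_exp2 K : let y := INR (2 ^ K./2) in y * y <= INR (2 ^ K) <= 2 * (y * y).
Proof.
rewrite /= -mult_INR -INR_2 -mult_INR multE -expnD -expnS.
by split; apply: INR_exp2_le; lia.
Qed.

Lemma rsum_dyadic_prime_weight_large : exists K0, forall K, (K0 <= K)%N ->
  INR (2 ^ K) / 8 <= \rsum_(K./2 <= i < K) dyadic_prime_weight i.
Proof.
have [h0 large] := for_large_exp2 (for_large_and (@for_large_ln_pow_le 160 2 1 ltac:(lra))
  (for_large_ge 2)).
exists (2 * h0).+2 => K le_K; have [] := large K./2 ltac:(lia).
have := half_sqr_exp2 K; have := @rsum_dyadic_prime_weight_ge K K./2 ltac:(lia) ltac:(lia).
rewrite INR_exp2S; set y := INR (2 ^ K./2); set X := INR (2 ^ K).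
move=> weight_ge /= X_range log_le y_ge2; rewrite Rpower_1 in log_le; last lra.
have X_ge1 : 1 <= X by nra.
set l := 1 + ln y in log_le; have l_ge1 : 1 <= l by have := @ln_ge0 y ltac:(lra); rewrite /l; lra.
have ln_X_le : ln X <= 2 * l.
  apply: Rle_trans (ln_le _ _ _ (proj2 X_range)) _; first lra.
  by apply: Rle_trans (ln_double_le _) _; [nra|rewrite ln_mult /l; lra].
have ln_X_ge0 := ln_ge0 X_ge1.
have K_le : INR K <= 2 * ln X.
  by apply: INR_le_ln_exp2; rewrite /X INR_expn INR_2; apply: Rle_refl.
have coef_le : 1 + y + 2 * y * INR K <= 10 * (y * l).
  have : y * INR K <= y * (4 * l) by apply: Rmult_le_compat_l; lra.
  by nra.
have : (1 + y + 2 * y * INR K) * ln X <= 10 * (y * l) * (2 * l).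
  by apply: Rmult_le_compat => //; have := pos_INR K; nra.
have : 160 * (y * (l * l)) <= y * y.
  by rewrite -Rmult_assoc (Rmult_comm 160) Rmult_assoc; apply: Rmult_le_compat_l; lra.
by lra.
Qed.

Lemma rsum_lt_exists a b (F G : nat -> R) :
  \rsum_(a <= i < b) F i < \rsum_(a <= i < b) G i -> exists i, (a <= i < b)%N /\ F i < G i.
Proof.
move=> lt_FG; apply: NNPP => none; apply: (Rlt_not_le _ _ lt_FG); apply: rsum_le => i i_range _.
by apply: Rnot_lt_le => lt_i; apply: none; exists i.
Qed.

Lemma rsum_exp2_le h K : (h <= K)%N -> \rsum_(h <= i < K) INR (2 ^ i) <= INR (2 ^ K).
Proof.
move/subnK <-; elim: (K - h)%N => [|k IH]; first by rewrite big_geq //; apply: pos_INR.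
by rewrite addSn big_nat_recr ?leq_addl //= INR_exp2S; lra.
Qed.

Lemma exists_dyadic_prime_weight_ge eps : 0 < eps -> exists K0, forall K, (K0 <= K)%N ->
  exists i, (K <= (2 * i).+1)%N /\ (i < K)%N /\
  INR (2 ^ i) * Rpower (INR (2 ^ i)) (- eps) <= dyadic_prime_weight i.
Proof.
move=> eps_gt0; have [K1 weight_large] := rsum_dyadic_prime_weight_large.
have [h0 pow_large] := for_large_exp2 (@for_large_le_Rpower 9 eps eps_gt0).
exists (maxn K1 (2 * h0).+1) => K le_K.
set y := INR (2 ^ K./2); have y_gt0 : 0 < y by apply: INR_exp2_gt0.
have y_eps_le : 9 * Rpower y (- eps) <= 1.
  by rewrite -(Rpower_mulN y eps); apply: Rmult_le_compat_r => //; apply: pow_large; lia.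
have [i [i_range lt_i]] : exists i, (K./2 <= i < K)%N /\
    INR (2 ^ i) * Rpower y (- eps) < dyadic_prime_weight i.
  apply: rsum_lt_exists; rewrite -big_distrl /=.
  have := @rsum_exp2_le K./2 K ltac:(lia); have := weight_large K ltac:(lia).
  by have := INR_exp2_gt0 K; have := Rpower_gt0 y (- eps); nra.
exists i; split; [lia|split; [lia|apply/Rlt_le/Rle_lt_trans/lt_i]].
apply: Rmult_le_compat_l; first exact: pos_INR.
by apply: Rle_Rpower_l_npos; [split=> //; apply: INR_exp2_le; lia|lra].
Qed.

Lemma Rpower_quarter_le x y : 16 <= x -> 0 < y -> x <= 4 * (y * y) -> Rpower x (/ 4) <= y.
Proof.
move=> x_ge y_gt0 x_le; set r := Rpower x (/ 4).
have r_gt0 : 0 < r by apply: Rpower_gt0.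
have eq_x : x = (r * r) * (r * r) by rewrite /r -!Rpower_plus (_ : _ + _ = 1) ?Rpower_1; lra.
have r_ge2 : 2 <= r by apply: Rnot_lt_le => lt_r; have : r * r < 4 by [nra]; nra.
apply: Rnot_lt_le => lt_y; have yy_lt : y * y < r * r by nra.
have : 4 * (r * r) <= r * r * (r * r) by apply: Rmult_le_compat_r; nra.
by lra.
Qed.

Lemma for_large_prime_weight_scale eps : 0 < eps -> for_large (fun X => forall N : nat, INR N = X ->
  exists M : nat, (0 < M)%N /\ (2 * M <= N)%N /\ Rpower X (/ 4) <= INR M /\
    INR M * Rpower (INR M) (- eps) <= \rsum_(M <= n < 2 * M) prime_weight n).
Proof.
move=> eps_gt0; have [K0 primes_large] := exists_dyadic_prime_weight_ge eps_gt0.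
exists (Rmax 16 (INR (2 ^ K0))) => X /Rlt_le N_ge N eq_X; subst X.
have N_ge16 := Rle_trans _ _ _ (Rmax_l _ _) N_ge; have N_geK0 := Rle_trans _ _ _ (Rmax_r _ _) N_ge.
have N_gt0 : (0 < N)%N by apply/ltP/INR_lt; rewrite INR_0; lra.
set K := trunc_log 2 N; have le_KN : (2 ^ K <= N)%N by apply: trunc_logP.
have lt_NK : (N < 2 ^ K.+1)%N by apply: trunc_log_ltn.
have le_K0 : (K0 <= K)%N.
  by rewrite -ltnS -(ltn_exp2l _ _ (_ : 1 < 2)%N) //; apply: leq_ltn_trans lt_NK; apply/leP/INR_le.
have [i [le_Ki [lt_iK weight_ge]]] := primes_large K le_K0.
have M_gt0 : (0 < 2 ^ i)%N by rewrite expn_gt0.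
exists (2 ^ i)%N; split=> //; split; first by rewrite -expnS (leq_trans _ le_KN) // leq_exp2l.
split; last by rewrite -expnS.
apply: Rpower_quarter_le => //; first by apply: INR_exp2_gt0.
have -> : 4 = 2 * 2 by ring.
rewrite -INR_2 -!mult_INR; apply: le_INR; apply/leP; apply: ltnW; apply: leq_trans lt_NK _.
by rewrite !multE -expnD -[(2 * 2)%N]/(2 ^ 2)%N -expnD leq_exp2l //; lia.
Qed.

Lemma exp2_cover M : (0 < M)%N ->
  exists L, (2 * M <= 2 ^ L)%N /\ INR L <= 3 * (1 + ln (INR M)).
Proof.
move=> M_gt0; have INR_M_ge1 : 1 <= INR M by apply: (le_INR 1); lia.
exists (trunc_log 2 (2 * M)).+1; split; first by apply/ltnW/trunc_log_ltn.
set k := trunc_log _ _; have le_2M : (2 ^ k <= 2 * M)%N by apply: trunc_logP => //; lia.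
have := @INR_le_ln_exp2 k (2 * INR M); rewrite S_INR.
have := ln_double_le (_ : 0 < INR M); have := ln_ge0 INR_M_ge1.
suff : 2 ^ k <= 2 * INR M by move=> le_pow ln_M_ge0 /(_ ltac:(lra)) ln_2M_le /(_ le_pow); lra.
by rewrite -INR_2 -INR_expn -mult_INR; apply: le_INR; lia.
Qed.

Lemma sum_mangoldt_nonprime_le_sqrt M : (0 < M)%N ->
  \rsum_(1 <= n < 2 * M | ~~ prime n) mangoldt n <=
  9 * (1 + ln (INR M)) ^ 2 * Rpower (INR M) (/ 2).
Proof.
move=> M_gt0; have INR_M_ge1 : 1 <= INR M by apply: (le_INR 1); lia.
set l := 1 + ln (INR M); set r := Rpower (INR M) (/ 2).
have r_ge1 : 1 <= r by apply: Rpower_ge1; lra.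
have rr : r * r = INR M by apply: Rpower_half_mul; lra.
have [L [le_exp L_le]] := exp2_cover M_gt0; rewrite -/l in L_le.
have [s' s'_range] := @nfloor_ex (2 * r) ltac:(lra).
have s_range : 2 * r <= INR s'.+1 <= 3 * r by rewrite S_INR; lra.
have le_s : (2 * M <= s'.+1 ^ 2)%N.
  by apply/leP/INR_le; rewrite mult_INR INR_2 INR_expn; simpl; nra.
apply: Rle_trans (sum_mangoldt_nonprime_le_mul (N := 2 * M) _ le_s le_exp) _; first lia.
have -> : 9 * l ^ 2 * r = 3 * r * (3 * l) * l by ring.
have ln_2M_le : ln (INR (2 * M)) <= l by rewrite mult_INR INR_2; apply: ln_double_le; lra.
have ln_2M_ge0 : 0 <= ln (INR (2 * M)) by apply/ln_ge0/(le_INR 1); lia.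
apply: Rmult_le_compat ln_2M_le => //; first by apply: Rmult_le_pos; apply: pos_INR.
by apply: Rmult_le_compat; try exact: pos_INR; lra.
Qed.

(** * Vaughan's identity *)

Section Vaughan.
Variables (M U V L : nat) (F : nat -> C) (E : R).
Hypotheses (V_gt0 : (0 < V)%N) (lt_VM : (V < M)%N) (U_gt0 : (0 < U)%N) (lt_UM : (U < M)%N).
Hypothesis le_2M_exp2 : (2 * M <= 2 ^ L)%N.
Hypothesis E_ge0 : 0 <= E.
Hypothesis F_le1 : forall n, Cmod (F n) <= 1.
Hypothesis linear_sum_le : forall D a b, (0 < D <= U * V)%N ->
  (forall n, (a <= n < b)%N -> (M <= D * n < 2 * M)%N) ->
  Cmod (\csum_(a <= n < b) F (D * n)%N) <= INR M / INR D * E.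
Hypothesis bilinear_sum_le : forall d c1 c2 a b, (0 < d)%N -> (0 < c2 < c1)%N ->
  (c1 * d * U < 2 * M)%N ->
  (forall n, (a <= n < b)%N -> (M <= c1 * d * n < 2 * M)%N) ->
  Cmod (\csum_(a <= n < b) (F (c1 * d * n)%N * Cconj (F (c2 * d * n)%N))) <=
  INR M / INR (c1 * d) * E.

Let N := (2 * M)%N.
Let ell := ln (INR N).
Let Phi n : C := if (M <= n < N)%N then F n else RtoC 0.

Let M_gt0 : 0 < INR M. Proof. by apply: lt_0_INR; lia. Qed.
Let N_ge1 : 1 <= INR N. Proof. by apply: (le_INR 1); lia. Qed.
Let ell_ge0 : 0 <= ell. Proof. exact: ln_ge0. Qed.
Let ME_ge0 : 0 <= INR M * E. Proof. by apply: Rmult_le_pos => //; apply: Rlt_le. Qed.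

Let Phi_large n : (N <= n)%N -> Phi n = RtoC 0.
Proof. by move=> le_Nn; rewrite /Phi ifF //; lia. Qed.

Let Phi_small n : (n < M)%N -> Phi n = RtoC 0.
Proof. by move=> lt_nM; rewrite /Phi ifF //; lia. Qed.

Let Cmod_Phi_le1 n : Cmod (Phi n) <= 1.
Proof. by rewrite /Phi; case: ifP => _ //; rewrite Cmod_0; lra. Qed.

Let inv_ge0 n : (0 < n)%N -> 0 <= / INR n.
Proof. by move=> n_gt0; apply/Rlt_le/Rinv_0_lt_compat/lt_0_INR; lia. Qed.

Let rsum_inv_le c (P : pred nat) : 0 <= c ->
  \rsum_(1 <= d < N | P d) (c * / INR d) <= c * (1 + ell).
Proof.
move=> c_ge0; apply: Rle_trans (rsum_le_cond _ _) _ => [d d_range|].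
  by apply: Rmult_le_pos => //; apply: inv_ge0; lia.
rewrite -big_distrr; apply: Rmult_le_compat_l => //.
have := @harmonic_le N ltac:(lia); rewrite big_nat_recr /=; last by lia.
by have := @inv_ge0 N ltac:(lia); rewrite /ell; lra.
Qed.

Let Rabs_coef_le b c : (0 < c < N)%N -> Rabs (moebius b * mangoldt c) <= ell.
Proof.
move=> c_range; rewrite Rabs_mult (Rabs_pos_eq _ (mangoldt_ge0 c)).
have := @mangoldt_le_ln c N ltac:(lia); rewrite -/ell.
have := Rabs_moebius_le1 b; have := mangoldt_ge0 c; have := Rabs_pos (moebius b); nra.
Qed.

Let term b c d : C := (RtoC (moebius b * mangoldt c) * Phi (b * c * d)%N)%C.

Let mangoldt_Phi_expand c : (1 <= c < N)%N -> (RtoC (mangoldt c) * Phi c)%C =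
  \csum_(1 <= b < N) \csum_(1 <= d < N) term b c d.
Proof.
move=> c_range; pose f b m := (RtoC (moebius b * mangoldt c) * Phi (c * m)%N)%C.
transitivity (\csum_(1 <= b < N) \csum_(1 <= d < N) f b (b * d)%N); last first.
  by apply: eq_bigr => b _; apply: eq_bigr => d _; rewrite /term /f mulnA (mulnC c).
rewrite big_divisors => [|b m le_Nm]; last by rewrite /f Phi_large ?Cmult_0_r //; nia.
transitivity (\csum_(1 <= m < N | m == 1%N) (RtoC (mangoldt c) * Phi (c * m)%N)).
  by rewrite (big_nat1_eq Cplus) ifT ?muln1 //; lia.
rewrite big_mkcond; apply: eq_big_nat => m m_range.
transitivity (RtoC (\rsum_(1 <= b < N | (b %| m)%N) moebius b) * RtoC (mangoldt c) *
  Phi (c * m)%N)%C.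
  by rewrite sum_moebius //; case: ifP => _; ring.
by rewrite RtoC_rsum !big_distrl; apply: eq_bigr => b _; rewrite /f RtoC_mult.
Qed.

Let term_sum_log b : (0 < b < N)%N ->
  \csum_(1 <= c < N) \csum_(1 <= d < N) term b c d =
  (RtoC (moebius b) * \csum_(1 <= m < N) (RtoC (ln (INR m)) * Phi (b * m)%N))%C.
Proof.
move=> b_range; pose f c m := (RtoC (moebius b * mangoldt c) * Phi (b * m)%N)%C.
rewrite big_distrr.
transitivity (\csum_(1 <= c < N) \csum_(1 <= d < N) f c (c * d)%N).
  by apply: eq_bigr => c _; apply: eq_bigr => d _; rewrite /term /f mulnA.
rewrite big_divisors => [|c m le_Nm]; last by rewrite /f Phi_large ?Cmult_0_r //; nia.
apply: eq_big_nat => m m_range; rewrite -(sum_mangoldt m_range) RtoC_rsum big_distrl big_distrr /=.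
by apply: eq_bigr => c _; rewrite /f RtoC_mult; ring.
Qed.

Let Phi_interval (w : nat -> C) D : (0 < D)%N -> exists a b,
  (forall n, (a <= n < b)%N -> (M <= D * n < 2 * M)%N) /\
  \csum_(1 <= n < N) (w n * Phi (D * n)%N) = \csum_(a <= n < b) (w n * F (D * n)%N).
Proof.
move=> D_gt0.
have [a [b [ab_range eq_ab]]] := @big_nat_convex _ _ Cplus (fun n => w n * F (D * n)%N)%C
  (fun n => M <= D * n < 2 * M)%N N ltac:(move=> i j k ijk Pi Pk; nia).
exists a, b; split=> [n /ab_range[]//|]; rewrite -eq_ab [RHS]big_mkcond /= [RHS]big_ltn;
  last by lia.
rewrite ifF ?Cplus_0_l; last by lia.
by apply: eq_bigr => n _; rewrite /Phi /N; case: ifP => _ //; rewrite Cmult_0_r.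
Qed.

Let Phi_log_sum_le b : (0 < b <= U)%N ->
  Cmod (\csum_(1 <= m < N) (RtoC (ln (INR m)) * Phi (b * m)%N)) <= ell * (INR M / INR b * E).
Proof.
move=> b_range; have b_gt0 : 0 < INR b by apply: lt_0_INR; lia.
have [a [b' [ab_range ->]]] := @Phi_interval (fun m => RtoC (ln (INR m))) b ltac:(lia).
apply: csum_monotone_weight_le => //.
- by apply: Rmult_le_pos => //; apply: Rdiv_le_0_compat => //; apply: Rlt_le.
- by move=> c le_ac; apply: linear_sum_le => [|n n_range]; [nia|apply: ab_range; lia].
- move=> n le_an lt_nb; apply: ln_le; last by apply: le_INR; lia.
  by apply: lt_0_INR; have := ab_range n ltac:(lia); nia.
move=> n /ab_range n_range; split; first by apply: ln_ge0; apply: (le_INR 1); nia.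
by apply: ln_le; [apply: lt_0_INR|apply: le_INR]; nia.
Qed.

Let log_part_le :
  Cmod (\csum_(1 <= b < N | (b <= U)%N) \csum_(1 <= c < N) \csum_(1 <= d < N) term b c d) <=
  INR M * E * (1 + ell) ^ 2.
Proof.
apply: Rle_trans (Cmod_csum _ _ _ _) _.
apply: Rle_trans (_ : \rsum_(1 <= b < N | (b <= U)%N) (ell * (INR M * E) * / INR b) <= _).
  apply: rsum_le => b b_range le_bU; rewrite term_sum_log // Cmod_mult Cmod_R.
  have := @Phi_log_sum_le b ltac:(lia); set X := Cmod _; have X_ge0 : 0 <= X by apply: Cmod_ge_0.
  have -> : ell * (INR M * E) * / INR b = ell * (INR M / INR b * E) by rewrite /Rdiv; ring.
  by have := Rabs_moebius_le1 b; nra.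
apply: Rle_trans (rsum_inv_le _ _) _; first exact: Rmult_le_pos.
by nra.
Qed.

Let Phi_sum_le b c : (0 < b <= U)%N -> (0 < c <= V)%N ->
  Cmod (\csum_(1 <= d < N) Phi (b * c * d)%N) <= INR M / INR (b * c) * E.
Proof.
move=> b_range c_range; have [a [b' [ab_range eq_ab]]] :=
  @Phi_interval (fun=> RtoC 1) (b * c) ltac:(nia).
have -> : \csum_(1 <= d < N) Phi (b * c * d)%N = \csum_(a <= n < b') F (b * c * n)%N.
  by move: eq_ab; under eq_bigr do rewrite Cmult_1_l; under [RHS]eq_bigr do rewrite Cmult_1_l.
by apply: linear_sum_le => //; nia.
Qed.

Let short_part_le :
  Cmod (\csum_(1 <= b < N | (b <= U)%N) \csum_(1 <= c < N | (c <= V)%N)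
    \csum_(1 <= d < N) term b c d) <= INR M * E * (1 + ell) ^ 3.
Proof.
have coef_ge0 b : (0 < b)%N -> 0 <= ell * (INR M * E) * / INR b.
  by move=> b_gt0; apply: Rmult_le_pos; [apply: Rmult_le_pos|apply: inv_ge0].
apply: Rle_trans (Cmod_csum _ _ _ _) _.
apply: Rle_trans (_ : \rsum_(1 <= b < N | (b <= U)%N)
  (ell * (INR M * E) * (1 + ell) * / INR b) <= _).
  apply: rsum_le => b b_range le_bU; apply: Rle_trans (Cmod_csum _ _ _ _) _.
  have -> : ell * (INR M * E) * (1 + ell) * / INR b =
      ell * (INR M * E) * / INR b * (1 + ell) by ring.
  apply: Rle_trans (rsum_inv_le (fun c => c <= V)%N (coef_ge0 b _)); last lia.
  apply: rsum_le => c c_range le_cV; rewrite -big_distrr /= Cmod_mult Cmod_R.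
  have -> : ell * (INR M * E) * / INR b * / INR c = ell * (INR M / INR (b * c) * E).
    by rewrite mult_INR; field; split; apply: not_0_INR; lia.
  apply: Rmult_le_compat; [exact: Rabs_pos|exact: Cmod_ge_0|apply: Rabs_coef_le; lia|].
  by apply: Phi_sum_le; lia.
apply: Rle_trans (rsum_inv_le _ _) _.
  by apply: Rmult_le_pos; [apply: Rmult_le_pos|lra].
have -> : ell * (INR M * E) * (1 + ell) * (1 + ell) = INR M * E * (ell * (1 + ell) ^ 2) by ring.
by apply: Rmult_le_compat_l => //; have := pow2_ge_0 (1 + ell); simpl; nra.
Qed.

Let count_multiples q : (0 < q)%N -> \rsum_(1 <= b < N | (b * q < N)%N) 1 <= INR N / INR q.
Proof.
move=> q_gt0; have INR_q_gt0 : 0 < INR q by apply: lt_0_INR; lia.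
have le_divN : (N %/ q * q <= N)%N := leq_divM N q.
have lt_div b : (b * q < N)%N -> (b < (N %/ q).+1)%N
  by move=> lt_bqN; rewrite ltnS leq_divRL //; lia.
set K := (N %/ q)%N in le_divN lt_div; apply: (Rle_trans _ (INR K)); last first.
  by apply/Rle_div_r => //; rewrite -mult_INR; apply: le_INR; lia.
apply: Rle_trans (_ : \rsum_(1 <= b < N | (b < K.+1)%N) 1 <= _).
  rewrite big_mkcond [X in _ <= X]big_mkcond; apply: rsum_le => b _ _.
  by case: ifP => [/lt_div ->|_]; [lra|case: ifP; lra].
case: (leqP K.+1 N) => [lt_KN|le_NK].
  by rewrite -(big_nat_widen 1 _ _ xpredT) // rsum_const Rmult_1_r; apply: le_INR; lia.
apply: Rle_trans (rsum_le_cond _ _) _; first by move=> *; lra.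
by rewrite rsum_const Rmult_1_r; apply: le_INR; lia.
Qed.

Let correlation d c1 c2 : C :=
  \csum_(1 <= b < N | (U < b)%N) (Phi (b * c1 * d)%N * Cconj (Phi (b * c2 * d)%N)).

Let correlation_diag_le d c : (0 < d)%N -> (0 < c)%N ->
  Cmod (correlation d c c) <= INR N / INR (c * d).
Proof.
move=> d_gt0 c_gt0; apply: Rle_trans (Cmod_csum _ _ _ _) _.
apply: Rle_trans (count_multiples (_ : 0 < c * d)%N); last by nia.
rewrite big_mkcond [X in _ <= X]big_mkcond; apply: rsum_le => b _ _.
rewrite mulnA Cmod_mult Cmod_conj.
case: (ltnP (b * c * d) N) => [lt_N|le_N]; last first.
  by rewrite Phi_large // Cmod_0; case: ifP; lra.
have := Cmod_Phi_le1 (b * c * d); have := Cmod_ge_0 (Phi (b * c * d)).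
by case: ifP => _; nra.
Qed.

Let correlation_lt_le d c1 c2 : (0 < d)%N -> (0 < c2 < c1)%N ->
  Cmod (correlation d c1 c2) <= INR M / INR (c1 * d) * E.
Proof.
move=> d_gt0 c_range; have cd_gt0 : 0 < INR (c1 * d) by apply: lt_0_INR; nia.
pose P b := [&& (U < b)%N, (M <= c1 * d * b < N)%N & (M <= c2 * d * b < N)%N].
have [a [b [ab_range eq_ab]]] := @big_nat_convex _ _ Cplus
  (fun n => F (c1 * d * n)%N * Cconj (F (c2 * d * n)%N))%C P N
  ltac:(rewrite /P /N; move=> i j k ijk Pi Pk; nia).
have -> : correlation d c1 c2 = \csum_(a <= n < b) (F (c1 * d * n)%N * Cconj (F (c2 * d * n)%N)).
  rewrite -eq_ab [RHS]big_mkcond /= [RHS]big_ltn ?Cplus_0_l; last by lia.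
  rewrite /correlation big_mkcond; apply: eq_bigr => n _.
  rewrite /P /Phi -!(mulnA n) !(mulnC n).
  case: ifP => _ //=; case: ifP => _ /=; last by rewrite Cmult_0_l.
  by case: ifP => _ //=; rewrite Cconj_RtoC Cmult_0_r.
case: (ltnP a b) => [lt_ab|le_ba]; last first.
  rewrite big_geq // Cmod_0; apply: Rmult_le_pos => //.
  by apply: Rdiv_le_0_compat => //; apply: Rlt_le.
have [Pa _] := ab_range a ltac:(lia); rewrite /P /N in Pa.
apply: bilinear_sum_le => //; first by nia.
by move=> n /ab_range[]; rewrite /P /N => /and3P[].
Qed.

Let correlation_le d c1 c2 B : (0 < d)%N -> (0 < B)%N -> (B <= c1)%N -> (B <= c2)%N ->
  Cmod (correlation d c1 c2) <=
  (if c2 == c1 then INR N / (INR B * INR d) else 0) + INR M / (INR B * INR d) * E.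
Proof.
move=> d_gt0 B_gt0 le_c1 le_c2.
have Bd_gt0 : 0 < INR B * INR d by apply: Rmult_lt_0_compat; apply: lt_0_INR; lia.
have inv_le c : (B <= c)%N -> / INR (c * d) <= / (INR B * INR d).
  by move=> le_Bc; rewrite -mult_INR; apply: Rinv_le_contravar;
    [apply: lt_0_INR|apply: le_INR]; nia.
have off_diag_ge0 : 0 <= INR M / (INR B * INR d) * E.
  by apply: Rmult_le_pos => //; apply: Rdiv_le_0_compat => //; apply: Rlt_le.
case: eqP => [->|neq_c].
  apply: Rle_trans (correlation_diag_le d_gt0 _) _; first by lia.
  have := Rmult_le_compat_l (INR N) _ _ ltac:(lra) (inv_le _ le_c1); rewrite -!/(Rdiv _ _); lra.
have off_diag e1 e2 : (B <= e2 < e1)%N ->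
    Cmod (correlation d e1 e2) <= 0 + INR M / (INR B * INR d) * E.
  move=> e_range; apply: Rle_trans (correlation_lt_le d_gt0 _) _; first by lia.
  rewrite Rplus_0_l; apply: Rmult_le_compat_r => //; apply: Rmult_le_compat_l; first lra.
  by apply: inv_le; lia.
case: (ltnP c2 c1) => [lt_c|le_c]; first by apply: off_diag; lia.
rewrite -Cmod_conj (_ : Cconj _ = correlation d c2 c1); first by apply: off_diag; lia.
rewrite /correlation Cconj_csum; apply: eq_bigr => b _.
by rewrite Cmult_conj Cconj_conj Cmult_comm.
Qed.

Let dyadic_part d i : C :=
  \csum_(2 ^ i <= c < 2 ^ i.+1 | (V < c < N)%N) \csum_(1 <= b < N | (U < b)%N) term b c d.

Let dyadic_inner d i b : C :=
  \csum_(2 ^ i <= c < 2 ^ i.+1 | (V < c < N)%N) (RtoC (mangoldt c) * Phi (b * c * d)%N).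

Let dyadic_part_inner d i :
  dyadic_part d i = \csum_(1 <= b < N | (U < b)%N) (RtoC (moebius b) * dyadic_inner d i b).
Proof.
rewrite /dyadic_part exchange_big /=; apply: eq_bigr => b _; rewrite big_distrr.
by apply: eq_bigr => c _; rewrite /term RtoC_mult /=; ring.
Qed.

Let dyadic_inner_sqr_sum d i :
  RtoC (\rsum_(1 <= b < N | (U < b)%N) Cmod (dyadic_inner d i b) ^ 2) =
  \csum_(2 ^ i <= c1 < 2 ^ i.+1 | (V < c1 < N)%N) \csum_(2 ^ i <= c2 < 2 ^ i.+1 | (V < c2 < N)%N)
    (RtoC (mangoldt c1 * mangoldt c2) * correlation d c1 c2).
Proof.
rewrite RtoC_rsum.
under [RHS]eq_bigr do under eq_bigr do rewrite big_distrr.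
under [RHS]eq_bigr do rewrite exchange_big.
rewrite [RHS]exchange_big /=; apply: eq_bigr => b _.
rewrite Cmod2_conj Cconj_csum big_distrl; apply: eq_bigr => c1 _.
rewrite big_distrr; apply: eq_bigr => c2 _ /=.
by rewrite Cmult_conj Cconj_RtoC RtoC_mult; ring.
Qed.

Let dyadic_inner_sqr_sum_le d i : (0 < d)%N ->
  \rsum_(1 <= b < N | (U < b)%N) Cmod (dyadic_inner d i b) ^ 2 <=
  ell ^ 2 * (INR N / INR d + INR (2 ^ i) * INR M / INR d * E).
Proof.
move=> d_gt0; rewrite -[X in X <= _]Rabs_pos_eq -?Cmod_R ?dyadic_inner_sqr_sum; last first.
  by apply: rsum_ge0 => b _ _; apply: pow2_ge_0.
have -> : (2 ^ i.+1 = 2 * 2 ^ i)%N by rewrite expnS.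
set B := (2 ^ i)%N.
have INR_d_gt0 : 0 < INR d by apply: lt_0_INR; lia.
have INR_B_gt0 : 0 < INR B by apply: lt_0_INR; lia.
have eq_B : (2 * B - B = B)%N by lia.
set diag := INR N / (INR B * INR d); set off := INR M / (INR B * INR d) * E.
have diag_ge0 : 0 <= diag by apply: Rdiv_le_0_compat; [lra|apply: Rmult_lt_0_compat].
have off_ge0 : 0 <= off.
  by apply: Rmult_le_pos => //; apply: Rdiv_le_0_compat; [lra|apply: Rmult_lt_0_compat].
have bound_ge0 (x : bool) : 0 <= ell ^ 2 * ((if x then diag else 0) + off).
  by apply: Rmult_le_pos; [apply: pow2_ge_0|case: x; lra].
apply: Rle_trans (csum_le_const (c := ell ^ 2 * (diag + INR B * off)) _ _) _.
- by apply: Rmult_le_pos; [apply: pow2_ge_0|nra].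
- move=> c1 c1_range c1_VN; apply: Rle_trans (Cmod_csum _ _ _ _) _.
  apply: Rle_trans (_ : \rsum_(B <= c2 < 2 * B)
    (ell ^ 2 * ((if c2 == c1 then diag else 0) + off)) <= _).
    rewrite big_mkcond; apply: rsum_le => c2 c2_range _; case: ifP => // c2_VN.
    rewrite Cmod_mult Cmod_R Rabs_mult !Rabs_pos_eq; try exact: mangoldt_ge0.
    have := @mangoldt_le_ln c1 N ltac:(lia); have := @mangoldt_le_ln c2 N ltac:(lia); rewrite -/ell.
    have := mangoldt_ge0 c1; have := mangoldt_ge0 c2 => m2_ge0 m1_ge0 m2_le m1_le.
    apply: Rmult_le_compat; [nra|exact: Cmod_ge_0|rewrite /= Rmult_1_r; exact: Rmult_le_compat|].
    by apply: correlation_le => //; lia.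
  rewrite -big_distrr; apply: Rmult_le_compat_l; first exact: pow2_ge_0.
  rewrite big_split /= -big_mkcond (big_nat1_eq Rplus (fun=> diag)) rsum_const eq_B.
  by case: ifP; lra.
by apply: Req_le; rewrite eq_B /diag /off; field; lra.
Qed.

Let s := sqrt (8 / INR V + 2 * E).

(* Cauchy-Schwarz in [b]; only the [b] with [b * 2 ^ i * d < N] contribute. *)
Let dyadic_part_sqr_le d i : (0 < d)%N ->
  Cmod (dyadic_part d i) ^ 2 <= INR N / INR (2 ^ i * d) *
    \rsum_(1 <= b < N | (U < b)%N) Cmod (dyadic_inner d i b) ^ 2.
Proof.
move=> d_gt0; set B := (2 ^ i)%N.
rewrite dyadic_part_inner; pose chi b : R := if (b * (B * d) < N)%N then 1 else 0.
have sum_le : Cmod (\csum_(1 <= b < N | (U < b)%N) (RtoC (moebius b) * dyadic_inner d i b)) <=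
    \rsum_(1 <= b < N | (U < b)%N) (chi b * Cmod (dyadic_inner d i b)).
  apply: Rle_trans (Cmod_csum _ _ _ _) _; apply: rsum_le => b b_range lt_Ub.
  rewrite Cmod_mult Cmod_R /chi; have := Rabs_moebius_le1 b; have := Cmod_ge_0 (dyadic_inner d i b).
  case: ifP => [_|ge_N]; first by nra.
  rewrite (_ : dyadic_inner d i b = RtoC 0) ?Cmod_0; first by lra.
  by apply: big_nat_idx => c c_range _; rewrite Phi_large ?Cmult_0_r //; nia.
apply: Rle_trans (pow_incr _ _ 2 (conj (Cmod_ge_0 _) sum_le)) _.
apply: Rle_trans (rsum_cauchy_schwarz _ _ _ _ _) _; apply: Rmult_le_compat_r.
  by apply: rsum_ge0 => b _ _; apply: pow2_ge_0.
apply: Rle_trans (count_multiples (_ : 0 < B * d)%N); last by nia.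
rewrite big_mkcond [X in _ <= X]big_mkcond; apply: rsum_le => b _ _.
by rewrite /chi; case: ifP => _; case: ifP => _; rewrite /=; lra.
Qed.

Let dyadic_part_le d i : (0 < d)%N -> Cmod (dyadic_part d i) <= INR M / INR d * ell * s.
Proof.
move=> d_gt0; set B := (2 ^ i)%N.
have INR_d_gt0 : 0 < INR d by apply: lt_0_INR; lia.
have INR_B_gt0 : 0 < INR B by apply: lt_0_INR; lia.
have INR_V_gt0 : 0 < INR V by apply: lt_0_INR; lia.
have bound_ge0 : 0 <= INR M / INR d * ell * s.
  by apply: Rmult_le_pos (sqrt_pos _); apply: Rmult_le_pos => //; apply: Rdiv_le_0_compat; lra.
case: (leqP (2 * B) V) => [le_BV|lt_VB].
  by rewrite /dyadic_part expnS big_nat_idx ?Cmod_0 // => c c_range c_VN; lia.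
suff sqr_le : Cmod (dyadic_part d i) ^ 2 <= (INR M / INR d * ell * s) ^ 2.
  by apply: Rnot_lt_le => lt_part; nra.
apply: Rle_trans (dyadic_part_sqr_le i d_gt0) _.
apply: Rle_trans (Rmult_le_compat_l _ _ _ _ (dyadic_inner_sqr_sum_le i d_gt0)) _.
  by apply: Rdiv_le_0_compat; [lra|apply: lt_0_INR; nia].
rewrite (Rpow_mult_distr _ s) (Rpow_mult_distr _ ell) /s pow2_sqrt; last first.
  by have := Rdiv_lt_0_compat 8 (INR V) ltac:(lra) INR_V_gt0; lra.
rewrite !mult_INR INR_2 -/B.
have -> : 2 * INR M / (INR B * INR d) *
  (ell ^ 2 * (2 * INR M / INR d + INR B * INR M / INR d * E)) =
   (INR M / INR d) ^ 2 * ell ^ 2 * (4 / INR B + 2 * E) by field; lra.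
apply: Rmult_le_compat_l; first by apply: Rmult_le_pos; apply: pow2_ge_0.
have le_V2B : INR V <= 2 * INR B by rewrite -INR_2 -mult_INR; apply: le_INR; lia.
have -> : 8 / INR V = 4 / (INR V / 2) by field; lra.
by apply/Rplus_le_compat_r/Rmult_le_compat_l; [lra|apply: Rinv_le_contravar; lra].
Qed.

Let bilinear_part_le :
  Cmod (\csum_(1 <= c < N | (V < c)%N) \csum_(1 <= b < N | (U < b)%N)
    \csum_(1 <= d < N) term b c d) <=
  INR M * (1 + ell) ^ 2 * (INR L * s).
Proof.
have s_ge0 : 0 <= s by apply: sqrt_pos.
have L_ge0 := pos_INR L.
have -> : \csum_(1 <= c < N | (V < c)%N) \csum_(1 <= b < N | (U < b)%N)
      \csum_(1 <= d < N) term b c d =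
    \csum_(1 <= d < N) \csum_(0 <= i < L) dyadic_part d i.
  under eq_bigr do rewrite exchange_big.
  rewrite exchange_big /=; apply: eq_bigr => d _.
  rewrite (big_nat_widen 1 N (2 ^ L)) // big_mkcond -(expn0 2) big_dyadic //=.
  by apply: eq_bigr => i _; rewrite -big_mkcond.
apply: Rle_trans (Cmod_csum _ _ _ _) _.
apply: Rle_trans (_ : \rsum_(1 <= d < N) (INR M * ell * s * INR L * / INR d) <= _).
  apply: rsum_le => d d_range _;
    apply: Rle_trans (csum_le_const (c := INR M / INR d * ell * s) _ _) _.
  - by apply: Rle_trans (@dyadic_part_le d 0%N _); [apply: Cmod_ge_0|lia].
  - by move=> i _ _; apply: dyadic_part_le; lia.
  by rewrite subn0; apply: Req_le; rewrite /Rdiv; ring.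
have coef_ge0 : 0 <= INR M * ell * s * INR L.
  by apply: Rmult_le_pos => //; apply: Rmult_le_pos => //; nra.
apply: Rle_trans (rsum_inv_le xpredT coef_ge0) _.
have -> : INR M * ell * s * INR L * (1 + ell) = INR M * (ell * (1 + ell)) * (INR L * s) by ring.
apply: Rmult_le_compat_r; first by nra.
by apply: Rmult_le_compat_l; [lra|nra].
Qed.

Let vaughan_identity :
  \csum_(1 <= n < N) (RtoC (mangoldt n) * Phi n) =
  (\csum_(1 <= b < N | (b <= U)%N) \csum_(1 <= c < N) \csum_(1 <= d < N) term b c d -
   \csum_(1 <= b < N | (b <= U)%N) \csum_(1 <= c < N | (c <= V)%N) \csum_(1 <= d < N) term b c d +
   \csum_(1 <= c < N | (V < c)%N) \csum_(1 <= b < N | (U < b)%N) \csum_(1 <= d < N) term b c d)%C.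
Proof.
pose inner c b := \csum_(1 <= d < N) term b c d.
have gtnE m : (fun b => ~~ (b <= m)%N) =1 (fun b => m < b)%N by move=> b; rewrite ltnNge.
have split_b c : \csum_(1 <= b < N) inner c b =
    (\csum_(1 <= b < N | (b <= U)%N) inner c b + \csum_(1 <= b < N | (U < b)%N) inner c b)%C.
  by rewrite (bigID (fun b => b <= U)%N) /= (eq_bigl _ _ (gtnE U)).
have split_c (f : nat -> C) : \csum_(1 <= c < N | (V < c)%N) f c =
    (\csum_(1 <= c < N) f c - \csum_(1 <= c < N | (c <= V)%N) f c)%C.
  by rewrite [X in (X - _)%C](bigID (fun c => c <= V)%N) /= (eq_bigl _ _ (gtnE V)); ring.
transitivity (\csum_(1 <= c < N | (V < c)%N) \csum_(1 <= b < N) inner c b).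
  rewrite split_c [X in (_ - X)%C]big_nat_idx => [|c c_range le_cV]; last first.
    by rewrite -mangoldt_Phi_expand // Phi_small ?Cmult_0_r //; lia.
  rewrite /Cminus Copp_0 Cplus_0_r; apply: eq_big_nat => c c_range.
  exact: mangoldt_Phi_expand.
rewrite (eq_bigr _ (fun c _ => split_b c)) big_split /=; congr Cplus.
by rewrite split_c; congr Cminus; rewrite exchange_big.
Qed.

Lemma vaughan_bound :
  Cmod (\csum_(M <= n < 2 * M) (RtoC (mangoldt n) * F n)) <=
  INR M * (1 + ln (INR (2 * M))) ^ 3 * (2 * E + INR L * sqrt (8 / INR V + 2 * E)).
Proof.
rewrite -/N -/ell -/s.
have -> : \csum_(M <= n < N) (RtoC (mangoldt n) * F n) =
  \csum_(1 <= n < N) (RtoC (mangoldt n) * Phi n).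
  rewrite [RHS](@big_cat_nat _ _ _ M) //=; try lia.
  rewrite [X in (X + _)%C]big_nat_idx => [|n n_range _];
    last by rewrite Phi_small ?Cmult_0_r //; lia.
  by rewrite Cplus_0_l; apply: eq_big_nat => n n_range; rewrite /Phi n_range.
rewrite vaughan_identity; set A := bigop.body _ _ _; set B := bigop.body _ _ _;
  set D := bigop.body _ _ _.
have pow_le : (1 + ell) ^ 2 <= (1 + ell) ^ 3 by apply: Rle_pow; [lra|lia].
have A_le := Rle_trans _ _ _ log_part_le (Rmult_le_compat_l _ _ _ ME_ge0 pow_le).
have Ls_ge0 : 0 <= INR M * (INR L * s).
  by apply: Rmult_le_pos; [lra|apply: Rmult_le_pos; [apply: pos_INR|apply: sqrt_pos]].
have := Rmult_le_compat_l _ _ _ Ls_ge0 pow_le.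
have := Cmod_triangle (A - B) D; have := Cmod_triangle A (- B); rewrite Cmod_opp -/(Cminus _ _).
by have := short_part_le; have := bilinear_part_le; rewrite -/A -/B -/D in A_le *; lra.
Qed.

End Vaughan.

Lemma vaughan_factor_le rho : 0 < rho <= / 4 ->
  for_large (fun X => forall l V L, 0 <= l <= 1 + ln (2 * X) -> Rpower X (/ 4) / 2 <= V ->
    0 <= L <= 3 * (1 + ln X) ->
    l ^ 3 * (2 * Rpower X (- rho) + L * sqrt (8 / V + 2 * Rpower X (- rho))) <=
    Rpower X (- (rho / 4))).
Proof.
move=> [rho_gt0 rho_le].
have := for_large_and (@for_large_ln_pow_le 136 4 (rho / 4) ltac:(lra)) (for_large_ge 1).
apply: for_large_imp => X [log_le X_ge1] l V L l_range V_ge L_range.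
have ln_X_ge0 := ln_ge0 X_ge1; have ln_2X_le := @ln_double_le X ltac:(lra).
set l1 := 1 + ln X in log_le L_range.
have {}l_range : 0 <= l <= 2 * l1 by rewrite /l1; lra.
set z := Rpower X (- (rho / 2)); have z_gt0 : 0 < z by apply: Rpower_gt0.
have zz : z * z = Rpower X (- rho) by rewrite -Rpower_plus; congr Rpower; field.
have z_le1 : z <= 1 by rewrite -(Rpower_O X); [apply: Rle_Rpower|]; lra.
have V_inv_le : 8 / V <= 16 * (z * z).
  have -> : 8 / V = 16 * / (2 * V).
    by field; have := Rpower_gt0 X (/ 4); lra.
  apply: Rmult_le_compat_l; first lra.
  apply: Rle_trans (Rinv_le_contravar (Rpower X (/ 4)) _ _ _) _ => //; first lra.
  by rewrite zz -Rpower_Ropp; apply: Rle_Rpower; lra.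
rewrite -zz; set sq := sqrt _; have sq_ge0 : 0 <= sq by apply: sqrt_pos.
have sq_le : sq <= 5 * z.
  by rewrite -[X in _ <= X]sqrt_square; [apply: sqrt_le_1_alt; nra|lra].
have Lsq_le : L * sq <= 3 * l1 * (5 * z) by apply: Rmult_le_compat; lra.
have l1_ge1 : 1 <= l1 by rewrite /l1; lra.
apply: Rle_trans (_ : (2 * l1) ^ 3 * (17 * l1 * z) <= _).
  apply: Rmult_le_compat; [|by have := Rmult_le_pos L sq; nra|exact: pow_incr|nra].
  by apply: pow_le; lra.
have -> : (2 * l1) ^ 3 * (17 * l1 * z) = 136 * l1 ^ 4 * z by ring.
have -> : Rpower X (- (rho / 4)) = Rpower X (rho / 4) * z
  by rewrite /z -Rpower_plus; congr Rpower; field.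
by apply: Rmult_le_compat_r; lra.
Qed.

Lemma exists_vaughan_parameters X : 256 <= X -> exists U V : nat,
  1 <= INR U < X /\ 1 <= INR V < X /\ Rpower X (/ 4) / 2 <= INR V /\
  INR U * INR V <= 2 * Rpower X (3 / 4) /\
  forall D, 0 <= D -> D * INR U < 2 * X -> D <= 2 * Rpower X (3 / 4).
Proof.
move=> X_ge; have X_gt0 : 0 < X by lra.
set x := Rpower X (/ 4); set y := Rpower X (/ 2).
have eq_y : y = x * x by rewrite /x /y -Rpower_plus; congr Rpower; field.
have eq_X : X = y * y by rewrite Rpower_half_mul.
have -> : Rpower X (3 / 4) = y * x by rewrite /x /y -Rpower_plus; congr Rpower; field.
have x_gt0 : 0 < x by apply: Rpower_gt0.
have y_ge16 : 16 <= y by apply: Rnot_lt_le => lt_y; have : 0 < y by [apply: Rpower_gt0]; nra.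
have x_ge4 : 4 <= x by nra.
have [U U_range] := @nfloor_ex y ltac:(lra); have [V V_range] := @nfloor_ex x ltac:(lra).
exists U, V; split; [nra|split; [nra|split; [lra|split]]].
  by apply: Rle_trans (Rmult_le_compat _ y _ x (pos_INR _) (pos_INR _) _ _) _; nra.
by move=> D D_ge0 lt_DU; nra.
Qed.

Lemma vaughan_power_saving rho : 0 < rho <= / 4 ->
  for_large (fun X => forall (M : nat) (F : nat -> C), INR M = X -> (forall n, Cmod (F n) <= 1) ->
    (forall D a b, (0 < D)%N -> INR D <= 2 * Rpower X (3 / 4) ->
       (forall n, (a <= n < b)%N -> (M <= D * n < 2 * M)%N) ->
       Cmod (\csum_(a <= n < b) F (D * n)%N) <= X / INR D * Rpower X (- rho)) ->
    (forall D r a b, (0 < r < D)%N -> INR D <= 2 * Rpower X (3 / 4) ->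
       (forall n, (a <= n < b)%N -> (M <= D * n < 2 * M)%N) ->
       Cmod (\csum_(a <= n < b) (F (D * n)%N * Cconj (F (r * n)%N))) <=
         X / INR D * Rpower X (- rho)) ->
    Cmod (\csum_(M <= n < 2 * M) (RtoC (mangoldt n) * F n)) <= X * Rpower X (- (rho / 4))).
Proof.
move=> rho_range; have := for_large_and (vaughan_factor_le rho_range) (for_large_ge 256).
apply: for_large_imp => X [factor_le X_ge] M F eq_X F_le1 linear_le bilinear_le.
have M_gt0 : (0 < M)%N by apply/ltP/INR_lt; rewrite INR_0; lra.
have [U [V [U_range [V_range [V_ge [UV_le D_le]]]]]] := exists_vaughan_parameters X_ge.
have [L [le_exp L_le]] := exp2_cover M_gt0.
have lt_of_INR (m n : nat) : INR m < INR n -> (m < n)%N by move=> lt_mn; apply/ltP/INR_lt.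
apply: Rle_trans (@vaughan_bound M U V L F (Rpower X (- rho)) _ _ _ _ le_exp _ F_le1 _ _) _.
- by apply: lt_of_INR; rewrite INR_0; lra.
- by apply: lt_of_INR; lra.
- by apply: lt_of_INR; rewrite INR_0; lra.
- by apply: lt_of_INR; lra.
- exact: Rpower_ge0.
- move=> D a b D_range ab_range; rewrite eq_X; apply: linear_le => //; first lia.
  by apply: Rle_trans UV_le; rewrite -mult_INR; apply: le_INR; lia.
- move=> d c1 c2 a b d_gt0 c_range lt_2M ab_range; rewrite eq_X; apply: bilinear_le => //;
  first nia.
  apply: D_le; first exact: pos_INR.
  by rewrite -eq_X -INR_2 -!mult_INR; apply: lt_INR; apply/ltP.
rewrite eq_X in L_le *; rewrite Rmult_assoc; apply: Rmult_le_compat_l; first lra.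
have ln_2X_ge0 := @ln_ge0 (2 * X) ltac:(lra).
by rewrite mult_INR INR_2 eq_X; apply: factor_le => //; [lra|split; [apply: pos_INR|]].
Qed.

(** * Detecting small fractional parts *)

Lemma floorZ_bounds x : IZR (floorZ x) <= x < IZR (floorZ x) + 1.
Proof. by have := archimed x; rewrite /floorZ minus_IZR; lra. Qed.

Lemma floorZ_eq x (m : Z) : IZR m <= x < IZR m + 1 -> floorZ x = m.
Proof.
move=> m_bounds; have x_bounds := floorZ_bounds x.
have lt_m : (m < floorZ x + 1)%Z by apply: lt_IZR; rewrite plus_IZR; lra.
have lt_floor : (floorZ x < m + 1)%Z by apply: lt_IZR; rewrite plus_IZR; lra.
lia.
Qed.

Lemma dist_int_le x (z : Z) : dist_int x <= Rabs (x - IZR z).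
Proof.
have x_bounds := floorZ_bounds x; rewrite /dist_int.
case: (Z_le_gt_dec z (floorZ x)) => [/IZR_le le_z|gt_z].
  by apply: Rle_trans (Rmin_l _ _) _; rewrite Rabs_pos_eq; lra.
have ge_z : IZR (floorZ x) + 1 <= IZR z by rewrite -plus_IZR; apply: IZR_le; lia.
by apply: Rle_trans (Rmin_r _ _) _; rewrite Rabs_minus_sym Rabs_pos_eq; lra.
Qed.

Lemma dist_int_attained x :
  exists z : Z, dist_int x = Rabs (x - IZR z) /\ Rabs (x - IZR z) <= / 2.
Proof.
have x_bounds := floorZ_bounds x; rewrite /dist_int /Rmin; case: Rle_dec => nearest.
  by exists (floorZ x); rewrite Rabs_pos_eq; lra.
by exists (floorZ x + 1)%Z; rewrite plus_IZR Rabs_minus_sym Rabs_pos_eq; lra.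
Qed.

Lemma dist_int_ge0 x : 0 <= dist_int x.
Proof. by have [z [-> _]] := dist_int_attained x; apply: Rabs_pos. Qed.

Lemma dist_int_divide_floorZ_le (k : Z) x xi : k <> 0%Z -> 0 <= x -> (k | floorZ x)%Z ->
  dist_int (xi * IZR (floorZ x)) <= x * dist_int (IZR k * xi).
Proof.
move=> k_neq0 x_ge0 [c eq_floor]; have x_bounds := floorZ_bounds x.
have [z [-> _]] := dist_int_attained (IZR k * xi).
have floor_ge0 : 0 <= IZR (floorZ x).
  by apply: IZR_le; suff : (-1 < floorZ x)%Z by [lia]; apply: lt_IZR; lra.
apply: Rle_trans (dist_int_le _ (c * z)) _.
apply: Rle_trans (Rmult_le_compat_r _ _ _ (Rabs_pos _) (proj1 x_bounds)).
rewrite -[X in _ <= X * _](Rabs_pos_eq _ floor_ge0) eq_floor !mult_IZR.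
have -> : xi * (IZR c * IZR k) - IZR c * IZR z = IZR c * (IZR k * xi - IZR z) by ring.
rewrite !Rabs_mult -!abs_IZR; apply: Rmult_le_compat_r; first exact: Rabs_pos.
by rewrite -mult_IZR; apply: IZR_le; nia.
Qed.

Lemma divide_floorZ x (q : nat) : (0 < q)%N ->
  dist_int (x / INR q - / (2 * INR q)) < / (2 * INR q) -> (Z.of_nat q | floorZ x)%Z.
Proof.
move=> q_gt0; have INR_q_gt0 : 0 < INR q by apply: lt_0_INR; lia.
have [z [-> _]] := dist_int_attained (x / INR q - / (2 * INR q)).
move=> /Rabs_def2 [lt_z gt_z]; exists z; apply: floorZ_eq; rewrite mult_IZR -INR_IZR_INZ.
have eq_half : / (2 * INR q) * INR q = / 2 by field; lra.
have eq_x : x / INR q * INR q = x by field; lra.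
have := Rmult_lt_compat_r _ _ _ INR_q_gt0 lt_z; have := Rmult_lt_compat_r _ _ _ INR_q_gt0 gt_z.
by lra.
Qed.

Lemma dist_int_mul_floorZ_le x xi w : w <= / 2 -> dist_int (x - w) < w -> dist_int (xi * x) < w ->
  dist_int (xi * IZR (floorZ x)) <= (1 + 2 * Rabs xi) * w.
Proof.
move=> w_le; have [z [-> _]] := dist_int_attained (x - w).
have [z' [-> _]] := dist_int_attained (xi * x) => /Rabs_def2 [lt_z gt_z] close.
have -> : floorZ x = z by apply: floorZ_eq; lra.
apply: Rle_trans (dist_int_le _ z') _.
have -> : xi * IZR z - IZR z' = xi * (IZR z - x) + (xi * x - IZR z') by ring.
apply: Rle_trans (Rabs_triang _ _) _; rewrite Rabs_mult.
have diff_le : Rabs (IZR z - x) <= 2 * w by apply: Rabs_le; lra.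
by have := Rmult_le_compat_l _ _ _ (Rabs_pos xi) diff_le; lra.
Qed.

Lemma dist_int_le_Cmod_1_expi x : dist_int x <= Cmod (1 - expi x).
Proof.
have [z [-> near_z]] := dist_int_attained x.
have -> : expi x = expi (x - IZR z).
  by have {1}-> : x = (x - IZR z) + IZR z by [ring]; rewrite expiD expi_IZR Cmult_1_r.
exact: Cmod_1_expi_ge.
Qed.

Definition dirichlet_kernel (K : nat) (x : R) : C := \csum_(0 <= k < K) expi (INR k * x)%R.

Lemma dirichlet_kernel_le K x w : 0 < w <= dist_int x ->
  Cmod (dirichlet_kernel K x) ^ 2 <= 4 / w ^ 2.
Proof.
move=> [w_gt0 le_w]; have dist_le := dist_int_le_Cmod_1_expi x.
have geometric : (dirichlet_kernel K x * (1 - expi x) = 1 - expi (INR K * x)%R)%C.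
  rewrite /dirichlet_kernel; elim: K => [|K IH].
    by rewrite big_geq // INR_0 Rmult_0_l expi0; ring.
  by rewrite big_nat_recr //= Cmult_plus_distr_r IH S_INR Rmult_plus_distr_r Rmult_1_l expiD; ring.
have prod_le : Cmod (dirichlet_kernel K x) * Cmod (1 - expi x) <= 2.
  rewrite -Cmod_mult geometric; apply: Rle_trans (Cmod_triangle _ _) _.
  by rewrite Cmod_opp Cmod_expi Cmod_1; lra.
set D := Cmod _ in prod_le *; have D_ge0 : 0 <= D by apply: Cmod_ge_0.
have w2_gt0 : 0 < w ^ 2 by apply: pow_lt.
apply/(Rle_div_r (D ^ 2) 4) => //; rewrite -Rpow_mult_distr (_ : 4 = 2 ^ 2); last ring.
by apply: pow_incr; split; [apply: Rmult_le_pos; lra|nra].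
Qed.

Definition exp_sum (a b : nat) (g x : nat -> R) : C := \csum_(a <= n < b) (RtoC (g n) * expi (x n)).

Lemma eq_exp_sum a b g x y : (forall n, x n = y n) -> exp_sum a b g x = exp_sum a b g y.
Proof. by move=> eq_xy; apply: eq_bigr => n _; rewrite eq_xy. Qed.

Lemma Cmod_exp_sum_addr a b g x c :
  Cmod (exp_sum a b g (fun n => x n + c)) = Cmod (exp_sum a b g x).
Proof.
rewrite /exp_sum -[RHS]Rmult_1_r -(Cmod_expi c) -Cmod_mult big_distrl /=.
by congr Cmod; apply: eq_bigr => n _; rewrite expiD Cmult_assoc.
Qed.

Lemma Cmod_exp_sum_prime_weight_le a b x :
  Cmod (exp_sum a b prime_weight x) <=
  Cmod (exp_sum a b mangoldt x) + \rsum_(a <= n < b | ~~ prime n) mangoldt n.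
Proof.
have -> : exp_sum a b prime_weight x =
    (exp_sum a b mangoldt x - \csum_(a <= n < b | ~~ prime n) (RtoC (mangoldt n) * expi (x n)))%C.
  rewrite big_mkcond csum_sub; apply: eq_bigr => n _.
  by rewrite /prime_weight; case: prime => /=; ring.
apply: Rle_trans (Cmod_triangle _ _) _; rewrite Cmod_opp; apply: Rplus_le_compat_l.
apply: Rle_trans (Cmod_csum _ _ _ _) _; apply: rsum_le => n _ _.
by rewrite Cmod_mult Cmod_expi Cmod_R Rabs_pos_eq; [lra|apply: mangoldt_ge0].
Qed.

Section Detection.
Variables (a b : nat) (g : nat -> R).
Hypothesis g_ge0 : forall n, 0 <= g n.
Let W := \rsum_(a <= n < b) g n.

Lemma mean_square_le J (phi : nat -> nat -> R) Er : 0 <= Er ->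
  (forall i j, (i < J)%N -> (j < J)%N -> i != j ->
    Cmod (exp_sum a b g (fun n => phi i n - phi j n)) <= Er) ->
  Rabs (\rsum_(a <= n < b) (g n * Cmod (\csum_(0 <= j < J) expi (phi j n)) ^ 2) - INR J * W)
    <= INR J ^ 2 * Er.
Proof.
move=> Er_ge0 sum_le; rewrite -Cmod_R RtoC_minus.
pose S i j := exp_sum a b g (fun n => phi i n - phi j n).
have expand : RtoC (\rsum_(a <= n < b) (g n * Cmod (\csum_(0 <= j < J) expi (phi j n)) ^ 2)) =
    \csum_(0 <= i < J) \csum_(0 <= j < J) S i j.
  rewrite RtoC_rsum /S /exp_sum.
  under [RHS]eq_bigr do rewrite exchange_big.
  rewrite [RHS]exchange_big /=; apply: eq_bigr => n _.
  rewrite RtoC_mult Cmod2_conj Cconj_csum big_distrl big_distrr; apply: eq_bigr => i _.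
  by rewrite big_distrr big_distrr; apply: eq_bigr => j _; rewrite expi_sub.
have diagonal : RtoC (INR J * W) =
    \csum_(0 <= i < J) \csum_(0 <= j < J) RtoC (if j == i then W else 0).
  rewrite -{1}(subn0 J) -rsum_const RtoC_rsum; apply: eq_big_nat => i i_range.
  by rewrite -RtoC_rsum -big_mkcond (big_nat1_eq Rplus (fun=> W)) ifT.
rewrite expand diagonal csum_sub.
have -> : INR J ^ 2 * Er = INR (J - 0) * (INR (J - 0) * Er) by rewrite subn0; ring.
have J_ge0 := pos_INR (J - 0).
apply: csum_le_const => [|i i_range _]; first exact: Rmult_le_pos.
rewrite csum_sub; apply: csum_le_const => // j j_range _.
case: (eqVneq j i) => [->|neq_ji]; last first.
  by rewrite (_ : S i j - 0 = S i j)%C; [apply: sum_le; rewrite 1?eq_sym; lia|ring].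
suff -> : S i i = RtoC W by rewrite /Cminus Cplus_opp_r Cmod_0.
rewrite /S /W RtoC_rsum; apply: eq_bigr => n _.
by rewrite Rminus_diag expi0 Cmult_1_r.
Qed.

Lemma INR_subZ i j : INR i - INR j = IZR (Z.of_nat i - Z.of_nat j).
Proof. by rewrite minus_IZR -!INR_IZR_INZ. Qed.

Section Kernel.
Variables (K : nat) (Er : R).
Hypothesis Er_ge0 : 0 <= Er.

Lemma dirichlet_kernel_mean (x : nat -> R) :
  (forall h : Z, (0 < Z.abs h < Z.of_nat K)%Z ->
    Cmod (exp_sum a b g (fun n => IZR h * x n)) <= Er) ->
  Rabs (\rsum_(a <= n < b) (g n * Cmod (dirichlet_kernel K (x n)) ^ 2) - INR K * W) <=
    INR K ^ 2 * Er.
Proof.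
move=> sum_le; apply: (@mean_square_le K (fun k n => INR k * x n)) => // i j lt_iK lt_jK neq_ij.
have := sum_le (Z.of_nat i - Z.of_nat j)%Z ltac:(lia); apply: Rle_trans; apply: Req_le; congr Cmod.
by apply: eq_exp_sum => n; rewrite -INR_subZ; ring.
Qed.

Lemma dirichlet_kernel_mul_mean (x y : nat -> R) : (0 < K)%N ->
  (forall h k : Z, (Z.abs h < Z.of_nat K)%Z -> (Z.abs k < Z.of_nat K)%Z -> (h, k) <> (0, 0)%Z ->
    Cmod (exp_sum a b g (fun n => IZR h * x n + IZR k * y n)) <= Er) ->
  Rabs (\rsum_(a <= n < b)
      (g n * (Cmod (dirichlet_kernel K (x n)) ^ 2 * Cmod (dirichlet_kernel K (y n)) ^ 2))
    - INR K ^ 2 * W) <= INR K ^ 4 * Er.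
Proof.
move=> K_gt0 sum_le.
have := @mean_square_le (K * K) (fun j n => INR (j %% K) * x n + INR (j %/ K) * y n) Er Er_ge0.
have product n : \csum_(0 <= j < K * K) expi (INR (j %% K) * x n + INR (j %/ K) * y n)%R =
    (dirichlet_kernel K (x n) * dirichlet_kernel K (y n))%C.
  rewrite (big_modn_divn Cplus (fun k l => expi (INR k * x n + INR l * y n)%R)) // big_distrr /=.
  apply: eq_bigr => l _; rewrite /dirichlet_kernel big_distrl /=.
  by apply: eq_bigr => k _; apply: expiD.
under eq_bigr do rewrite product Cmod_mult Rpow_mult_distr.
rewrite mult_INR (_ : INR K * INR K = INR K ^ 2); last by ring.
rewrite (_ : (INR K ^ 2) ^ 2 = INR K ^ 4); last by ring.
apply=> i j lt_i lt_j neq_ij.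
have [lt_ir lt_jr] : (i %% K < K)%N /\ (j %% K < K)%N by rewrite !ltn_mod.
have [lt_iq lt_jq] : (i %/ K < K)%N /\ (j %/ K < K)%N by rewrite !ltn_divLR.
rewrite (@eq_exp_sum _ _ _ _ (fun n => IZR (Z.of_nat (i %% K) - Z.of_nat (j %% K)) * x n +
  IZR (Z.of_nat (i %/ K) - Z.of_nat (j %/ K)) * y n)) => [|n]; last by rewrite -!INR_subZ; ring.
have abs_sub_lt u v : (u < K)%N -> (v < K)%N -> (Z.abs (Z.of_nat u - Z.of_nat v) < Z.of_nat K)%Z
  by lia.
apply: sum_le; [exact: abs_sub_lt|exact: abs_sub_lt|].
case=> /Z.sub_move_0_r/Nat2Z.inj eq_r /Z.sub_move_0_r/Nat2Z.inj eq_q; move/eqP: neq_ij; apply.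
by rewrite (divn_eq i K) (divn_eq j K) eq_r eq_q.
Qed.

Lemma dirichlet_kernel_mean_le2 (x y : nat -> R) :
  (forall h k : Z, (Z.abs h < Z.of_nat K)%Z -> (Z.abs k < Z.of_nat K)%Z -> (h, k) <> (0, 0)%Z ->
    Cmod (exp_sum a b g (fun n => IZR h * x n + IZR k * y n)) <= Er) ->
  \rsum_(a <= n < b) (g n * Cmod (dirichlet_kernel K (x n)) ^ 2) <= INR K * W + INR K ^ 2 * Er /\
  \rsum_(a <= n < b) (g n * Cmod (dirichlet_kernel K (y n)) ^ 2) <= INR K * W + INR K ^ 2 * Er.
Proof.
move=> sum_le.
have mean_le z : (forall h : Z, (0 < Z.abs h < Z.of_nat K)%Z ->
    Cmod (exp_sum a b g (fun n => IZR h * z n)) <= Er) ->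
    \rsum_(a <= n < b) (g n * Cmod (dirichlet_kernel K (z n)) ^ 2) <= INR K * W + INR K ^ 2 * Er.
  by move=> /dirichlet_kernel_mean /Rabs_le_between; lra.
split; apply: mean_le => h h_range.
  rewrite (@eq_exp_sum _ _ _ _ (fun n => IZR h * x n + IZR 0 * y n)) => [|n]; last ring.
  by apply: sum_le => [||[]]; lia.
rewrite (@eq_exp_sum _ _ _ _ (fun n => IZR 0 * x n + IZR h * y n)) => [|n]; last ring.
by apply: sum_le => [||[]]; lia.
Qed.

Variable w : R.
Hypotheses (w_gt0 : 0 < w) (W_gt0 : 0 < W).

Let w_sqr_inv_gt0 : 0 < / w ^ 2. Proof. exact/Rinv_0_lt_compat/pow_lt. Qed.

Lemma exists_dist_int_lt (x : nat -> R) : 8 / w ^ 2 <= INR K -> 2 * INR K * Er < W ->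
  (forall h : Z, (0 < Z.abs h < Z.of_nat K)%Z ->
    Cmod (exp_sum a b g (fun n => IZR h * x n)) <= Er) ->
  exists n, (a <= n < b)%N /\ 0 < g n /\ dist_int (x n) < w.
Proof.
move=> K_ge Er_lt sum_le; have [mean_ge _] :=
  proj1 (Rabs_le_between _ _) (dirichlet_kernel_mean sum_le).
apply: NNPP => none.
have : \rsum_(a <= n < b) (g n * Cmod (dirichlet_kernel K (x n)) ^ 2) <=
  \rsum_(a <= n < b) (4 / w ^ 2 * g n).
  apply: rsum_le => n n_range _; case: (g_ge0 n) => [gn_gt0|<-]; last by lra.
  rewrite Rmult_comm; apply: Rmult_le_compat_r; first exact: Rlt_le.
  by apply: dirichlet_kernel_le; split=> //; apply: Rnot_lt_le => lt_w; apply: none; exists n.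
rewrite -big_distrr /= -/W; set total := bigop.body _ _ _ in mean_ge *.
have : 8 / w ^ 2 * W <= INR K * W by apply: Rmult_le_compat_r; lra.
by rewrite -[w * (w * 1)]/(w ^ 2) /Rdiv; nra.
Qed.

Lemma dirichlet_kernel_mul_le s t : ~ (dist_int s < w /\ dist_int t < w) ->
  Cmod (dirichlet_kernel K s) ^ 2 * Cmod (dirichlet_kernel K t) ^ 2 <=
  4 / w ^ 2 * (Cmod (dirichlet_kernel K s) ^ 2 + Cmod (dirichlet_kernel K t) ^ 2).
Proof.
move=> far; have s_ge0 := pow2_ge_0 (Cmod (dirichlet_kernel K s)).
have t_ge0 := pow2_ge_0 (Cmod (dirichlet_kernel K t)).
have bound_gt0 : 0 < 4 / w ^ 2 by rewrite /Rdiv; lra.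
have [far_s|far_t] : w <= dist_int s \/ w <= dist_int t by lra.
  by have := dirichlet_kernel_le K (conj w_gt0 far_s); nra.
by have := dirichlet_kernel_le K (conj w_gt0 far_t); nra.
Qed.

Lemma exists_dist_int_lt2 (x y : nat -> R) : 16 / w ^ 2 <= INR K -> 4 * INR K ^ 2 * Er <= W ->
  (forall h k : Z, (Z.abs h < Z.of_nat K)%Z -> (Z.abs k < Z.of_nat K)%Z -> (h, k) <> (0, 0)%Z ->
    Cmod (exp_sum a b g (fun n => IZR h * x n + IZR k * y n)) <= Er) ->
  exists n, (a <= n < b)%N /\ 0 < g n /\ dist_int (x n) < w /\ dist_int (y n) < w.
Proof.
move=> K_ge Er_le sum_le.
have K_gt0 : 0 < INR K by rewrite /Rdiv in K_ge; lra.
have K_nat_gt0 : (0 < K)%N by apply/ltP/INR_lt; rewrite INR_0.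
have [prod_ge _] := proj1 (Rabs_le_between _ _) (dirichlet_kernel_mul_mean K_nat_gt0 sum_le).
have [x_le y_le] := dirichlet_kernel_mean_le2 sum_le.
apply: NNPP => none.
have : \rsum_(a <= n < b)
      (g n * (Cmod (dirichlet_kernel K (x n)) ^ 2 * Cmod (dirichlet_kernel K (y n)) ^ 2)) <=
    \rsum_(a <= n < b) (4 / w ^ 2 *
      (g n * Cmod (dirichlet_kernel K (x n)) ^ 2 + g n * Cmod (dirichlet_kernel K (y n)) ^ 2)).
  apply: rsum_le => n n_range _; case: (g_ge0 n) => [gn_gt0|<-]; last by lra.
  have far : ~ (dist_int (x n) < w /\ dist_int (y n) < w) by move=> near; apply: none; exists n.
  by have := Rmult_le_compat_l _ _ _ (Rlt_le _ _ gn_gt0) (dirichlet_kernel_mul_le far); lra.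
rewrite -big_distrr big_split /= -[w * (w * 1)]/(w ^ 2).
set A := bigop.body _ _ _ in prod_ge *; set B := bigop.body _ _ _ in x_le *.
set D := bigop.body _ _ _ in y_le *.
have K_ge1 : 1 <= INR K by apply: (le_INR 1); lia.
have mean_err : INR K ^ 2 * Er <= W / 4 by lra.
have prod_err : INR K ^ 4 * Er <= INR K ^ 2 * (W / 4).
  have -> : INR K ^ 4 * Er = INR K ^ 2 * (INR K ^ 2 * Er) by ring.
  by apply: Rmult_le_compat_l => //; apply: pow2_ge_0.
have BD_le : B + D <= 5 / 2 * (INR K * W) by nra.
have KW_gt0 : 0 < INR K * W by apply: Rmult_lt_0_compat.
have : 4 / w ^ 2 * (B + D) <= INR K / 4 * (5 / 2 * (INR K * W)).
  apply: Rle_trans (_ : 4 / w ^ 2 * (5 / 2 * (INR K * W)) <= _).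
    by apply: Rmult_le_compat_l => //; rewrite /Rdiv; lra.
  by apply: Rmult_le_compat_r; [lra|rewrite /Rdiv in K_ge *; lra].
have -> : INR K / 4 * (5 / 2 * (INR K * W)) = 5 / 8 * (INR K ^ 2 * W) by field.
have : 0 < INR K ^ 2 * W by apply: Rmult_lt_0_compat => //; apply: pow_lt.
lra.
Qed.

End Kernel.

End Detection.

(** * Exponential sums over power sums *)

Fixpoint falling (x : R) (i : nat) : R :=
  if i is i'.+1 then falling x i' * (x - INR i') else 1.

Lemma falling_INR_eq0 n i : (n < i)%N -> falling (INR n) i = 0.
Proof.
elim: i => // i IH; rewrite ltnS leq_eqVlt => /orP[/eqP->|/IH IHn] /=; last by rewrite IHn; ring.
by ring.
Qed.

Lemma falling_neq0 x i : (forall z : Z, x <> IZR z) -> falling x i <> 0.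
Proof.
move=> x_nonint; elim: i => [|i IH] /=; first lra.
apply: Rmult_integral_contrapositive_currified => //.
by have := x_nonint (Z.of_nat i); rewrite -INR_IZR_INZ; lra.
Qed.

Lemma derivable_pt_lim_rsum d (F F' : nat -> R -> R) x :
  (forall j, (j < d)%N -> derivable_pt_lim (F j) x (F' j x)) ->
  derivable_pt_lim (fun y => \rsum_(0 <= j < d) F j y) x (\rsum_(0 <= j < d) F' j x).
Proof.
elim: d => [|d IH] F_deriv.
  rewrite big_geq // => eps eps_gt0; exists (mkposreal 1 ltac:(lra)) => h _ _.
  by rewrite !big_geq // (_ : (0 - 0) / h - 0 = 0) ?Rabs_R0 // /Rdiv; ring.
have sum_deriv := derivable_pt_lim_plus _ _ _ _ _
  (IH (fun j lt_jd => F_deriv j (ltnW lt_jd))) (F_deriv d (leqnn _)).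
rewrite big_nat_recr //= => eps eps_gt0; have [delta close] := sum_deriv eps eps_gt0.
by exists delta => y y_neq0 y_lt; rewrite !big_nat_recr //=; apply: close.
Qed.

Lemma Rpower_sub_le r D p q : 0 < r <= D -> p <= q ->
  Rpower D p - Rpower r p <= Rpower D (p - q) * (Rpower D q - Rpower r q).
Proof.
move=> r_range le_pq; have split_exp x : Rpower x p = Rpower x (p - q) * Rpower x q.
  by rewrite -Rpower_plus; congr Rpower; ring.
have neg_le : Rpower D (p - q) <= Rpower r (p - q) by apply: Rle_Rpower_l_npos; lra.
have := Rmult_le_compat_r _ _ _ (Rpower_ge0 r q) neg_le; rewrite !split_exp; lra.
Qed.

Lemma Rpower_pred x q : 0 < x -> Rpower x q = x * Rpower x (q - 1).
Proof. by move=> x_gt0; rewrite -{2}(Rpower_1 x) // -Rpower_plus; congr Rpower; ring. Qed.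

Lemma Rpower_sub_ge r D q : 0 < r -> r + 1 <= D -> 1 <= q ->
  Rpower D (q - 1) <= Rpower D q - Rpower r q.
Proof.
move=> r_gt0 le_rD q_ge1; rewrite (Rpower_pred q r_gt0) (@Rpower_pred D q); last lra.
have := @Rle_Rpower_l r D (q - 1) ltac:(lra) ltac:(lra).
by have := Rpower_gt0 r (q - 1); nra.
Qed.

Lemma div_quarter_ge M D : 1 <= M -> 1 <= D <= 2 * Rpower M (3 / 4) -> Rpower M (/ 4) / 2 <= M / D.
Proof.
move=> M_ge1 [D_ge1 D_le]; apply/(Rle_div_r (Rpower M (/ 4) / 2) M); first lra.
have eq_M : Rpower M (/ 4) * Rpower M (3 / 4) = M.
  by rewrite -Rpower_plus (_ : / 4 + 3 / 4 = 1) ?Rpower_1; lra.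
by have := Rmult_le_compat_l _ _ _ (Rpower_ge0 M (/ 4)) D_le; lra.
Qed.

Section Scale.
Variables (a th c2 M D e : R) (k : nat).
Hypotheses (a_gt0 : 0 < a) (th_ge1 : 1 <= th) (c2_gt0 : 0 < c2) (M_ge1 : 1 <= M).
Hypothesis D_range : 1 <= D <= 2 * Rpower M (3 / 4).
Hypothesis e_ge : a * (Rpower M (- / 16) * Rpower D (th - 1)) <= e.
Hypothesis e_le : e <= a * (Rpower M (/ 16) * Rpower D th).

Let A := M / D.
Let A_gt0 : 0 < A. Proof. by apply: Rdiv_lt_0_compat; lra. Qed.
Let A_ge : Rpower M (/ 4) / 2 <= A. Proof. exact: div_quarter_ge. Qed.
Let DA : D * A = M. Proof. by rewrite /A; field; lra. Qed.

Lemma scale_sqrt_le : 1 <= c2 * a * Rpower M (/ 16) -> Rpower A (/ 2) <= 2 * c2 * (e * Rpower A th).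
Proof.
move=> large; have sqr_A := Rpower_half_mul A_gt0; set r := Rpower A (/ 2) in sqr_A *.
have r_gt0 : 0 < r by apply: Rpower_gt0.
have r_ge : Rpower M (/ 8) / 2 <= r.
  apply: Rnot_lt_le => lt_r; have := Rpower_gt0 M (/ 8).
  have : Rpower M (/ 8) * Rpower M (/ 8) = Rpower M (/ 4)
    by rewrite -Rpower_plus; congr Rpower; field.
  by nra.
have size_ge : a * Rpower M (- / 16) * A <= e * Rpower A th.
  rewrite (Rpower_pred th A_gt0) (Rmult_comm A) -Rmult_assoc; apply: Rmult_le_compat_r; first lra.
  apply: Rle_trans (Rmult_le_compat_r _ _ _ (Rpower_ge0 A (th - 1)) e_ge).
  rewrite Rmult_assoc Rmult_assoc Rpower_mult_distr ?DA //; last lra.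
  apply: Rmult_le_compat_l; first lra.
  rewrite -[X in X <= _]Rmult_1_r; apply: Rmult_le_compat_l => //.
  by apply: Rpower_ge1; lra.
have c2_ge0 : 0 <= 2 * c2 by lra.
apply: Rle_trans (Rmult_le_compat_l _ _ _ c2_ge0 size_ge); rewrite -sqr_A.
have -> : 2 * c2 * (a * Rpower M (- / 16) * (r * r)) = c2 * a * (Rpower M (- / 16) * (2 * r)) * r
  by ring.
rewrite -[X in X <= _]Rmult_1_l; apply: Rmult_le_compat_r; first lra.
apply: Rle_trans large _; apply: Rmult_le_compat_l; first by nra.
have -> : Rpower M (/ 16) = Rpower M (- / 16) * Rpower M (/ 8).
  by rewrite -Rpower_plus; congr Rpower; field.
by apply: Rmult_le_compat_l => //; lra.
Qed.

Lemma scale_pow_ge :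
  2 ^ k.+1 * (2 * c2 * a) * Rpower M (1 + (th + / 16)) <= Rpower M (INR k.+1 / 4) ->
  M * (2 * c2 * (e * Rpower A th)) <= A ^ k.+1.
Proof.
move=> large; have size_le : e * Rpower A th <= a * Rpower M (th + / 16).
  apply: Rle_trans (Rmult_le_compat_r _ _ _ (Rpower_ge0 A th) e_le) _.
  rewrite Rmult_assoc Rmult_assoc Rpower_mult_distr ?DA -?Rpower_plus //; last lra.
  by rewrite (Rplus_comm (/ 16)); apply: Rle_refl.
have pow2_gt0 : 0 < 2 ^ k.+1 by apply: pow_lt; lra.
have quarter_gt0 := Rpower_gt0 M (/ 4).
apply: Rle_trans (pow_incr (Rpower M (/ 4) / 2) A k.+1 _); last lra.
have -> : (Rpower M (/ 4) / 2) ^ k.+1 = Rpower M (INR k.+1 / 4) / 2 ^ k.+1.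
  by rewrite Rpow_mult_distr pow_inv -Rpower_pow // Rpower_mult (Rmult_comm (/ 4)).
apply/(Rle_div_r _ (Rpower M (INR k.+1 / 4))) => //; apply: Rle_trans large.
rewrite Rpower_plus Rpower_1; last lra.
have -> : 2 ^ k.+1 * (2 * c2 * a) * (M * Rpower M (th + / 16)) =
  M * (2 * c2) * 2 ^ k.+1 * (a * Rpower M (th + / 16)) by ring.
have -> : M * (2 * c2 * (e * Rpower A th)) * 2 ^ k.+1 =
  M * (2 * c2) * 2 ^ k.+1 * (e * Rpower A th) by ring.
by apply: Rmult_le_compat_l => //; apply: Rmult_le_pos; [nra|lra].
Qed.

End Scale.

Section PowerSums.
Variables (d t : nat) (alpha theta : nat -> R).
Hypotheses (lt_td : (t < d)%N) (alpha_gt0 : forall j, (j < d)%N -> 0 < alpha j).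
Hypothesis theta_ge1 : forall j, (j < d)%N -> 1 <= theta j.
(* [theta t] is the largest non-integral exponent. *)
Hypothesis theta_lt : forall j, (j < t)%N -> theta j < theta t.
Hypothesis theta_t_nonint : forall z : Z, theta t <> IZR z.
Hypothesis theta_int : forall j, (t < j < d)%N -> exists z : Z, theta j = IZR z.

Definition power_sum (c : nat -> R) (x : R) : R :=
  \rsum_(0 <= j < d) (c j * Rpower x (theta j)).

Definition power_sum_deriv (c : nat -> R) (i : nat) (x : R) : R :=
  \rsum_(0 <= j < d) (c j * falling (theta j) i * Rpower x (theta j - INR i)).

Lemma power_sum_deriv0 c x : power_sum_deriv c 0 x = power_sum c x.
Proof. by apply: eq_bigr => j _; rewrite INR_0 Rminus_0_r Rmult_1_r. Qed.

Lemma power_sum_deriv_tower c a b : 0 < a -> deriv_tower (power_sum_deriv c) a b.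
Proof.
move=> a_gt0 i x x_range; apply: (@derivable_pt_lim_rsum d
  (fun j y => c j * falling (theta j) i * Rpower y (theta j - INR i))
  (fun j y => c j * falling (theta j) i.+1 * Rpower y (theta j - INR i.+1))) => j _.
have -> : c j * falling (theta j) i.+1 * Rpower x (theta j - INR i.+1) =
    (c j * falling (theta j) i) * ((theta j - INR i) * Rpower x (theta j - INR i - 1)).
  by rewrite S_INR /= (_ : theta j - (INR i + 1) = theta j - INR i - 1); ring.
by apply/derivable_pt_lim_scal/derivable_pt_lim_power; lra.
Qed.

Lemma theta_bounded : exists B, 1 <= B /\ forall j, (j < d)%N -> theta j <= B.
Proof.
have [B B_large] := for_large_and (for_large_ge 1)
  (@for_large_forall_ord d (fun j M => theta j <= M) (fun j _ => for_large_ge _)).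
by exists (B + 1); apply: B_large; lra.
Qed.

(* At argument scale [D * x], the coefficients below [t] are no larger relative to
   the [t]-th one than those of [fun x => power_sum alpha (D * x)]. *)
Definition dominated (D : R) (c : nat -> R) : Prop := forall j, (j < t)%N ->
  Rabs (c j) <= alpha j / alpha t * Rpower D (theta j - theta t) * Rabs (c t).

Lemma deriv_lower_term_le i c D x M j : (j < t)%N -> dominated D c -> 0 < D -> 0 < x ->
  0 < M <= D * x ->
  Rabs (c j * falling (theta j) i * Rpower x (theta j - INR i)) <=
  alpha j / alpha t * Rabs (falling (theta j) i) * Rpower M (theta j - theta t) *
    (Rabs (c t) * Rpower x (theta t - INR i)).
Proof.
move=> lt_jt dom D_gt0 x_gt0 M_range.
rewrite !Rabs_mult (Rabs_pos_eq (Rpower _ _)) //.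
have -> : Rpower x (theta j - INR i) = Rpower x (theta j - theta t) * Rpower x (theta t - INR i).
  by rewrite -Rpower_plus; congr Rpower; ring.
have scale_le : Rpower D (theta j - theta t) * Rpower x (theta j - theta t) <=
  Rpower M (theta j - theta t).
  rewrite Rpower_mult_distr //; apply: Rle_Rpower_l_npos => //.
  by have := theta_lt lt_jt; lra.
have ratio_ge0 : 0 <= alpha j / alpha t.
  by apply/Rlt_le/Rdiv_lt_0_compat; apply: alpha_gt0 => //; lia.
have main_ge0 : 0 <= Rabs (c t) * Rpower x (theta t - INR i).
  by apply: Rmult_le_pos => //; apply: Rabs_pos.
have coef_ge0 : 0 <= alpha j / alpha t * Rabs (falling (theta j) i).
  by apply: Rmult_le_pos => //; apply: Rabs_pos.
apply: Rle_trans (Rmult_le_compat_r _ _ _ main_ge0 (Rmult_le_compat_l _ _ _ coef_ge0 scale_le)).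
apply: Rle_trans (_ : alpha j / alpha t * Rpower D (theta j - theta t) * Rabs (c t) *
    Rabs (falling (theta j) i) * (Rpower x (theta j - theta t) * Rpower x (theta t - INR i)) <= _).
  apply: Rmult_le_compat_r; first by apply: Rmult_le_pos.
  by apply: Rmult_le_compat_r; [apply: Rabs_pos|apply: dom].
by apply: Req_le; ring.
Qed.

Lemma deriv_upper_term_eq0 i c x j : (t < j < d)%N -> theta j < INR i ->
  c j * falling (theta j) i * Rpower x (theta j - INR i) = 0.
Proof.
move=> j_range lt_i; have [z eq_z] := theta_int j_range.
have z_ge1 : (1 <= z)%Z by apply: le_IZR; rewrite -eq_z; apply: theta_ge1; lia.
have eq_nat : theta j = INR (Z.to_nat z) by rewrite eq_z INR_IZR_INZ Z2Nat.id //; lia.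
rewrite eq_nat falling_INR_eq0; first ring.
by apply/ltP/INR_lt; rewrite -eq_nat.
Qed.

(* Beyond the largest exponent only the non-integral exponents survive in the
   derivative, and the largest of those dominates. *)
Lemma power_sum_deriv_main i : (forall j, (j < d)%N -> theta j < INR i) ->
  for_large (fun M => forall c D x, dominated D c -> 0 < D -> 0 < x -> M <= D * x ->
    Rabs (power_sum_deriv c i x - c t * falling (theta t) i * Rpower x (theta t - INR i)) <=
    / 2 * (Rabs (c t) * Rabs (falling (theta t) i) * Rpower x (theta t - INR i))).
Proof.
move=> theta_lt_i; set ff := Rabs (falling (theta t) i).
have ff_gt0 : 0 < ff by apply: Rabs_pos_lt; apply: falling_neq0.
have d_gt0 : 0 < INR d by apply: lt_0_INR; lia.
have alpha_t_gt0 := alpha_gt0 lt_td.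
pose share := ff / (2 * INR d); have share_gt0 : 0 < share by apply: Rdiv_lt_0_compat; lra.
have lower_small : for_large (fun M => forall j, (j < t)%N ->
    alpha j / alpha t * Rabs (falling (theta j) i) * Rpower M (theta j - theta t) <= share).
  apply: for_large_forall_ord => j lt_jt.
  have neg : theta j - theta t < 0 by have := theta_lt lt_jt; lra.
  have := for_large_and (for_large_ge 1)
    (for_large_mul_Rpower_le (alpha j / alpha t * Rabs (falling (theta j) i) / share) neg).
  apply: for_large_imp => M [M_ge1]; rewrite Rpower_O; last lra.
  move=> /(Rmult_le_compat_r share _ _ (Rlt_le _ _ share_gt0)); rewrite Rmult_1_l; apply: Rle_trans.
  by apply: Req_le; field; lra.
have := for_large_and (for_large_ge 1) lower_small.
apply: for_large_imp => M [M_ge1 {}lower_small] c D x dom D_gt0 x_gt0 M_le.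
set main := Rabs (c t) * Rpower x (theta t - INR i).
have main_ge0 : 0 <= main by apply: Rmult_le_pos => //; apply: Rabs_pos.
have -> : / 2 * (Rabs (c t) * ff * Rpower x (theta t - INR i)) = INR (d - 0) * (share * main).
  by rewrite subn0 /share /main; field; lra.
have term_bound_ge0 : 0 <= share * main by nra.
rewrite /power_sum_deriv (bigD1_seq t) ?mem_index_iota ?iota_uniq //=.
rewrite /Rminus Rplus_comm -Rplus_assoc Rplus_opp_l Rplus_0_l.
apply: Rle_trans (Rabs_rsum _ _ _ _) _; apply: rsum_le_const => // j j_range neq_jt.
case: (ltnP j t) => [lt_jt|le_tj]; last first.
  by rewrite deriv_upper_term_eq0 ?Rabs_R0 //; [lia|apply: theta_lt_i].
apply: Rle_trans (deriv_lower_term_le i lt_jt dom D_gt0 x_gt0 (M := M) _) _; first lra.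
by apply: Rmult_le_compat_r => //; apply: lower_small.
Qed.

Section VdcSize.
Variable k : nat.
Hypothesis theta_lt_k : forall j, (j < d)%N -> theta j < INR k.+1.

Let F1 := Rabs (falling (theta t) k.+1).
Let F2 := Rabs (falling (theta t) k.+2).

Let Rpower_sub_INR A i : 0 < A -> Rpower A (theta t - INR i) = Rpower A (theta t) / A ^ i.
Proof. by move=> A_gt0; rewrite /Rminus Rpower_plus Rpower_Ropp Rpower_pow. Qed.

Let Rpower_dyadic_bounds A x i : 0 < A -> A <= x <= 2 * A -> theta t <= INR i ->
  Rpower 2 (theta t - INR i) * (Rpower A (theta t) / A ^ i) <= Rpower x (theta t - INR i) <=
  Rpower A (theta t) / A ^ i.
Proof.
move=> A_gt0 x_range le_i; rewrite -Rpower_sub_INR // Rpower_mult_distr //; last lra.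
by split; apply: Rle_Rpower_l_npos; lra.
Qed.

Lemma power_sum_vdc_size : for_large (fun M => forall D A c,
  0 < D -> 0 < A -> M <= D * A -> dominated D c -> 0 < c t * falling (theta t) k.+1 ->
  vdc_size k (F1 / 2 * Rpower 2 (theta t - INR k.+1)) (3 / 2 * F1) (3 / 2 * F2)
    A (Rabs (c t) * Rpower A (theta t)) (power_sum_deriv c)).
Proof.
have theta_lt_kS j : (j < d)%N -> theta j < INR k.+2
  by move=> /theta_lt_k; rewrite (S_INR k.+1); lra.
have := for_large_and (power_sum_deriv_main theta_lt_k) (power_sum_deriv_main theta_lt_kS).
apply: for_large_imp => M [main1 main2] D A c D_gt0 A_gt0 M_le dom sign.
have M_le_x x : A <= x -> M <= D * x.
  by move=> le_Ax; apply: Rle_trans M_le _; apply: Rmult_le_compat_l; lra.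
split; [exact: power_sum_deriv_tower|split=> x x_range].
- have := main1 c D x dom D_gt0 ltac:(lra) (M_le_x x ltac:(lra)).
  have := Rpower_dyadic_bounds A_gt0 x_range (Rlt_le _ _ (theta_lt_k lt_td)).
  rewrite -/F1; set X := Rpower x _; set P := Rpower A _ / _; set w := Rpower 2 _ => X_bounds.
  have -> : c t * falling (theta t) k.+1 * X = Rabs (c t) * F1 * X.
    by rewrite -Rabs_mult Rabs_pos_eq //; lra.
  have coef_ge0 : 0 <= Rabs (c t) * F1 by apply: Rmult_le_pos; apply: Rabs_pos.
  have := Rmult_le_compat_l _ _ _ coef_ge0 (proj1 X_bounds).
  have := Rmult_le_compat_l _ _ _ coef_ge0 (proj2 X_bounds).
  move=> le_P ge_P /Rabs_le_between near; rewrite /Rdiv !Rmult_assoc -/(Rdiv _ _).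
  by rewrite -!(Rmult_assoc (Rabs (c t))) /P /Rdiv in le_P ge_P *; lra.
have := main2 c D x dom D_gt0 ltac:(lra) (M_le_x x ltac:(lra)).
have := Rpower_dyadic_bounds A_gt0 x_range (Rlt_le _ _ (theta_lt_kS _ lt_td)).
rewrite -/F2; set X := Rpower x _; set P := Rpower A _ / _ => X_bounds near.
have coef_ge0 : 0 <= Rabs (c t) * F2 by apply: Rmult_le_pos; apply: Rabs_pos.
have := Rmult_le_compat_l _ _ _ coef_ge0 (proj2 X_bounds).
set y := power_sum_deriv c k.+2 x in near *; set y0 := c t * _ * X in near.
have := Rabs_triang (y - y0) y0; have -> : y - y0 + y0 = y by ring.
have -> : Rabs y0 = Rabs (c t) * F2 * X.
  by rewrite /y0 (Rabs_mult _ X) (Rabs_mult (c t)) (Rabs_pos_eq X (Rpower_ge0 _ _)).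
by rewrite /P /Rdiv; lra.
Qed.

End VdcSize.

Lemma power_sum_opp c x : power_sum (fun j => - c j) x = - power_sum c x.
Proof.
rewrite /power_sum (big_morph Ropp Ropp_plus_distr Ropp_0).
by apply: eq_bigr => j _; ring.
Qed.

Definition admissible (M D : R) (c : nat -> R) : Prop :=
  1 <= D <= 2 * Rpower M (3 / 4) /\ dominated D c /\
  alpha t * (Rpower M (- / 16) * Rpower D (theta t - 1)) <= Rabs (c t) /\
  Rabs (c t) <= alpha t * (Rpower M (/ 16) * Rpower D (theta t)).

Definition power_sum_saving (rho M : R) : Prop := forall D c a b, admissible M D c ->
  (forall n, (a <= n < b)%N -> M <= D * INR n <= 2 * M) ->
  Cmod (\csum_(a <= n < b) expi (power_sum c (INR n))) <= M / D * Rpower M (- rho).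

Lemma admissible_opp M D c : admissible M D c -> admissible M D (fun j => - c j).
Proof.
move=> [D_range [dom [c_ge c_le]]]; split=> //; rewrite Rabs_Ropp; split=> // j lt_jt.
by rewrite !Rabs_Ropp; apply: dom.
Qed.

Lemma admissible_neq0 M D c : admissible M D c -> c t <> 0.
Proof.
move=> [_ [_ [c_ge _]]] c0; rewrite c0 Rabs_R0 in c_ge; apply: (Rle_not_lt _ _ c_ge).
by apply: Rmult_lt_0_compat; [apply: alpha_gt0|apply: Rmult_lt_0_compat].
Qed.

(* Up to complex conjugation the leading derivative is positive. *)
Lemma power_sum_saving_of_sign rho M i :
  (forall D c a b, 0 < c t * falling (theta t) i -> admissible M D c ->
     (forall n, (a <= n < b)%N -> M <= D * INR n <= 2 * M) ->
     Cmod (\csum_(a <= n < b) expi (power_sum c (INR n))) <= M / D * Rpower M (- rho)) ->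
  power_sum_saving rho M.
Proof.
move=> saving D c a b adm ab_range.
have prod_neq0 : c t * falling (theta t) i <> 0.
  by apply: Rmult_integral_contrapositive_currified;
    [apply: admissible_neq0 adm|apply: falling_neq0].
case: (Rlt_or_le 0 (c t * falling (theta t) i)) => [pos|neg]; first exact: saving.
rewrite -Cmod_csum_expi_opp; under eq_bigr do rewrite -power_sum_opp.
by apply: saving (admissible_opp adm) ab_range; lra.
Qed.

Lemma exists_power_sum_saving : exists rho, 0 < rho <= / 4 /\ for_large (power_sum_saving rho).
Proof.
have [B [B_ge1 theta_le_B]] := theta_bounded; have theta_t_le := theta_le_B t lt_td.
have [k' [_ lt_k]] := @nfloor_ex (4 * B + 8) ltac:(lra); pose k := k'.+1.
have {lt_k} k_ge : 4 * B + 8 <= INR k by rewrite S_INR; lra.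
have theta_lt_k j : (j < d)%N -> theta j < INR k.+1 by move=> /theta_le_B; rewrite S_INR; lra.
have theta_t_ge1 := theta_ge1 lt_td; have alpha_t_gt0 := alpha_gt0 lt_td.
pose F1 := Rabs (falling (theta t) k.+1); pose F2 := Rabs (falling (theta t) k.+2).
have F1_gt0 : 0 < F1 by apply/Rabs_pos_lt/falling_neq0.
pose c1 := F1 / 2 * Rpower 2 (theta t - INR k.+1); pose c2 := 3 / 2 * F1; pose c3 := 3 / 2 * F2.
have c1_gt0 : 0 < c1 by apply: Rmult_lt_0_compat => //; lra.
have c2_gt0 : 0 < c2 by rewrite /c2; lra.
have c3_ge0 : 0 <= c3 by have := Rabs_pos (falling (theta t) k.+2); rewrite /c3 /F2; lra.
have [rho1 [rho1_gt0 saving]] := vdc_power_saving k c1_gt0 c2_gt0 c3_ge0.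
exists (Rmin rho1 (/ 4)); split; first by split; [apply: Rmin_pos; lra|apply: Rmin_r].
have := for_large_and saving (for_large_and (power_sum_vdc_size theta_lt_k) (for_large_and
  (@for_large_le_Rpower (/ (c2 * alpha t)) (/ 16) ltac:(lra)) (for_large_and
  (@for_large_mul_Rpower_le (2 ^ k.+1 * (2 * c2 * alpha t)) (1 + (theta t + / 16)) (INR k.+1 / 4)
    ltac:(rewrite S_INR; lra)) (for_large_and (@for_large_le_Rpower 2 (/ 4) ltac:(lra))
      (for_large_ge 1))))).
apply: for_large_imp => M [{}saving [size [lower [upper [M_quarter M_ge1]]]]].
apply: (@power_sum_saving_of_sign _ _ k.+1) => D c a b sign [D_range [dom [c_ge c_le]]] ab_range.
pose A := M / D; have DA : D * A = M by rewrite /A; field; lra.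
have A_ge1 : 1 <= A by have := div_quarter_ge M_ge1 D_range; rewrite -/A; lra.
have A_le : A <= M by rewrite -DA; nra.
have c_t_gt0 : 0 < Rabs (c t).
  by apply: Rabs_pos_lt => c0; rewrite c0 Rmult_0_l in sign; lra.
under eq_bigr do rewrite -power_sum_deriv0.
apply: (Rle_trans _ (A * Rpower M (- rho1))); last first.
  by apply: Rmult_le_compat_l; [lra|apply: Rle_Rpower => //; have := Rmin_l rho1 (/ 4); lra].
have scale_large : 1 <= c2 * alpha t * Rpower M (/ 16).
  have c2_alpha_gt0 : 0 < c2 * alpha t by apply: Rmult_lt_0_compat.
  by have := Rmult_le_compat_l _ _ _ (Rlt_le _ _ c2_alpha_gt0) lower; rewrite Rinv_r; lra.
apply: (saving A (Rabs (c t) * Rpower A (theta t))) => //.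
- by apply: Rmult_lt_0_compat.
- exact: scale_sqrt_le D_range c_ge scale_large.
- exact: scale_pow_ge D_range c_le upper.
- by apply: size dom sign; lra.
by move=> n /ab_range; rewrite -DA => n_range; split; apply: (Rmult_le_reg_l D); lra.
Qed.

Local Notation f := (power_sum alpha).

Lemma dominated_scale beta D e :
  (forall j, (j <= t)%N -> 0 <= e j <= Rpower D (theta j - theta t) * e t) ->
  dominated D (fun j => beta * (alpha j * e j)).
Proof.
move=> e_bounds j lt_jt; have alpha_t_gt0 := alpha_gt0 lt_td.
have alpha_j_gt0 : 0 < alpha j by apply: alpha_gt0; lia.
have [e_j_ge0 e_j_le] := e_bounds j (ltnW lt_jt); have [e_t_ge0 _] := e_bounds t (leqnn t).
rewrite !Rabs_mult (Rabs_pos_eq (alpha j)) ?(Rabs_pos_eq (alpha t)) ?(Rabs_pos_eq (e j))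
  ?(Rabs_pos_eq (e t)); try lra.
have -> : alpha j / alpha t * Rpower D (theta j - theta t) * (Rabs beta * (alpha t * e t)) =
    Rabs beta * (alpha j * (Rpower D (theta j - theta t) * e t)) by field; lra.
by apply: Rmult_le_compat_l; [apply: Rabs_pos|apply: Rmult_le_compat_l; lra].
Qed.

Definition admissible_frequency (M beta : R) : Prop :=
  Rpower M (- / 16) <= Rabs beta <= Rpower M (/ 16).

Lemma admissible_scale M D beta e : 1 <= D <= 2 * Rpower M (3 / 4) -> admissible_frequency M beta ->
  (forall j, (j <= t)%N -> 0 <= e j <= Rpower D (theta j - theta t) * e t) ->
  Rpower D (theta t - 1) <= e t <= Rpower D (theta t) ->
  admissible M D (fun j => beta * (alpha j * e j)).
Proof.
move=> D_range [beta_ge beta_le] e_bounds [e_ge e_le]; split=> //; split;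
  first exact: dominated_scale.
have alpha_t_gt0 := alpha_gt0 lt_td; have [e_t_ge0 _] := e_bounds t (leqnn t).
rewrite !Rabs_mult (Rabs_pos_eq (alpha t)) ?(Rabs_pos_eq (e t)); try lra.
have -> : Rabs beta * (alpha t * e t) = alpha t * (Rabs beta * e t) by ring.
split; (apply: Rmult_le_compat_l; first lra); apply: Rmult_le_compat => //; exact: Rabs_pos.
Qed.

Lemma mul_power_sum beta D n : (0 < D)%N -> (0 < n)%N -> beta * f (INR (D * n)) =
  power_sum (fun j => beta * (alpha j * Rpower (INR D) (theta j))) (INR n).
Proof.
move=> D_gt0 n_gt0; rewrite /power_sum big_distrr; apply: eq_bigr => j _.
by rewrite mult_INR -Rpower_mult_distr /=; [ring| |]; apply: lt_0_INR; lia.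
Qed.

Lemma power_sum_sub c c' x : power_sum c x - power_sum c' x = power_sum (fun j => c j - c' j) x.
Proof.
rewrite /Rminus /power_sum (big_morph Ropp Ropp_plus_distr Ropp_0) -big_split /=.
by apply: eq_bigr => j _; ring.
Qed.

Section Frequency.
Variables (rho beta : R) (M : nat).
Hypotheses (saving : power_sum_saving rho (INR M)) (beta_adm : admissible_frequency (INR M) beta).
Let F n := expi (beta * f (INR n)).

Let scale_range D n : (M <= D * n < 2 * M)%N -> INR M <= INR D * INR n <= 2 * INR M.
Proof. by move=> range; rewrite -INR_2 -!mult_INR; split; apply: le_INR; lia. Qed.

Lemma linear_exp_sum_le D a b : (0 < D)%N -> INR D <= 2 * Rpower (INR M) (3 / 4) ->
  (forall n, (a <= n < b)%N -> (M <= D * n < 2 * M)%N) ->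
  Cmod (\csum_(a <= n < b) F (D * n)%N) <= INR M / INR D * Rpower (INR M) (- rho).
Proof.
move=> D_gt0 D_le ab_range; have D_ge1 : 1 <= INR D by apply: (le_INR 1); lia.
pose c j := beta * (alpha j * Rpower (INR D) (theta j)).
rewrite (@eq_big_nat _ _ _ a b _ (fun n => expi (power_sum c (INR n)))) => [|n n_range]; last first.
  by rewrite /F mul_power_sum //; have := ab_range n n_range; nia.
apply: saving => [|n /ab_range]; last exact: scale_range.
apply: admissible_scale => // [j _|]; last by split; [apply: Rle_Rpower; lra|lra].
by split=> //; apply: Req_le; rewrite -Rpower_plus; congr Rpower; ring.
Qed.

Lemma bilinear_exp_sum_le D r a b : (0 < r < D)%N -> INR D <= 2 * Rpower (INR M) (3 / 4) ->
  (forall n, (a <= n < b)%N -> (M <= D * n < 2 * M)%N) ->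
  Cmod (\csum_(a <= n < b) (F (D * n)%N * Cconj (F (r * n)%N))) <=
  INR M / INR D * Rpower (INR M) (- rho).
Proof.
move=> r_range D_le ab_range; have theta_t_ge1 := theta_ge1 lt_td.
have r_ge1 : 1 <= INR r by apply: (le_INR 1); lia.
have lt_rD : INR r + 1 <= INR D by rewrite -S_INR; apply: le_INR; lia.
pose c j := beta * (alpha j * (Rpower (INR D) (theta j) - Rpower (INR r) (theta j))).
rewrite (@eq_big_nat _ _ _ a b _ (fun n => expi (power_sum c (INR n)))) => [|n n_range]; last first.
  have n_gt0 : (0 < n)%N by have := ab_range n n_range; nia.
  rewrite /F -expi_sub !mul_power_sum //; try lia; rewrite power_sum_sub.
  by congr expi; apply: eq_bigr => j _; rewrite /c; ring.
apply: saving => [|n /ab_range]; last exact: scale_range.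
have pow_le j : 1 <= theta j -> Rpower (INR r) (theta j) <= Rpower (INR D) (theta j).
  by move=> theta_j_ge1; apply: Rle_Rpower_l; lra.
apply: admissible_scale => // [|j le_jt|]; first lra.
- have theta_j_ge1 : 1 <= theta j by apply: theta_ge1; lia.
  have theta_j_le : theta j <= theta t.
    by move: le_jt; rewrite leq_eqVlt => /orP[/eqP->|/theta_lt]; lra.
  split; first by have := pow_le j theta_j_ge1; lra.
  by apply: Rpower_sub_le => //; lra.
split; first by apply: Rpower_sub_ge => //; lra.
by have := Rpower_gt0 (INR r) (theta t); lra.
Qed.

End Frequency.

Lemma mangoldt_exp_sum_saving : exists rho, 0 < rho <= / 4 /\
  for_large (fun X => forall M : nat, INR M = X -> forall beta, admissible_frequency X beta ->
    Cmod (exp_sum M (2 * M) mangoldt (fun n => beta * f (INR n))) <= X * Rpower X (- rho)).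
Proof.
have [rho [rho_range saving]] := exists_power_sum_saving.
exists (rho / 4); split; first lra.
have := for_large_and saving (vaughan_power_saving rho_range).
apply: for_large_imp => X [{}saving vaughan] M eq_X beta beta_adm; subst X.
apply: (vaughan M (fun n => expi (beta * f (INR n)))) => // [n|D a b|D r a b].
- by rewrite Cmod_expi; lra.
- exact: linear_exp_sum_le.
exact: bilinear_exp_sum_le.
Qed.

Definition prime_saving (r : R) (M : nat) : Prop :=
  0 < \rsum_(M <= n < 2 * M) prime_weight n /\
  forall beta, admissible_frequency (INR M) beta ->
  Cmod (exp_sum M (2 * M) prime_weight (fun n => beta * f (INR n))) <=
  (\rsum_(M <= n < 2 * M) prime_weight n) * Rpower (INR M) (- r).

Definition prime_saving_scales (r : R) : Prop :=
  for_large (fun X => forall N : nat, INR N = X ->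
    exists M : nat, (0 < M)%N /\ (2 * M <= N)%N /\ Rpower X (/ 4) <= INR M /\ prime_saving r M).

Lemma for_large_prime_saving : exists r, 0 < r /\
  for_large (fun X => forall M : nat, INR M = X ->
    X * Rpower X (- (r / 2)) <= \rsum_(M <= n < 2 * M) prime_weight n -> prime_saving r M).
Proof.
have [rho [rho_range mangoldt_saving]] := mangoldt_exp_sum_saving.
exists (rho / 2); split; first lra.
have := for_large_and mangoldt_saving (for_large_and (for_large_ge 1) (for_large_and
  (@for_large_ln_pow_le 9 2 (/ 4) ltac:(lra))
    (@for_large_mul_Rpower_le 2 (- (3 * rho / 4)) (- (rho / 2)) ltac:(lra)))).
apply: for_large_imp => X [{}mangoldt_saving [X_ge1 [log_le two_le]]] M eq_X; subst X.
have -> : rho / 2 / 2 = rho / 4 by field.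
set W := \rsum_(M <= n < 2 * M) prime_weight n => W_ge.
have M_gt0 : (0 < M)%N by apply/ltP/INR_lt; rewrite INR_0; lra.
split=> [|beta beta_adm].
  by apply: Rlt_le_trans W_ge; apply: Rmult_lt_0_compat => //; lra.
have nonprime_le : \rsum_(M <= n < 2 * M | ~~ prime n) mangoldt n <= INR M * Rpower (INR M) (- rho).
  apply: Rle_trans (Rle_trans _ _ _ _ (sum_mangoldt_nonprime_le_sqrt M_gt0)) _.
    rewrite [X in _ <= X](@big_cat_nat _ _ _ M) //=; last by lia.
    have : 0 <= \rsum_(1 <= n < M | ~~ prime n) mangoldt n
      by apply: rsum_ge0 => n _ _; apply: mangoldt_ge0.
    by lra.
  apply: Rle_trans (Rmult_le_compat_r _ _ _ (Rpower_ge0 (INR M) (/ 2)) log_le) _.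
  by rewrite -{3}(Rpower_1 (INR M)) -?Rpower_plus; [apply: Rle_Rpower|]; lra.
have := mangoldt_saving M (erefl _) beta beta_adm.
have := Cmod_exp_sum_prime_weight_le M (2 * M) (fun n => beta * f (INR n)).
move=> prime_le mangoldt_le; apply: Rle_trans (_ : INR M * (2 * Rpower (INR M) (- rho)) <= _);
  first lra.
apply: Rle_trans (Rmult_le_compat_r _ _ _ (Rpower_ge0 _ _) W_ge).
rewrite Rmult_assoc; apply: Rmult_le_compat_l; first lra.
have -> : Rpower (INR M) (- rho) = Rpower (INR M) (- (rho / 4)) * Rpower (INR M) (- (3 * rho / 4)).
  by rewrite -Rpower_plus; congr Rpower; field.
by have := Rmult_le_compat_l _ _ _ (Rpower_ge0 (INR M) (- (rho / 4))) two_le; lra.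
Qed.

Lemma exists_prime_saving_scales : exists r, 0 < r /\ prime_saving_scales r.
Proof.
have [r [r_gt0 saving]] := for_large_prime_saving; exists r; split=> //.
have := for_large_and (@for_large_prime_weight_scale (r / 2) ltac:(lra))
  (@for_large_comp_Rpower _ (/ 4) ltac:(lra) saving).
apply: for_large_imp => X [scale {}saving] N eq_X.
have [M [M_gt0 [le_MN [M_ge W_ge]]]] := scale N eq_X.
by exists M; split=> //; split=> //; split=> //; apply: saving M_ge _ _ W_ge.
Qed.

Lemma Rabs_IZR_bounds (h : Z) (K : nat) : (0 < Z.abs h < Z.of_nat K)%Z ->
  1 <= Rabs (IZR h) <= INR K.
Proof. by move=> h_range; rewrite -abs_IZR INR_IZR_INZ; split; apply: IZR_le; lia. Qed.

Lemma prime_saving_divides r M q : prime_saving r M -> (0 < q)%N ->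
  32 * INR q ^ 2 <= Rpower (INR M) (/ 16) -> 64 * INR q ^ 2 < Rpower (INR M) r ->
  exists p, prime p /\ (M <= p < 2 * M)%N /\ (Z.of_nat q | floorZ (f (INR p)))%Z.
Proof.
move=> [W_gt0 saving] q_gt0 q_le q_lt; have q_ge1 : 1 <= INR q by apply: (le_INR 1); lia.
set W := \rsum_(M <= n < 2 * M) prime_weight n in W_gt0 saving.
have inv_q_gt0 : 0 < / (2 * INR q) by apply: Rinv_0_lt_compat; lra.
have eq_K : INR (32 * q * q) = 32 * INR q ^ 2.
  by rewrite !mult_INR (_ : INR 32 = 32); [ring|rewrite INR_IZR_INZ].
have err_ge0 : 0 <= W * Rpower (INR M) (- r) by apply: Rmult_le_pos => //; apply: Rlt_le.
have K_ge : 8 / (/ (2 * INR q)) ^ 2 <= INR (32 * q * q) by apply: Req_le; rewrite eq_K; field; lra.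
have err_lt : 2 * INR (32 * q * q) * (W * Rpower (INR M) (- r)) < W.
  have := Rmult_lt_compat_r _ _ _ (Rpower_gt0 (INR M) (- r)) q_lt; rewrite Rpower_mulN => lt_1.
  by have := Rmult_lt_compat_l _ _ _ W_gt0 lt_1; rewrite eq_K; lra.
pose x n := f (INR n) / INR q - / (2 * INR q).
have sum_le (h : Z) : (0 < Z.abs h < Z.of_nat (32 * q * q))%Z ->
    Cmod (exp_sum M (2 * M) prime_weight (fun n => IZR h * x n)) <= W * Rpower (INR M) (- r).
  move=> h_range; rewrite (@eq_exp_sum _ _ _ _
    (fun n => IZR h * / INR q * f (INR n) + - (IZR h * / (2 * INR q)))) => [|n];
      last by rewrite /x; field; lra.
  rewrite Cmod_exp_sum_addr; apply: saving.
  have [h_ge1 h_le] := Rabs_IZR_bounds h_range; rewrite eq_K in h_le.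
  have q_inv : 0 < / INR q <= 1.
    by split; [apply: Rinv_0_lt_compat|rewrite -Rinv_1; apply: Rinv_le_contravar]; lra.
  rewrite /admissible_frequency Rabs_mult (Rabs_pos_eq (/ _)); last lra.
  split; last by nra.
  rewrite Rpower_Ropp; apply: Rle_trans (_ : / INR q <= _); last by nra.
  by apply: Rinv_le_contravar; [lra|nra].
have [p [p_range [p_weight close]]] :=
  exists_dist_int_lt prime_weight_ge0 err_ge0 inv_q_gt0 W_gt0 K_ge err_lt sum_le.
exists p; split; first exact: prime_weight_gt0.
by split=> //; apply: divide_floorZ.
Qed.

Lemma prime_saving_equidistributed r M K w xi : prime_saving r M -> 1 <= INR M ->
  0 < w <= / 2 -> 16 / w ^ 2 <= INR K ->
  INR K * (1 + Rabs xi) <= Rpower (INR M) (/ 16) -> 4 * INR K ^ 2 <= Rpower (INR M) r ->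
  (forall k : Z, (0 < Z.abs k < Z.of_nat K)%Z ->
    Rpower (INR M) (- / 16) <= dist_int (IZR k * xi)) ->
  exists p, prime p /\ (M <= p < 2 * M)%N /\
    dist_int (xi * IZR (floorZ (f (INR p)))) <= (1 + 2 * Rabs xi) * w.
Proof.
move=> [W_gt0 saving] M_ge1 [w_gt0 w_le] K_ge K_le K_sqr_le far.
set W := \rsum_(M <= n < 2 * M) prime_weight n in W_gt0 saving.
have err_ge0 : 0 <= W * Rpower (INR M) (- r) by apply: Rmult_le_pos => //; apply: Rlt_le.
have err_le : 4 * INR K ^ 2 * (W * Rpower (INR M) (- r)) <= W.
  have := Rmult_le_compat_r _ _ _ (Rpower_ge0 (INR M) (- r)) K_sqr_le; rewrite Rpower_mulN => le_1.
  by have := Rmult_le_compat_l _ _ _ (Rlt_le _ _ W_gt0) le_1; lra.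
have abs_le (z : Z) : (Z.abs z < Z.of_nat K)%Z -> Rabs (IZR z) <= INR K.
  by move=> lt_z; rewrite -abs_IZR INR_IZR_INZ; apply: IZR_le; lia.
have sum_le (h k : Z) : (Z.abs h < Z.of_nat K)%Z -> (Z.abs k < Z.of_nat K)%Z ->
    (h, k) <> (0, 0)%Z -> Cmod (exp_sum M (2 * M) prime_weight
      (fun n => IZR h * (f (INR n) - w) + IZR k * (xi * f (INR n)))) <=
    W * Rpower (INR M) (- r).
  move=> h_lt k_lt neq0; rewrite (@eq_exp_sum _ _ _ _
    (fun n => (IZR h + IZR k * xi) * f (INR n) + - (IZR h * w))) => [|n]; last by ring.
  rewrite Cmod_exp_sum_addr; apply: saving; split; last first.
    apply: Rle_trans K_le; apply: Rle_trans (Rabs_triang _ _) _; rewrite Rabs_mult.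
    by have := abs_le h h_lt; have := Rmult_le_compat_r _ _ _ (Rabs_pos xi) (abs_le k k_lt); lra.
  case: (Z.eq_dec k 0) => [k0|k_neq0]; last first.
    apply: Rle_trans (far k ltac:(lia)) _; apply: Rle_trans (dist_int_le _ (- h)) _.
    by rewrite opp_IZR; apply: Req_le; congr Rabs; ring.
  rewrite k0 Rmult_0_l Rplus_0_r; have h_neq0 : h <> 0%Z by move=> h0; apply: neq0; rewrite h0 k0.
  have := @Rabs_IZR_bounds h K ltac:(lia).
  by have := @Rle_Rpower (INR M) (- / 16) 0 M_ge1 ltac:(lra); rewrite Rpower_O; lra.
have [p [p_range [p_weight [close close']]]] :=
  exists_dist_int_lt2 prime_weight_ge0 err_ge0 w_gt0 W_gt0 K_ge err_le sum_le.
exists p; split; first exact: prime_weight_gt0.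
by split=> //; apply: dist_int_mul_floorZ_le.
Qed.

Lemma power_sum_growth : exists B Cf, 1 <= B /\ 0 < Cf /\
  forall x, 1 <= x -> 0 <= f x <= Cf * Rpower x B.
Proof.
have [B [B_ge1 theta_le_B]] := theta_bounded.
have alpha_ge0 j : (0 <= j < d)%N -> 0 <= alpha j by move=> lt_jd; apply/Rlt_le/alpha_gt0.
have sum_ge0 : 0 <= \rsum_(0 <= j < d) alpha j by apply: rsum_ge0 => j /alpha_ge0.
exists B, (1 + \rsum_(0 <= j < d) alpha j); split=> //; split; first lra.
move=> x x_ge1; split.
  by apply: rsum_ge0 => j /alpha_ge0 alpha_j_ge0 _; apply: Rmult_le_pos.
apply: Rle_trans (_ : \rsum_(0 <= j < d) (alpha j * Rpower x B) <= _).
  apply: rsum_le => j j_range _; apply: Rmult_le_compat_l; first exact: alpha_ge0.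
  by apply: Rle_Rpower => //; apply: theta_le_B.
by rewrite -big_distrl /=; have := Rpower_gt0 x B; lra.
Qed.

Lemma prime_saving_scales_Rpower r s : 0 < s -> prime_saving_scales r ->
  for_large (fun X => exists M, (0 < M)%N /\ INR (2 * M) <= Rpower X s /\
    Rpower X (s / 8) <= INR M /\ prime_saving r M).
Proof.
move=> s_gt0 scales.
have := for_large_and (for_large_comp_Rpower (_ : 0 < s / 2) scales) (for_large_and (for_large_ge 1)
  (@for_large_mul_Rpower_le 2 (s / 2) s ltac:(lra))).
move=> /(_ ltac:(lra)); apply: for_large_imp => X [scale [X_ge1 power_le]].
have [N N_range] := nfloor_ex (Rpower X s) (Rpower_ge0 X s).
have half_ge1 := @Rpower_ge1 X (s / 2) X_ge1 ltac:(lra).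
have N_ge : Rpower X (s / 2) <= INR N by lra.
have [M [M_gt0 [le_MN [M_ge saving]]]] := scale _ N_ge N (erefl _).
exists M; split=> //; split; last split=> //.
  by apply: Rle_trans (proj1 N_range); apply: le_INR; lia.
apply: Rle_trans M_ge; have -> : s / 8 = s / 2 * / 4 by field.
by apply: Rpower_mul_le => //; lra.
Qed.

(* A prime [p] with [k | floorZ (f p)] multiplies the error [dist_int (k * xi)] by at
   most [f p], so [p] is taken from a scale [X ^ s] with [X ^ (s * B) = X ^ (1 / 128)]. *)
Lemma close_multiple_prime r s B Cf e xi : 0 < r -> prime_saving_scales r ->
  (forall x, 1 <= x -> 0 <= f x <= Cf * Rpower x B) -> 0 <= B -> 0 <= Cf ->
  0 < s <= 1 -> s * B = / 128 -> 4 * e < s / 128 -> 4 * e < s * r / 8 ->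
  for_large (fun X => forall (N K : nat) (k : Z), INR N = X -> INR K <= 17 * Rpower X (2 * e) ->
    (0 < Z.abs k < Z.of_nat K)%Z -> dist_int (IZR k * xi) < Rpower X (- / 64) ->
    exists p, prime p /\ (p <= N)%N /\
      dist_int (xi * IZR (floorZ (f (INR p)))) <= Rpower X (- / 256)).
Proof.
move=> r_gt0 scales f_bounds B_ge0 Cf_ge0 [s_gt0 s_le1] sB e_lt e_lt_r.
have := for_large_and (prime_saving_scales_Rpower s_gt0 scales)
  (for_large_and (for_large_ge 1) (for_large_and
  (for_large_mul_Rpower_le (32 * 289) e_lt) (for_large_and
  (for_large_mul_Rpower_le (65 * 289) e_lt_r)
  (@for_large_mul_Rpower_le Cf (- / 128) (- / 256) ltac:(lra))))).
apply: for_large_imp => X [scale [X_ge1 [q_le [q_lt Cf_le]]]] N K k eq_X K_le k_range close.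
have [M [M_gt0 [M_le [M_ge saving]]]] := scale.
pose q := Z.abs_nat k; have q_gt0 : (0 < q)%N by lia.
have [_ INR_q_le] := Rabs_IZR_bounds k_range.
have eq_q : INR q = Rabs (IZR k) by rewrite INR_IZR_INZ Zabs2Nat.id_abs abs_IZR.
have q_sqr : INR q ^ 2 <= 289 * Rpower X (4 * e).
  have q_bound : INR q <= 17 * Rpower X (2 * e) by rewrite eq_q; lra.
  have := sqr_le_mul_Rpower (conj (pos_INR q) q_bound).
  by rewrite -Rmult_assoc (_ : 2 * 2 = 4); lra.
have M_16 : Rpower X (s / 128) <= Rpower (INR M) (/ 16).
  by have -> : s / 128 = s / 8 * / 16 by [field]; apply: Rpower_mul_le => //; lra.
have M_r : Rpower X (s * r / 8) <= Rpower (INR M) r.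
  by have -> : s * r / 8 = s / 8 * r by [field]; apply: Rpower_mul_le => //; lra.
have [p [p_prime [p_range q_dvd]]] := prime_saving_divides saving q_gt0 ltac:(lra)
  ltac:(have := Rpower_gt0 X (4 * e); lra).
have p_ge1 : 1 <= INR p by apply: (le_INR 1); lia.
have p_le : INR p <= Rpower X s by apply: Rle_trans M_le; apply: le_INR; lia.
exists p; split=> //; split.
  apply/leP/INR_le; rewrite eq_X; apply: Rle_trans p_le _.
  by rewrite -{2}(Rpower_1 X); [apply: Rle_Rpower|]; lra.
have k_dvd : (k | floorZ (f (INR p)))%Z by apply/Z.divide_abs_l; rewrite -Zabs2Nat.id_abs.
have [f_ge0 f_le] := f_bounds _ p_ge1.
apply: Rle_trans (dist_int_divide_floorZ_le xi _ f_ge0 k_dvd) _; first by lia.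
apply: Rle_trans Cf_le; have -> : - / 128 = s * B + - / 64 by rewrite sB; field.
rewrite Rpower_plus -Rmult_assoc; apply: Rmult_le_compat (Rlt_le _ _ close) => //;
  first exact: dist_int_ge0.
apply: Rle_trans f_le _; apply: Rmult_le_compat_l => //.
by rewrite -Rpower_mult; apply: Rle_Rpower_l => //; lra.
Qed.

Lemma far_multiples_prime r e xi : 0 < r -> prime_saving_scales r -> 0 < e ->
  2 * e < / 64 -> 4 * e < r / 4 ->
  for_large (fun X => forall N K : nat, INR N = X ->
    16 * Rpower X (2 * e) <= INR K <= 17 * Rpower X (2 * e) ->
    (forall k : Z, (0 < Z.abs k < Z.of_nat K)%Z -> Rpower X (- / 64) <= dist_int (IZR k * xi)) ->
    exists p, prime p /\ (p <= N)%N /\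
      dist_int (xi * IZR (floorZ (f (INR p)))) <= Rpower X (- (e / 2))).
Proof.
move=> r_gt0 scales e_gt0 e_lt e_lt_r; have xi_ge0 := Rabs_pos xi.
have := for_large_and scales (for_large_and (for_large_le_Rpower 2 e_gt0) (for_large_and
  (for_large_mul_Rpower_le (17 * (1 + Rabs xi)) e_lt) (for_large_and
  (for_large_mul_Rpower_le (4 * 289) e_lt_r)
  (for_large_and (@for_large_mul_Rpower_le (1 + 2 * Rabs xi) (- e) (- (e / 2)) ltac:(lra))
    (for_large_ge 1))))).
apply: for_large_imp => X [scale [X_e_ge2 [xi_le [K_sqr_le [w_le X_ge1]]]]] N K eq_X K_range far.
have [M [M_gt0 [le_MN [M_ge saving]]]] := scale N eq_X.
have M_ge1 : 1 <= INR M by apply: (le_INR 1); lia.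
have M_16 : Rpower X (/ 64) <= Rpower (INR M) (/ 16).
  by have -> : / 64 = / 4 * / 16 by [field]; apply: Rpower_mul_le => //; lra.
have M_16N : Rpower (INR M) (- / 16) <= Rpower X (- / 64).
  by have -> : / 64 = / 4 * / 16 by [field]; apply: Rpower_mulN_le => //; lra.
have M_r : Rpower X (r / 4) <= Rpower (INR M) r.
  by have -> : r / 4 = / 4 * r by [field]; apply: Rpower_mul_le => //; lra.
set w := Rpower X (- e); set v := Rpower X (2 * e) in xi_le K_range.
have w_gt0 : 0 < w by apply: Rpower_gt0.
have w_le_half : w <= / 2 by rewrite /w Rpower_Ropp; apply: Rinv_le_contravar; lra.
have vw : v * w ^ 2 = 1.
  by rewrite Rpower_sqr (_ : 2 * - e = - (2 * e)) ?Rpower_mulN; [|ring].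
have K_ge : 16 / w ^ 2 <= INR K.
  by apply/(Rle_div_l 16); [apply: pow_lt|have := pow2_ge_0 w; nra].
have K_le : INR K * (1 + Rabs xi) <= Rpower (INR M) (/ 16).
  apply: Rle_trans M_16; apply: Rle_trans xi_le.
  by have := Rmult_le_compat_r (1 + Rabs xi) _ _ ltac:(lra) (proj2 K_range); lra.
have K_sqr : INR K ^ 2 <= 289 * Rpower X (4 * e).
  have := sqr_le_mul_Rpower (conj (pos_INR K) (proj2 K_range)).
  by rewrite -Rmult_assoc (_ : 2 * 2 = 4); lra.
have [p [p_prime [p_range p_close]]] :=
  prime_saving_equidistributed saving M_ge1 (conj w_gt0 w_le_half)
  K_ge K_le ltac:(lra) (fun k k_range => Rle_trans _ _ _ M_16N (far k k_range)).
exists p; split=> //; split; first by lia.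
exact: Rle_trans p_close w_le.
Qed.

Lemma dist_int_power_sum_primes : exists eta, 0 < eta /\
  forall xi, for_large (fun X => forall N : nat, INR N = X -> exists p, prime p /\ (p <= N)%N /\
    dist_int (xi * IZR (floorZ (f (INR p)))) <= Rpower X (- eta)).
Proof.
have [r [r_gt0 scales]] := exists_prime_saving_scales;
  have [B [Cf [B_ge1 [Cf_gt0 f_bounds]]]] := power_sum_growth.
pose s := / (128 * B).
have s_gt0 : 0 < s by apply: Rinv_0_lt_compat; lra.
have sB : s * B = / 128 by rewrite /s; field; lra.
have s_le : s <= / 128 by nra.
pose r' := Rmin (/ 16) r.
have r'_gt0 : 0 < r' by apply: Rmin_glb_lt; lra.
have r'_le : r' <= / 16 by apply: Rmin_l.
have r'_le_r : r' <= r by apply: Rmin_r.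
pose e := s * r' / 64; have e_gt0 : 0 < e by rewrite /e; nra.
exists (e / 2); split=> [|xi]; first lra.
have := for_large_and (for_large_ge 1) (for_large_and
  (@close_multiple_prime r s B Cf e xi r_gt0 scales f_bounds ltac:(lra) ltac:(lra) ltac:(lra) sB
    ltac:(rewrite /e; nra) ltac:(rewrite /e; nra))
  (@far_multiples_prime r e xi r_gt0 scales e_gt0 ltac:(rewrite /e; nra) ltac:(rewrite /e; nra))).
apply: for_large_imp => X [X_ge1 [close far]] N eq_X.
have v_ge1 := @Rpower_ge1 X (2 * e) X_ge1 ltac:(lra).
have [K K_range] := nfloor_ex (17 * Rpower X (2 * e)) ltac:(lra).
case: (classic (exists k : Z, (0 < Z.abs k < Z.of_nat K)%Z /\
  dist_int (IZR k * xi) < Rpower X (- / 64))).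
  move=> [k [k_range k_close]]; have [p [p_prime [p_le p_close]]] :=
    close N K k eq_X (proj1 K_range) k_range k_close.
  exists p; split=> //; split=> //; apply: Rle_trans p_close _.
  by apply: Rle_Rpower => //; rewrite /e; nra.
move=> none; apply: (far N K) => // [|k k_range]; first lra.
by apply: Rnot_lt_le => k_close; apply: none; exists k.
Qed.

End PowerSums.

Lemma pseudo_polyE d alpha theta x : pseudo_poly d alpha theta x = power_sum d theta alpha x.
Proof.
rewrite /pseudo_poly /power_sum -{2}(add0n d).
elim: d 0%N => [|d IH] a; first by rewrite addn0 big_geq.
by rewrite /= IH addSnnS [RHS]big_ltn //; lia.
Qed.

Lemma Zprime_of_nat p : prime p -> Znumtheory.prime (Z.of_nat p).
Proof.
move=> p_prime; have p_gt1 := prime_gt1 p_prime.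
apply/prime_alt; split=> [|n n_range [k eq_p]]; first by lia.
have n_dvd : (Z.to_nat n %| p)%N.
  apply/dvdnP; exists (Z.to_nat k).
  by apply: Nat2Z.inj; rewrite eq_p -multE Nat2Z.inj_mul !Z2Nat.id //; lia.
by move/primeP: p_prime => [_ /(_ _ n_dvd)] /orP[] /eqP; lia.
Qed.

Lemma exists_last_index (P : nat -> Prop) d : (exists j, (j < d)%N /\ P j) ->
  exists t, (t < d)%N /\ P t /\ forall j, (t < j < d)%N -> ~ P j.
Proof.
elim: d => [|d IH] [j [lt_jd Pj]] //.
case: (classic (P d)) => Pd; first by exists d; split=> //; split=> // i; lia.
have lt_jd' : (j < d)%N by case: (ltngtP j d) => // [|eq_jd]; [lia|case: Pd; rewrite -eq_jd].
have [t [lt_td [Pt after_t]]] := IH (ex_intro _ j (conj lt_jd' Pj)).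
exists t; split; [by lia|split=> // i i_range].
by case: (eqVneq i d) => [->//|neq_id]; apply: after_t; lia.
Qed.

Lemma dist_int_pseudo_poly_primes d alpha theta : is_pseudo_poly d alpha theta ->
  exists eta, 0 < eta /\ forall xi, for_large (fun X => forall N : nat, INR N = X ->
    exists p, Znumtheory.prime (Z.of_nat p) /\ (le 1 p /\ le p N) /\
      dist_int (xi * IZR (floorZ (pseudo_poly d alpha theta (INR p)))) <= Rpower X (- eta)).
Proof.
move=> [_ [alpha_gt0 [theta_0 [theta_S [j [lt_jd theta_j_nonint]]]]]].
have theta_lt i i' : (i < i')%N -> (i' < d)%N -> theta i < theta i'.
  elim: i' => // i' IH; rewrite ltnS leq_eqVlt => /orP[/eqP->|lt_i] lt_d;
    first by apply: theta_S; lia.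
  by have := IH lt_i ltac:(lia); have := theta_S i' ltac:(lia); lra.
have theta_ge1 i : (i < d)%N -> 1 <= theta i.
  by case: i => // i lt_id; have := theta_lt 0%N i.+1 isT lt_id; lra.
have [t [lt_td [theta_t_nonint after_t]]] :=
  @exists_last_index (fun i => forall z : Z, theta i <> IZR z) d
  (ex_intro _ j (conj (introT ltP lt_jd) theta_j_nonint)).
have theta_int i : (t < i < d)%N -> exists z : Z, theta i = IZR z.
  by move=> /after_t nonint; apply: NNPP => none; apply: nonint => z eq_z; apply: none; exists z.
have [eta [eta_gt0 dist_le]] := @dist_int_power_sum_primes d t alpha theta lt_td
  (fun i lt_id => alpha_gt0 i (elimT ltP lt_id)) theta_ge1 (fun i lt_it => theta_lt i t lt_it lt_td)
  theta_t_nonint theta_int.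
exists eta; split=> // xi; apply: for_large_imp (dist_le xi) => X {}dist_le N eq_X.
have [p [p_prime [le_pN p_close]]] := dist_le N eq_X; exists p; rewrite pseudo_polyE.
by split; [apply: Zprime_of_nat|split=> //; have := prime_gt0 p_prime; lia].
Qed.

End PrimeValues.

Theorem theorem2p9 (d : nat) (alpha theta : nat -> R) :
  is_pseudo_poly d alpha theta ->
  exists eta C : R, 0 < eta /\ 0 < C /\
    forall xi : R, exists N0 : nat, forall N : nat, (N0 <= N)%nat ->
      exists p : nat, (1 <= p <= N)%nat /\ prime (Z.of_nat p) /\
        dist_int (xi * IZR (floorZ (pseudo_poly d alpha theta (INR p))))
          <= C * Rpower (INR N) (- eta).
Proof.
intros f_pseudo_poly.
destruct (PrimeValues.dist_int_pseudo_poly_primes f_pseudo_poly) as [eta [eta_gt0 dist_le]].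
exists eta, 1; split; [exact eta_gt0|split; [exact Rlt_0_1|intros xi]].
destruct (PrimeValues.for_large_INR (dist_le xi)) as [N0 N0_large]; exists N0; intros N N_large.
destruct (N0_large N N_large N eq_refl) as [p [p_prime [p_range p_close]]].
exists p; rewrite Rmult_1_l; auto.
Qed.
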